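(* If $G$ is a graph that is $K_{3,3}$-free, i.e. $G$ does not contain $K_{3,3}$ as a minor, then the cycle matroid $M(G)$ has a cycle system.
   Context: Graphs are finite, possibly with loops and multiple edges; the cycle matroid $M(G)$ has ground set $E(G)$ and independent sets the forests of $G$. $K_{3,3}$ is the complete bipartite graph with parts of size 3. The corank of a matroid $M$ is $g(M)=|E(M)|-r(M)$. A *cycle* of a matroid is a union of circuits. Unique union: for a family $\mathcal{A}=\{A_1,\dots,A_g\}$ of subsets of a set and $\sigma\subseteq[g]=\{1,\dots,g\}$, $\mathcal{A}_\sigma$ is the set of elements $e\in\bigcup_{i\in\sigma}A_i$ for which there is exactly one $i\in\sigma$ with $e\in A_i$. A *cycle system* for $M$ is a collection $\mathcal{C}=\{C_1,\dots,C_g\}$ of cycles of $M$ with $g=g(M)$ such that for every nonempty $\sigma\subseteq[g]$ the unique union $\mathcal{C}_\sigma$ is dependent in $M$. *)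

(* Defs.v *)
From mathcomp Require Import all_boot.

Set Implicit Arguments.
Unset Strict Implicit.
Unset Printing Implicit Defensive.

Record matroid (T : finType) := Matroid {
  indep : {set T} -> bool;
  indep0 : indep set0;
  indepS : forall A B : {set T}, A \subset B -> indep B -> indep A;
  indep_aug : forall A B : {set T}, indep A -> indep B -> #|A| < #|B| ->
    exists2 x, x \in B :\: A & indep (x |: A) }.

Section MatroidNotions.
Variables (T : finType) (M : matroid T).

Definition dependent (A : {set T}) : bool := ~~ indep M A.

Definition rank : nat := \max_(A : {set T} | indep M A) #|A|.

Definition corank : nat := #|T| - rank.

Definition circuit (C : {set T}) : bool := minset dependent C.

Definition is_cycle (A : {set T}) : Prop :=
  exists2 P : {set {set T}}, (forall C, C \in P -> circuit C) & A = cover P.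

(* The elements lying in exactly one of the [A i], [i \in s]. *)
Definition unique_union (I : finType) (A : I -> {set T}) (s : {set I}) :
  {set T} := [set e | #|[set i in s | e \in A i]| == 1].

(* A family is used instead of a set of cycles; this changes nothing, since
   [C i = C j] with [i != j] makes the unique union over [[set i; j]] empty,
   hence independent. *)
Definition cycle_system (C : 'I_corank -> {set T}) : Prop :=
  (forall i, is_cycle (C i)) /\
  (forall s : {set 'I_corank}, s != set0 -> dependent (unique_union C s)).

Definition has_cycle_system : Prop := exists C, cycle_system C.

End MatroidNotions.

(* An edge has one end (a loop) or two. *)
Record mgraph := MGraph {
  vertex :> finType;
  edge : finType;
  ends : edge -> {set vertex};
  ends_card : forall e, 0 < #|ends e| <= 2 }.

Section Graph.
Variable G : mgraph.
Implicit Types (F : {set edge G}) (e : edge G) (x y u v : G).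

(* A graph cycle v_0 e_0 v_1 e_1 ... v_(k-1) e_(k-1) v_0; a loop is one with
   k = 1 and a pair of parallel edges is one with k = 2. *)
Definition is_polygon k (v : {ffun 'I_k -> G}) (g : {ffun 'I_k -> edge G}) :=
  [&& injectiveb v, injectiveb g
    & [forall i, ends (g i) == [set v i; v (ordS i)]]].

(* The bound on the length costs nothing as [v] is injective. *)
Definition forest F : bool :=
  ~~ [exists k : 'I_#|G|, exists v : {ffun 'I_k.+1 -> G},
      exists g : {ffun 'I_k.+1 -> edge G},
        is_polygon v g && [forall i, g i \in F]].

Definition adjacent F : rel G := [rel x y | [exists e in F, ends e == [set x; y]]].

Definition linked F : rel G := connect (adjacent F).

Lemma forestPn F :
  reflect (exists k, exists v : {ffun 'I_k.+1 -> G},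
           exists g : {ffun 'I_k.+1 -> edge G},
             is_polygon v g /\ forall i, g i \in F)
          (~~ forest F).
Proof.
rewrite negbK; apply: (iffP existsP) => [[k /existsP[v /existsP[g]]]|].
  by case/andP=> vg /forallP gF; exists k, v, g.
case=> k [v [g [vg gF]]].
have lt_k : k < #|G|.
  by case/and3P: (vg) => /injectiveP/leq_card; rewrite card_ord.
exists (Ordinal lt_k); apply/existsP; exists v; apply/existsP; exists g.
by rewrite vg; apply/forallP.
Qed.

Lemma forest0 : forest set0.
Proof.
by apply: contraT => /forestPn[k [v [g [_ /(_ ord0)]]]]; rewrite inE.
Qed.

Lemma forestS F1 F2 : F1 \subset F2 -> forest F2 -> forest F1.
Proof.
move=> /subsetP sF; apply: contraLR => /forestPn[k [v [g [vg gF]]]].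
by apply/forestPn; exists k, v, g; split=> // i; apply: sF.
Qed.

Lemma endsE e : exists u v, ends e = [set u; v].
Proof.
have := ends_card e; case: (set_0Vmem (ends e)) => [->|[u ue]].
  by rewrite cards0.
rewrite (cardsD1 u) ue /= ltnS.
case: (set_0Vmem (ends e :\ u)) => [D0 _|[v vD]].
  by exists u, u; rewrite -(setD1K ue) D0 setU0 setUid.
rewrite (cardsD1 v) vD ltnS leqn0 cards_eq0 => /eqP D0.
by exists u, v; rewrite -(setD1K ue) -(setD1K vD) D0 setU0.
Qed.

Lemma adjacent_sym F : symmetric (adjacent F).
Proof. by move=> x y /=; apply: eq_existsb => e; rewrite setUC. Qed.

Lemma linked_sym F : symmetric (linked F).
Proof. exact/sym_connect_sym/adjacent_sym. Qed.

Lemma linkedW F1 F2 x y : (forall e u v, e \in F1 -> ends e = [set u; v] ->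
  linked F2 u v) -> linked F1 x y -> linked F2 x y.
Proof.
move=> sF; apply: connect_sub => a b /exists_inP[e eF /eqP].
exact: sF.
Qed.

Lemma set2_eq (a b c d : G) : [set a; b] = [set c; d] ->
  (a = c /\ b = d) \/ (a = d /\ b = c).
Proof.
move/setP=> E; have Ea := E a; have Eb := E b; have Ec := E c; have Ed := E d.
move: Ea Eb Ec Ed; rewrite !inE !eqxx ?orbT /=.
move=> /esym/orP[]/eqP aE /esym/orP[]/eqP bE /orP[]/eqP cE /orP[]/eqP dE.
all: by first [left; split; congruence | right; split; congruence].
Qed.

Lemma linked_not_forest F e u v :
  e \notin F -> ends e = [set u; v] -> linked F u v -> ~~ forest (e |: F).
Proof.
move=> eF + /connectP[p0 up0 vE]; rewrite {}vE.
case/shortenP: up0 => p up Up _ ue.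
pose w i := nth u (u :: p) i.
have w_eq i j : i <= size p -> j <= size p -> w i = w j -> i = j.
  by move=> ip jp /eqP; rewrite nth_uniq //= => /eqP.
pose d a b := odflt e [pick f in F | ends f == [set a; b]].
have dP i : i < size p ->
    d (w i) (w i.+1) \in F /\ ends (d (w i) (w i.+1)) = [set w i; w i.+1].
  move=> ip; have /exists_inP[f fF fE] := pathP u up i ip.
  rewrite /d; case: pickP => [f' /andP[? /eqP]|/(_ f)] //=.
  by rewrite fF fE.
have wlast : w (size p) = last u p by rewrite /w -nth_last; case: (p).
pose vs := [ffun i : 'I_(size p).+1 => w i].
pose g := [ffun i : 'I_(size p).+1 =>
             if i < size p then d (w i) (w i.+1) else e].
apply/forestPn; exists (size p), vs, g; split=> [|i]; last first.
  rewrite ffunE; case: ifP => [/dP[iF _]|_]; first exact: setU1r.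
  exact: setU11.
have ge (i : 'I_(size p).+1) : i < size p = false -> i = size p :> nat.
  by move=> h; apply/eqP; rewrite eqn_leq -ltnS ltn_ord leqNgt h.
apply/and3P; split; last apply/forallP => i.
- apply/injectiveP => i j; rewrite !ffunE => /w_eq ij.
  by apply/val_inj/ij; rewrite -ltnS.
- apply/injectiveP => i j; rewrite !ffunE.
  case: ifP => [ip|/ge ip]; case: ifP => [jp|/ge jp].
  + have [_ iE] := dP _ ip; have [_ jE] := dP _ jp => ij.
    have: [set w i; w i.+1] = [set w j; w j.+1] by rewrite -iE -jE ij.
    case/set2_eq=> -[ij1 ij2].
      by apply/val_inj/w_eq; rewrite // ltnW.
    have eq1 : i = j.+1 :> nat by apply: w_eq => //; apply: ltnW.
    have eq2 : i.+1 = j by apply: w_eq => //; apply: ltnW.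
    by have := ltn_eqF (leqnSn j.+1 : j < j.+2); rewrite -eq1 eq2 eqxx.
  + by move=> ij; have [] := dP _ ip; rewrite ij (negPf eF).
  + by move=> ij; have [] := dP _ jp; rewrite -ij (negPf eF).
  + by move=> _; apply: val_inj; rewrite /= ip jp.
- rewrite !ffunE /=; case: ifP => [ip|/ge ip].
    by rewrite modn_small ?ltnS //; have [_ ->] := dP _ ip.
  by rewrite ip modnn wlast ue setUC.
Qed.

Lemma forest_add F e u v :
  ends e = [set u; v] -> forest F -> ~~ linked F u v -> forest (e |: F).
Proof.
move=> ue fF; apply: contraNT => /forestPn[k [w [g [+ gF]]]].
case/and3P=> w_inj g_inj /forallP wg.
have [i0 i0e] : exists i, g i = e.
  apply/'exists_eqP; apply: contraLR fF; rewrite negb_exists => /forallP ge.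
  apply/forestPn; exists k, w, g; split=> [|i].
    by apply/and3P; split=> //; apply/forallP.
  by have := gF i; rewrite in_setU1 (negPf (ge i)).
pose i1 m := iter m (@ordS _) (ordS i0).
have val_i1 m : i1 m = (i0 + m.+1) %% k.+1 :> nat.
  elim: m => [|m IHm]; first by rewrite addn1.
  have -> : i1 m.+1 = (i1 m).+1 %% k.+1 :> nat by [].
  by rewrite IHm -(addn1 (_ %% _)) modnDml -addnA addn1.
have lnk m : m <= k -> linked F (w (ordS i0)) (w (i1 m)).
  elim: m => [|m IHm] mk; first exact: connect0.
  apply: connect_trans (IHm (ltnW mk)) _; apply: connect1.
  apply/exists_inP; exists (g (i1 m)); last exact: wg.
  have := gF (i1 m); rewrite in_setU1 => /orP[|//].
  rewrite -i0e => /eqP/(injectiveP _ g_inj)/(congr1 val) /= /eqP.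
  rewrite val_i1 -{2}[nat_of_ord i0]addn0 -[X in _ == X](@modn_small _ k.+1).
    by rewrite eqn_modDl mod0n modn_small.
  by rewrite addn0.
have i1k : i1 k = i0 by apply: val_inj; rewrite /= val_i1 modnDr modn_small.
have := lnk k (leqnn k); rewrite i1k => l0.
have := eqP (wg i0); rewrite i0e ue => /set2_eq[] [-> ->] //.
by rewrite linked_sym.
Qed.

Let cls F x := [set y | linked F x y].
Let ncls F := #|[set cls F x | x in [set: G]]|.

Let cls_eq F x y : (cls F x == cls F y) = linked F x y.
Proof.
apply/eqP/idP => [E|xy]; first by have := connect0 (adjacent F) y;
  rewrite -/(linked F y y) -[linked F x y]in_set -/(cls F x) E inE.
by apply/setP => z; rewrite !inE; apply: (same_connect (linked_sym F)).
Qed.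

Let merge F1 F2 : (forall x y, linked F1 x y -> linked F2 x y) ->
  exists h, forall x, h (cls F1 x) = cls F2 x.
Proof.
move=> s12; exists (fun X : {set G} => \bigcup_(x in X) cls F2 x) => x.
apply/eqP; rewrite eqEsubset; apply/andP; split.
  apply/bigcupsP => y; rewrite inE => /s12 xy.
  by rewrite (_ : cls F2 y = cls F2 x) //; apply/esym/eqP; rewrite cls_eq.
by apply: (bigcup_max x) => //; rewrite inE; apply: connect0.
Qed.

Let ncls_le F1 F2 : (forall x y, linked F1 x y -> linked F2 x y) ->
  ncls F2 <= ncls F1.
Proof.
move=> /merge[h hE]; rewrite /ncls.
rewrite (_ : [set cls F2 x | x in _] = h @: [set cls F1 x | x in [set: G]]).
  exact: leq_imset_card.
by rewrite -imset_comp; apply: eq_imset => x /=; rewrite hE.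
Qed.

Let linkedU F e x y : linked F x y -> linked (e |: F) x y.
Proof.
apply: linkedW => f a b fF fE; apply: connect1; apply/exists_inP.
by exists f; rewrite ?fE ?eqxx // setU1r.
Qed.

Let linked_new F e u v : ends e = [set u; v] -> linked (e |: F) u v.
Proof.
move=> ue; apply: connect1; apply/exists_inP.
by exists e; rewrite ?ue ?setU11.
Qed.

Let ncls_lt F e u v : ends e = [set u; v] -> ~~ linked F u v ->
  ncls (e |: F) < ncls F.
Proof.
move=> ue uv; have [h hE] := merge (@linkedU F e).
rewrite /ncls [in X in _ < X](cardsD1 (cls F v)) imset_f ?inE // add1n ltnS.
set D := _ :\ _.
apply: leq_trans (leq_imset_card h D); apply/subset_leq_card/subsetP.
move=> _ /imsetP[x _ ->]; have [xv|xv] := boolP (linked F x v); last first.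
  rewrite -hE; apply: imset_f.
  by rewrite in_setD1 cls_eq xv imset_f ?inE.
have -> : cls (e |: F) x = cls (e |: F) u.
  apply/eqP; rewrite cls_eq; apply: connect_trans (linkedU e xv) _.
  by rewrite -/(linked _ v u) linked_sym; apply: linked_new.
by rewrite -hE; apply: imset_f; rewrite in_setD1 cls_eq uv imset_f ?inE.
Qed.

Let linked_addE F e u v x y : ends e = [set u; v] -> linked (e |: F) x y ->
  linked F x y \/ ((linked F x u || linked F x v) /\
                   (linked F y u || linked F y v)).
Proof.
move=> ue /connectP[p + ->]; elim: p x => [|z p IHp] x /=.
  by move=> _; left; apply: connect0.
case/andP=> /exists_inP[f fF /eqP fE] /IHp IH.
move: fF; rewrite in_setU1 => /orP[/eqP fe|fF]; last first.
  have xz : linked F x z.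
    by apply: connect1; apply/exists_inP; exists f; rewrite ?fE.
  case: IH => [zy|[zuv yuv]]; [left|right]; first exact: connect_trans xz zy.
  split=> //; case/orP: zuv => h; apply/orP; [left|right];
    exact: connect_trans xz h.
have xzuv : (x == u) || (x == v).
  by have := set21 x z; rewrite -fE fe ue !inE.
have zuv : (z == u) || (z == v).
  by have := set22 x z; rewrite -fE fe ue !inE.
right; split.
  by case/orP: xzuv => /eqP->; apply/orP; [left | right]; apply: connect0.
case: IH => [zy|[_ //]]; move: zy; rewrite linked_sym.
by case/orP: zuv => /eqP-> ->; rewrite ?orbT.
Qed.

Let ncls_add F e : ncls F <= (ncls (e |: F)).+1.
Proof.
have [u [v ue]] := endsE e; have [h hE] := merge (@linkedU F e).
rewrite /ncls (cardsD1 (cls F v)) imset_f ?inE // add1n ltnS.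
set D := _ :\ _; rewrite -(card_in_imset (f := h) (D := D)).
  apply/subset_leq_card/subsetP => _ /imsetP[X + ->].
  by rewrite in_setD1 => /andP[_ /imsetP[x _ ->]]; rewrite hE imset_f.
move=> X Y; rewrite !in_setD1 => /andP[+ /imsetP[x _ XE]].
move=> + /andP[+ /imsetP[y _ YE]]; rewrite {}XE {}YE !cls_eq !hE => xv yv.
move/eqP; rewrite cls_eq => /(linked_addE ue).
rewrite (negPf xv) (negPf yv) !orbF => -[xy|[xu yu]]; apply/eqP.
  by rewrite cls_eq.
by rewrite cls_eq; apply: connect_trans xu _; rewrite [connect _ _ _]linked_sym.
Qed.

Let ncls0 : ncls set0 = #|G|.
Proof.
rewrite /ncls card_imset ?cardsT // => x y /eqP; rewrite cls_eq.
case/connectP=> -[|z p] /=; first by move=> _ ->.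
by case/andP=> /exists_inP[e]; rewrite inE.
Qed.

Let ncls_ge F : #|G| <= ncls F + #|F|.
Proof.
move: {2}_.+1 (ltnSn #|F|) => n; elim: n F => // n IHn F.
case: (set_0Vmem F) => [->|[e eF]]; first by rewrite ncls0 leq_addr.
rewrite (cardsD1 e) eF add1n ltnS => /IHn /leq_trans; apply.
by rewrite addnS -addSn leq_add2r -{2}(setD1K eF) ncls_add.
Qed.

Let ncls_forest F : forest F -> ncls F + #|F| <= #|G|.
Proof.
move: {2}_.+1 (ltnSn #|F|) => n; elim: n F => // n IHn F.
case: (set_0Vmem F) => [->|[e eF]]; first by rewrite ncls0 cards0 addn0.
have [u [v ue]] := endsE e.
rewrite (cardsD1 e) eF add1n ltnS => /IHn IH fF.
apply: leq_trans (IH (forestS (subD1set _ _) fF)).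
rewrite addnS -addSn leq_add2r -{1}(setD1K eF) (ncls_lt ue) //.
apply: contraL fF => /(linked_not_forest _ ue); rewrite setD1K //; apply.
by rewrite setD11.
Qed.

Lemma forest_aug F1 F2 : forest F1 -> forest F2 -> #|F1| < #|F2| ->
  exists2 e, e \in F2 :\: F1 & forest (e |: F1).
Proof.
move=> fF1 fF2 lt12.
case: (pickP (fun e => (e \in F2 :\: F1) && forest (e |: F1))).
  by move=> e /andP[]; exists e.
move=> no; have : ncls F1 <= ncls F2.
  apply: ncls_le => x y; apply: linkedW => e u v eF2 ue.
  have [eF1|eF1] := boolP (e \in F1).
    by apply: connect1; apply/exists_inP; exists e; rewrite ?ue.
  apply: contraFT (no e) => uv; rewrite in_setD eF1 eF2 /=.
  exact: forest_add ue fF1 uv.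
have := ncls_ge F1; have := ncls_forest fF2 => h2 h1 h.
have := leq_trans h2 h1; rewrite leqNgt => /negP[].
by rewrite -addnS leq_add.
Qed.

Definition cycle_matroid : matroid (edge G) :=
  Matroid forest0 forestS forest_aug.

End Graph.

(* [H] is isomorphic to the graph obtained from [G] by contracting each of the
   disjoint nonempty connected sets [B x] to the vertex [x], keeping the edges
   [f e] and deleting all other vertices and edges. The sets [B x] are connected
   by the edges that are not kept, so that these can be contracted. The ends of
   [f e] become the vertices [x] whose [B x] they lie in. *)
Definition is_minor (H G : mgraph) : Prop :=
  exists (B : H -> {set G}) (f : edge H -> edge G),
  [/\ injective f,
      forall x, B x != set0,
      forall x y, x != y -> [disjoint B x & B y],
      forall x, {in B x &, forall a b,
        linked [set e | (e \notin codom f) && (ends e \subset B x)] a b}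
    & forall e, ends (f e) \subset \bigcup_x B x /\
        ends e = [set x | ~~ [disjoint B x & ends (f e)]]].

Definition K33_ends (e : 'I_3 * 'I_3) : {set 'I_3 + 'I_3} :=
  [set inl e.1; inr e.2].

Lemma K33_ends_card e : 0 < #|K33_ends e| <= 2.
Proof. by rewrite cards2. Qed.

Definition K33 : mgraph := MGraph K33_ends_card.

Definition K33_free (G : mgraph) : Prop := ~ is_minor K33 G.

(* Main.v *)
(* A graph with a MacLane 2-basis (independent even sets spanning the
   cycle space, every edge in at most two of them) has a cycle system, since unique
   unions are then symmetric differences. By induction on the number of edges,
   every edge e of a K33-free graph lies in exactly one member of some cycle system.
   The extra control at e allows gluing systems along 1- and 2-separations, so the
   graph may be assumed simple and 3-connected. Then the peripheral cycles (induced
   cycles with connected complement) span the cycle space, by Tutte. If no edge lies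
   in three of them, a basis among them is a 2-basis. If some edge does, there is a
   K33 minor or the graph is K5, and in K5, or in any cone, the triangles through
   the apex form a cycle system. *)
Require Import Defs.
From mathcomp Require Import all_boot.
From mathcomp Require Import zify.

Set Implicit Arguments.
Unset Strict Implicit.
Unset Printing Implicit Defensive.

(** * Connected sets and K33 minors of a relation *)

(** A graph is an end map [h] on fixed vertex and edge types together with an edge set [F], so that
    subgraphs and the parts of a 2-sum differ only in [F] and in the ends of one edge. K33 minors
    are expressed for the adjacency relation by connected branch sets, so nothing is ever
    contracted. Over GF(2) the even sets form a space whose dimension is the corank, and the unique
    union of a family is its sum as long as no edge is covered more than twice.

    The obstacle is K5: it has no K33 minor, but it is not planar and so has no 2-basis. The unique
    unions in its cycle system need not be even; they contain a cycle because only the apex can be a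
    leaf of them.

    The control at [e] is forced by 2-sums. A member using the virtual edge must be completed
    through the other side. If a single member there contains the virtual edge, it serves as the
    completion for all of them, and a family of the 2-sum behaves on that side like a family of the
    second system; with several such members this correspondence fails. *)

Ltac arith_term b :=
  lazymatch b with
  | leq _ _ => idtac
  | @eq_op _ ?x _ => lazymatch type of x with nat => idtac end
  | ?a && ?c => arith_term a; arith_term c
  | ?a || ?c => arith_term a; arith_term c
  | ~~ ?a => arith_term a
  end.

Ltac arith_hyp T :=
  lazymatch T with
  | is_true ?b => arith_term b
  | ?b = false => arith_term b
  | @eq nat _ _ => idtac
  | ?A \/ ?B => arith_hyp A; arith_hyp B
  end.

(** Hypotheses that are not arithmetic over [nat] are cleared before [lia] runs, since the contexts
    of the cycle arguments are large. *)
Ltac nlia := repeat match goal with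
  | H : ?T |- _ => tryif arith_hyp T then fail else clear H end; lia.

Section ConnectedSets.
Variables (V : finType) (r : rel V).
Implicit Types (A B K P Q R S X : {set V}) (x y z : V).

Definition restr K : rel V := fun x y => [&& r x y, x \in K & y \in K].

Definition conn K := [forall a in K, forall b in K, connect (restr K) a b].

Definition adj A B := [exists a in A, exists b in B, r a b].

Definition component K x := [set y | connect (restr K) x y].

Lemma connP K : reflect {in K &, forall a b, connect (restr K) a b} (conn K).
Proof.
apply: (iffP forall_inP) => [h a b aK bK|h a aK].
  exact: (forall_inP (h a aK)).
by apply/forall_inP => b; apply: h.
Qed.

Lemma adjP A B : reflect (exists a b, [/\ a \in A, b \in B & r a b]) (adj A B).
Proof.
apply: (iffP exists_inP) => [[a aA /exists_inP[b bB ab]]|[a [b [aA bB ab]]]].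
  by exists a, b.
by exists a => //; apply/exists_inP; exists b.
Qed.

Lemma adj_mono A A' B B' :
  A \subset A' -> B \subset B' -> adj A B -> adj A' B'.
Proof.
move=> /subsetP sA /subsetP sB /adjP[a [b [aA bB ab]]].
by apply/adjP; exists a, b; split; auto.
Qed.

Lemma adj_sub1 A B A' : A \subset A' -> adj A B -> adj A' B.
Proof. by move=> s; apply: adj_mono. Qed.

Lemma adj_sub2 A B B' : B \subset B' -> adj A B -> adj A B'.
Proof. by move=> s; apply: adj_mono. Qed.

Lemma restrS K K' : K \subset K' -> subrel (restr K) (restr K').
Proof. by move=> /subsetP s x y /and3P[xy /s xK /s yK]; apply/and3P. Qed.

Lemma connect_restrS K K' : K \subset K' ->
  subrel (connect (restr K)) (connect (restr K')).
Proof.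
by move=> s; apply: connect_sub => x y /(restrS s); apply: connect1.
Qed.

Lemma connect_inv K A x y : (forall a b, a \in A -> b \in K -> r a b -> b \in A) ->
  x \in A -> connect (restr K) x y -> y \in A.
Proof.
move=> cl xA /connectP[p + ->]; elim: p x xA => //= z p IH x xA.
by case/andP=> /and3P[xz _ zK] /IH; apply; apply: cl xz.
Qed.

Lemma conn_closed K A x : conn K ->
  (forall a b, a \in A -> a \in K -> b \in K -> r a b -> b \in A) ->
  x \in K -> x \in A -> K \subset A.
Proof.
move=> /connP cK cl xK xA; apply/subsetP => y yK.
suff: y \in A :&: K by case/setIP.
apply: (connect_inv _ _ (cK x y xK yK)); last by rewrite inE xA.
by move=> a b /setIP[aA aK] bK ab; rewrite inE bK andbT; apply: cl ab.
Qed.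

Hypothesis r_sym : symmetric r.

Lemma adjC A B : adj A B = adj B A.
Proof.
apply/adjP/adjP => -[a [b [aA bB ab]]]; exists b, a; split=> //;
by rewrite r_sym.
Qed.

Lemma restr_sym K : symmetric (restr K).
Proof. by move=> x y; rewrite /restr r_sym [(y \in K) && _]andbC. Qed.

Lemma connect_restr_sym K x y : connect (restr K) x y = connect (restr K) y x.
Proof. exact/sym_connect_sym/restr_sym. Qed.

Lemma connI K x : (forall y, y \in K -> connect (restr K) x y) -> conn K.
Proof.
move=> h; apply/connP => a b aK bK; apply: connect_trans (h b bK).
by rewrite connect_restr_sym h.
Qed.

Lemma conn1 x : conn [set x].
Proof. by apply: (@connI _ x) => y /set1P ->. Qed.

Lemma connU A B : conn A -> conn B -> adj A B || ~~ [disjoint A & B] ->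
  conn (A :|: B).
Proof.
move=> /connP cA /connP cB AB.
have [a [b [aA bB ab]]] : exists a b, [/\ a \in A, b \in B &
    connect (restr (A :|: B)) a b].
  case/orP: AB => [/adjP[a [b [aA bB ab]]]|/pred0Pn[c /andP[/= ? ?]]].
    by exists a, b; split=> //; apply: connect1; rewrite /restr ab !inE aA bB orbT.
  by exists c, c.
have cA' x : x \in A -> connect (restr (A :|: B)) a x.
  by move=> xA; apply: connect_restrS (cA a x aA xA); apply: subsetUl.
apply: (@connI _ a) => y /setUP[/cA' //|yB]; apply: connect_trans ab _.
by apply: connect_restrS (cB b y bB yB); apply: subsetUr.
Qed.

Lemma comp_refl K x : x \in component K x.
Proof. by rewrite inE. Qed.

Lemma comp_sub K x : x \in K -> component K x \subset K.
Proof.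
move=> xK; apply/subsetP => y; rewrite inE; apply: connect_inv => //.
Qed.

Lemma comp_closed K x y z : x \in K -> y \in component K x -> z \in K -> r y z ->
  z \in component K x.
Proof.
move=> xK yC zK yz; have yK := subsetP (comp_sub xK) _ yC.
move: yC; rewrite !inE => /connect_trans; apply; apply: connect1.
by rewrite /restr yz yK.
Qed.

Lemma comp_conn K x : x \in K -> conn (component K x).
Proof.
move=> xK; apply: (@connI _ x) => y; rewrite inE.
have h : connect (restr (component K x)) x x by [].
suff: forall a, connect (restr (component K x)) x a -> connect (restr K) a y ->
  connect (restr (component K x)) x y by apply.
move=> a xa /connectP[p + ->]; elim: p a xa => //= b p IH a xa.
case/andP=> /and3P[ab aK bK]; apply: IH; apply: connect_trans (xa) _.
have aC : a \in component K x.
  by rewrite inE; apply: connect_restrS xa; apply: comp_sub.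
by apply: connect1; rewrite /restr ab aC (comp_closed xK aC bK ab).
Qed.

(** Otherwise the component would be closed under adjacency in [K], hence contain all of [K], which
    meets [Q]. *)
Lemma comp_adj K Q x : conn K -> x \in K :\: Q -> K :&: Q != set0 ->
  adj (component (K :\: Q) x) Q.
Proof.
move=> cK xKQ /set0Pn[q /setIP[qK qQ]]; apply: contraT => /adjP nadj.
have xK : x \in K by case/setDP: xKQ.
suff /subsetP/(_ q qK) : K \subset component (K :\: Q) x.
  by move=> /(subsetP (comp_sub xKQ)); rewrite inE qQ.
apply: (conn_closed cK _ xK); last exact: comp_refl.
move=> a b aC _ bK ab; apply: (comp_closed xKQ aC _ ab).
rewrite inE bK andbT; apply/negP => bQ; apply: nadj.
by exists a, b.
Qed.

(** This replaces the interior of a shortest path from [P] to [Q]. [W] collects [P] and the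
    components of the rest that touch it; if none of these touches [Q], then [W] is closed in [K]
    and never reaches [Q]. *)
Lemma cross K P Q : conn K -> P \subset K -> Q \subset K -> P != set0 ->
  Q != set0 -> [disjoint P & Q] -> ~~ adj P Q ->
  exists R, [/\ conn R, R \subset K :\: (P :|: Q), adj R P & adj R Q].
Proof.
move=> cK sP sQ /set0Pn[x xP] /set0Pn[y yQ] dPQ nPQ.
set M := K :\: (P :|: Q).
pose W := P :|: [set z in M | adj (component M z) P].
case: (boolP [exists z in M, adj (component M z) P && adj (component M z) Q]).
  case/exists_inP=> z zM /andP[zP zQ]; exists (component M z); split=> //.
    exact: comp_conn.
  exact: comp_sub.
rewrite negb_exists_in => /forall_inP no.
have /subsetP/(_ y (subsetP sQ _ yQ)) : K \subset W.
  apply: (conn_closed cK _ (subsetP sP _ xP)); last by rewrite inE xP.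
  move=> a b aW aK bK ab; rewrite inE.
  have [//|bP] := boolP (b \in P); rewrite /= inE.
  have bQ : b \notin Q.
    apply/negP => bQ; case/setUP: aW => [aP|].
      by move/negP: nPQ; apply; apply/adjP; exists a, b.
    rewrite inE => /andP[aM aP]; move: (no a aM); rewrite aP /=.
    move/negP; apply; apply/adjP; exists a, b; split=> //; exact: comp_refl.
  have bM : b \in M by rewrite !inE negb_or bP bQ.
  rewrite bM /=; case/setUP: aW => [aP|].
    by apply/adjP; exists b, a; rewrite comp_refl r_sym.
  rewrite inE => /andP[aM]; apply: adj_sub1; apply/subsetP => c.
  rewrite !inE => /(connect_trans _); apply; apply: connect1.
  by rewrite /restr r_sym ab aM bM.
rewrite inE => /orP[yP|]; first by rewrite (disjointFr dPQ yP) in yQ.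
by rewrite inE => /andP[/setDP[_]]; rewrite inE yQ orbT.
Qed.

(** The branch sets of a K33 minor; the adjacencies force them to be nonempty. *)
Definition has_K33 := exists B : 'I_3 + 'I_3 -> {set V},
  [/\ forall s t, s != t -> [disjoint B s & B t], forall s, conn (B s)
    & forall i j, adj (B (inl i)) (B (inr j))].

Lemma has_K33I A0 A1 A2 B0 B1 B2 :
  [/\ conn A0, conn A1 & conn A2] -> [/\ conn B0, conn B1 & conn B2] ->
  [/\ [disjoint A0 & A1], [disjoint A0 & A2] & [disjoint A1 & A2]] ->
  [/\ [disjoint B0 & B1], [disjoint B0 & B2] & [disjoint B1 & B2]] ->
  [/\ [disjoint A0 & B0], [disjoint A0 & B1] & [disjoint A0 & B2]] ->
  [/\ [disjoint A1 & B0], [disjoint A1 & B1] & [disjoint A1 & B2]] ->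
  [/\ [disjoint A2 & B0], [disjoint A2 & B1] & [disjoint A2 & B2]] ->
  [/\ adj A0 B0, adj A0 B1 & adj A0 B2] ->
  [/\ adj A1 B0, adj A1 B1 & adj A1 B2] ->
  [/\ adj A2 B0, adj A2 B1 & adj A2 B2] -> has_K33.
Proof.
move=> [? ? ?] [? ? ?] [? ? ?] [? ? ?] [? ? ?] [? ? ?] [? ? ?] [? ? ?] [? ? ?].
move=> [? ? ?].
exists (fun s : 'I_3 + 'I_3 => match s with inl i => nth set0 [:: A0; A1; A2] i
                         | inr i => nth set0 [:: B0; B1; B2] i end).
split.
- move=> [[[|[|[|i]]] hi]|[[|[|[|i]]] hi]] [[[|[|[|j]]] hj]|[[|[|[|j]]] hj]] //=;
  by rewrite // disjoint_sym.
- by move=> [[[|[|[|i]]] hi]|[[|[|[|i]]] hi]].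
- by move=> [[|[|[|i]]] hi] [[|[|[|j]]] hj].
Qed.

End ConnectedSets.

Arguments comp_sub {V r K x}.
Arguments connP {V r K}.
Arguments adjP {V r A B}.

(** * Induced and peripheral cycles *)

Lemma disjointI (T : finType) (A B : {set T}) :
  (forall x, x \in A -> x \in B -> False) -> [disjoint A & B].
Proof.
move=> h; apply/pred0P => x /=; apply/negP => /andP[xA]; exact: h.
Qed.

Section InducedCycles.
Variables (V : finType) (r : rel V).
Hypothesis r_sym : symmetric r.
Implicit Types (A B K P Q R S X : {set V}) (x y z : V) (w : nat -> V).

Definition seg w i j := [set x in [seq w k | k <- index_iota i j]].

Lemma segP w i j x : reflect (exists2 k, i <= k < j & x = w k) (x \in seg w i j).
Proof.
rewrite inE; apply: (iffP mapP) => -[k]; rewrite ?mem_index_iota.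
  by move=> h ->; exists k.
by move=> h ->; exists k; rewrite ?mem_index_iota.
Qed.

Lemma mem_seg w i j k : i <= k < j -> w k \in seg w i j.
Proof. by move=> h; apply/segP; exists k. Qed.

(* [w 0, ..., w (n - 1)] are the successive vertices of an induced cycle; the
   values of [w] from [n] on are irrelevant. *)
Definition icyc n w := (2 < n) &&
  [forall i : 'I_n, forall j : 'I_n, ((w i == w j) ==> (i == j)) &&
    (r (w i) (w j) == [|| j == i.+1 :> nat, i == j.+1 :> nat,
      (i == 0 :> nat) && (j == n.-1 :> nat) |
      (j == 0 :> nat) && (i == n.-1 :> nat)])].

Lemma icycP n w : reflect
  [/\ 2 < n, forall i j, i < n -> j < n -> w i = w j -> i = j
    & forall i j, i < n -> j < n -> r (w i) (w j) =
      [|| j == i.+1, i == j.+1, (i == 0) && (j == n.-1) | (j == 0) && (i == n.-1)]]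
  (icyc n w).
Proof.
apply: (iffP andP) => [[n2 /forallP h]|[n2 winj wadj]].
  split=> // i j ilt jlt; have /forallP/(_ (Ordinal jlt))/andP[] := h (Ordinal ilt).
    by move=> /implyP /= h1 _ e; apply/eqP; rewrite -[i == j]/(Ordinal ilt == Ordinal jlt) h1 ?e.
  by move=> _ /eqP.
split=> //; apply/forallP => i; apply/forallP => j; rewrite wadj // eqxx andbT.
by apply/implyP => /eqP/winj h; apply/eqP/val_inj/h.
Qed.

Definition rotw n k w i := w (if i + k < n then i + k else i + k - n).

Lemma seg_rotw n k w : k < n -> seg (rotw n k w) 0 n = seg w 0 n.
Proof.
move=> kn; apply/setP => x; apply/segP/segP => -[i i_n ->].
  rewrite /rotw; case: ifP => h; [exists (i + k) | exists (i + k - n)] => //; nlia.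
have [h|h] := leqP k i; [exists (i - k) | exists (i + n - k)]; try nlia.
  by rewrite /rotw (_ : i - k + k < n); [congr w|]; nlia.
by rewrite /rotw (_ : i + n - k + k < n = false); [congr w|]; nlia.
Qed.

Lemma icyc_rot n k w : k < n -> icyc n w -> icyc n (rotw n k w).
Proof.
move=> kn /icycP[n2 winj wadj]; apply/icycP; split=> // i j i_n j_n; rewrite /rotw.
  by case: ifP => h1; case: ifP => h2 /winj; nlia.
by case: ifP => h1; case: ifP => h2; rewrite wadj; nlia.
Qed.

Definition revw n w i : V := w (n.-1 - i).

Lemma seg_revw n w : seg (revw n w) 0 n = seg w 0 n.
Proof.
apply/setP => x; apply/segP/segP => -[i i_n ->].
  by exists (n.-1 - i) => //; nlia.
by exists (n.-1 - i); [nlia | rewrite /revw; congr w; nlia].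
Qed.

Lemma icyc_rev n w : icyc n w -> icyc n (revw n w).
Proof.
move=> /icycP[n2 winj wadj]; apply/icycP; split=> // i j i_n j_n; rewrite /revw.
  by move/winj; nlia.
by rewrite wadj; nlia.
Qed.

Lemma icyc_start n w x : icyc n w -> x \in seg w 0 n ->
  exists w', [/\ icyc n w', seg w' 0 n = seg w 0 n & w' 0 = x].
Proof.
move=> cw /segP[k /andP[_ kn] ->]; exists (rotw n k w); split.
- exact: icyc_rot.
- exact: seg_rotw.
- by rewrite /rotw add0n kn.
Qed.

(** The cycle is rotated to the vertex just before its first exit from [A]. With another cycle as
    [A], an arc outside that cycle then starts at index 1. *)
Lemma icyc_exit n w A : icyc n w -> (exists2 x, x \in seg w 0 n & x \in A) ->
  ~~ (seg w 0 n \subset A) -> exists w',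
  [/\ icyc n w', seg w' 0 n = seg w 0 n, w' 0 \in A & w' 1 \notin A].
Proof.
move=> cw [x xw xA]; have [w1 [cw1 e1 w10]] := icyc_start cw xw.
rewrite -e1; case/subsetPn=> y /segP[j /andP[_ jn] ->] jA.
have ex : exists j, (j < n) && (w1 j \notin A) by exists j; rewrite jn.
have := @ex_minnP _ ex; case=> i /andP[i_n iA] imin.
case: i iA i_n imin => [|i] iA i_n imin; first by rewrite w10 xA in iA.
have [n2 _ _] := icycP _ _ cw1.
exists (rotw n i w1); split.
- by apply: icyc_rot => //; nlia.
- by rewrite seg_rotw //; nlia.
- rewrite /rotw add0n (_ : i < n); last nlia.
  by apply: contraT => h; have := imin i; rewrite h ltnn (ltnW i_n) => ->.
- by rewrite /rotw add1n i_n.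
Qed.

Lemma conn0 : conn r set0.
Proof. by apply/connP => a b; rewrite inE. Qed.

Lemma segS w i j : i <= j -> seg w i j.+1 = seg w i j :|: [set w j].
Proof.
move=> ij; apply/setP => x; rewrite in_setU in_set1; apply/segP/orP.
  move=> [k kij ->]; have [kj|kj] := ltnP k j.
    by left; apply/segP; exists k => //; nlia.
  by right; rewrite (_ : k = j) //; nlia.
case=> [/segP[k kij ->]|/eqP ->]; first by exists k => //; nlia.
by exists j => //; nlia.
Qed.

Lemma seg_nil w i j : j <= i -> seg w i j = set0.
Proof.
by move=> ji; apply/setP => x; rewrite in_set0; apply/segP => -[k]; nlia.
Qed.

Lemma seg_conn n w i j : icyc n w -> j <= n -> conn r (seg w i j).
Proof.
move=> cw; have [n2 winj wadj] := icycP _ _ cw.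
elim: j => [|j IH] jn; first by rewrite seg_nil //; apply: conn0.
have [ij|ji] := leqP i j; last by rewrite seg_nil //; apply: conn0.
rewrite segS //; have [->|ij'] := eqVneq i j.
  by rewrite seg_nil // set0U; apply: conn1.
apply: (connU r_sym); [by apply: IH; nlia | exact: conn1|].
apply/orP; left; apply/adjP; exists (w j.-1), (w j); rewrite mem_seg ?set11; last nlia.
by split=> //; rewrite wadj; nlia.
Qed.

Lemma icyc_nbr2 n w x : icyc n w -> x \in seg w 0 n -> exists p q,
  [/\ p != q, p \in seg w 0 n, q \in seg w 0 n
    & forall y, y \in seg w 0 n -> r x y = (y == p) || (y == q)].
Proof.
move=> cw xw; have [w1 [cw1 <- <-]] := icyc_start cw xw.
have [n2 winj wadj] := icycP _ _ cw1; exists (w1 1), (w1 n.-1); split.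
- by apply/eqP => /winj; nlia.
- by apply: mem_seg; nlia.
- by apply: mem_seg; nlia.
move=> y /segP[k /andP[_ kn] ->]; rewrite wadj; try nlia.
have e i j : i < n -> j < n -> (w1 i == w1 j) = (i == j).
  by move=> i_n j_n; apply/eqP/eqP => [/winj|->] //; apply.
by rewrite !e; nlia.
Qed.

(** The two neighbours of a vertex on the smaller cycle are also its two neighbours on the larger
    one, so the smaller cycle is closed under adjacency in the larger. *)
Lemma icyc_subset_eq n w m w' : icyc n w -> icyc m w' ->
  seg w 0 n \subset seg w' 0 m -> seg w 0 n = seg w' 0 m.
Proof.
move=> cw cw' s; apply/eqP; rewrite eqEsubset s /=.
have [n2 _ _] := icycP _ _ cw.
have w0 : w 0 \in seg w 0 n by apply: mem_seg; nlia.
apply: (conn_closed (seg_conn _ cw' (leqnn m)) _ (subsetP s _ w0) w0).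
move=> a b aw aw' bw' ab.
have [p [q [pq pw qw wr]]] := icyc_nbr2 cw aw.
have [p' [q' [pq' pw' qw' wr']]] := icyc_nbr2 cw' aw'.
have ap : r a p by rewrite wr // eqxx.
have aq : r a q by rewrite wr // eqxx orbT.
have := wr' _ (subsetP s _ qw); have := wr' _ (subsetP s _ pw).
rewrite ap aq => /esym/orP[]/eqP e1 /esym/orP[]/eqP e2.
- by rewrite e1 e2 eqxx in pq.
- by have := wr' _ bw'; rewrite ab => /esym/orP[]/eqP ->; rewrite -?e1 -?e2.
- by have := wr' _ bw'; rewrite ab => /esym/orP[]/eqP ->; rewrite -?e1 -?e2.
- by rewrite e1 e2 eqxx in pq.
Qed.

(** The length and the vertices range over finite types so that the predicate is boolean and
    peripheral cycles can be collected in a set. *)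
Definition icycle_set X :=
  [exists n : 'I_#|V|.+1, exists f : {ffun 'I_#|V|.+1 -> V},
    icyc n (fun i => f (inord i)) && (X == seg (fun i => f (inord i)) 0 n)].

Lemma eq_icyc n w w' : (forall i, i < n -> w i = w' i) -> icyc n w = icyc n w'.
Proof.
move=> e; rewrite /icyc; congr andb; apply: eq_forallb => i.
by apply: eq_forallb => j; rewrite !e.
Qed.

Lemma eq_seg w w' i j : (forall k, i <= k < j -> w k = w' k) ->
  seg w i j = seg w' i j.
Proof.
by move=> e; apply/setP => x; apply/segP/segP => -[k h ->]; exists k; rewrite ?e.
Qed.

Lemma icycle_setP X :
  reflect (exists n w, icyc n w /\ X = seg w 0 n) (icycle_set X).
Proof.
apply: (iffP existsP) => [[n /existsP[f /andP[cw /eqP ->]]]|[n [w [cw ->]]]].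
  by exists n, (fun i => f (inord i)).
have nV : n <= #|V|.
  have [_ winj _] := icycP _ _ cw.
  have /card_in_imset : {in [set: 'I_n] &, injective (fun i : 'I_n => w i)}.
    by move=> i j _ _ /winj h; apply/val_inj/h.
  by rewrite cardsT card_ord => <-; apply: max_card.
exists (Ordinal (nV : n < #|V|.+1)); apply/existsP.
exists [ffun i : 'I_#|V|.+1 => w i].
have e i : i < n -> [ffun i : 'I_#|V|.+1 => w i] (inord i) = w i.
  by move=> i_n; rewrite ffunE inordK // ltnS; apply: leq_trans (ltnW i_n) nV.
rewrite (eq_icyc e) cw /=; apply/eqP/eq_seg => k /andP[_ /e].
by [].
Qed.

Definition peri S X := [&& icycle_set X, X \subset S & conn r (S :\: X)].

(* The minor has parts [u], [v], [R] and [J], [I], [I'], where [R] joins the two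
   arcs [I], [I'] of [X2] outside [X1] and is extended outside [X2] to reach [J]. *)
Lemma K33_core S X1 X2 (J I I' : {set V}) (u v : V) :
  X1 \subset S -> X2 \subset S -> conn r (S :\: X1) -> conn r (S :\: X2) ->
  (forall x, (x \in X2) = [|| x == u, x == v, x \in I | x \in I']) ->
  u \in X1 -> v \in X1 -> u != v ->
  [/\ conn r I, conn r I' & conn r J] -> [disjoint I & I'] -> ~~ adj r I I' ->
  [/\ u \notin I, u \notin I', v \notin I & v \notin I'] ->
  J \subset X1 -> [disjoint J & X2] ->
  [/\ adj r [set u] I, adj r [set u] I' & adj r [set u] J] ->
  [/\ adj r [set v] I, adj r [set v] I' & adj r [set v] J] ->
  ~~ (I' \subset X1) ->
  (I \subset X1 -> exists x y,
     [/\ x \in I, y \in S, y \notin X1, y \notin X2 & r x y]) ->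
  has_K33 r.
Proof.
move=> s1 s2 c1 c2 X2E uX1 vX1 uv [cI cI' cJ] dII' nII' [uI uI' vI vI'] sJ dJ.
move=> [auI auI' auJ] [avI avI' avJ] nI' hI.
have sI : I \subset X2 by apply/subsetP => x xI; rewrite X2E xI !orbT.
have sI' : I' \subset X2 by apply/subsetP => x xI; rewrite X2E xI !orbT.
have [R [cR sR RI RI']] : exists R, [/\ conn r R, R \subset S :\: (X1 :|: X2),
    adj r R I & adj r R I'].
  have [x2 x2I' x2X1] := subsetPn nI'.
  have sI'1 : I' :\: X1 \subset S :\: X1 by apply: setSD (subset_trans sI' s2).
  have nzI' : I' :\: X1 != set0 by apply/set0Pn; exists x2; rewrite inE x2X1.
  (* If [I] lies in [X1], the last hypothesis gives a neighbour of [I] off both cycles, and its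
     component in [S :\: X1] without [I'] reaches [I']. Otherwise both arcs have vertices off [X1],
     and [cross] joins them there. *)
  have [sIX|nI] := boolP (I \subset X1).
    have [x [y [xI yS yX1 yX2 xy]]] := hI sIX.
    have yD : y \in (S :\: X1) :\: (I' :\: X1).
      by rewrite !inE yX1 yS /= andbT; apply: contra yX2; apply: (subsetP sI').
    exists (component r ((S :\: X1) :\: (I' :\: X1)) y); split.
    - exact: comp_conn.
    - apply/subsetP => z /(subsetP (comp_sub yD)).
      rewrite !inE => /andP[+ /andP[zX1 zS]]; rewrite (negPf zX1) zS X2E /= andbT => zI'.
      rewrite (negPf zI') orbF; apply/negP => /or3P[/eqP e|/eqP e|zI].
      + by rewrite e uX1 in zX1.
      + by rewrite e vX1 in zX1.
      + by rewrite (subsetP sIX _ zI) in zX1.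
    - by apply/adjP; exists y, x; rewrite comp_refl r_sym.
    - apply: adj_sub2 (subsetDl I' X1) _; apply: comp_adj => //.
      by apply/set0Pn; exists x2; rewrite !inE x2X1 x2I' (subsetP s2) // (subsetP sI').
  have [x1 x1I x1X1] := subsetPn nI.
  have := @cross _ r r_sym (S :\: X1) (I :\: X1) (I' :\: X1) c1.
  case=> //.
  - exact: setSD (subset_trans sI s2).
  - by apply/set0Pn; exists x1; rewrite inE x1X1.
  - by apply: disjointWl (subsetDl _ _) _; apply: disjointWr (subsetDl _ _) _.
  - apply: contra nII'; apply: adj_mono; exact: subsetDl.
  move=> R [cR sR RI RI']; exists R; split=> //.
  - apply/subsetP => x /(subsetP sR); rewrite !inE X2E !negb_or !negb_and !negbK.
    case/andP=> /andP[h1 h2] /andP[xX1 xS]; rewrite xS xX1 /= andbT.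
    rewrite (negPf xX1) /= in h1 h2; rewrite h1 h2 !andbT.
    by apply/andP; split; apply: contraNneq xX1 => ->.
  - exact: adj_sub2 (subsetDl _ _) RI.
  - exact: adj_sub2 (subsetDl _ _) RI'.
have [y [_ [yR _ _]]] := adjP RI.
have := subsetP sR _ yR; rewrite !inE negb_or => /andP[/andP[yX1 yX2] yS].
have yD : y \in (S :\: X2) :\: J.
  by rewrite !inE yX2 yS !andbT; apply: contra yX1; apply: (subsetP sJ).
pose R2 := component r ((S :\: X2) :\: J) y.
have [u1 [j [_ jJ _]]] := adjP auJ.
have aR2 : adj r R2 J.
  apply: comp_adj => //; apply/set0Pn; exists j.
  by rewrite !inE jJ (disjointFr dJ jJ) (subsetP s1) // (subsetP sJ).
have sR2 : R2 \subset (S :\: X2) :\: J by apply: comp_sub.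
pose R3 := R :|: R2.
have R3P x : x \in R3 -> x \notin X2 /\ x \notin J.
  case/setUP => [/(subsetP sR)|/(subsetP sR2)]; rewrite !inE ?negb_or.
    by case/andP=> /andP[xX1 xX2] _; split=> //; apply: contra xX1; apply: (subsetP sJ).
  by case/andP=> ? /andP[].
have uX2 : u \in X2 by rewrite X2E eqxx.
have vX2 : v \in X2 by rewrite X2E eqxx orbT.
have X2J x : x \in X2 -> x \in J -> False.
  by move=> xX2 /(disjointFr dJ); rewrite xX2.
apply: (@has_K33I _ r [set u] [set v] R3 J I I'); split=> //; try exact: conn1.
- apply: connU => //; first exact: comp_conn.
  apply/orP; right; apply/pred0Pn; exists y; rewrite /= yR; exact: comp_refl.
- by apply: disjointI => x /set1P-> /set1P e; rewrite e eqxx in uv.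
- by apply: disjointI => x /set1P-> /R3P[]; rewrite uX2.
- by apply: disjointI => x /set1P-> /R3P[]; rewrite vX2.
- by apply: disjointWr sI _.
- by apply: disjointWr sI' _.
- by apply: disjointI => x /set1P->; apply: X2J.
- by apply: disjointI => x /set1P->; apply/negP.
- by apply: disjointI => x /set1P->; apply/negP.
- by apply: disjointI => x /set1P->; apply: X2J.
- by apply: disjointI => x /set1P->; apply/negP.
- by apply: disjointI => x /set1P->; apply/negP.
- by apply: disjointI => x /R3P[_ /negP].
- by apply: disjointI => x /R3P[/negP h _] /(subsetP sI).
- by apply: disjointI => x /R3P[/negP h _] /(subsetP sI').
- by apply: adj_sub1 aR2; apply: subsetUr.
- by apply: adj_sub1 RI; apply: subsetUl.
- by apply: adj_sub1 RI'; apply: subsetUl.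
Qed.

Lemma periP S X : reflect
  [/\ exists n w, icyc n w /\ X = seg w 0 n, X \subset S & conn r (S :\: X)]
  (peri S X).
Proof.
apply: (iffP and3P) => -[].
  by move=> /icycle_setP.
by move=> /icycle_setP.
Qed.

Definition deg3 S := forall x a b, x \in S ->
  exists y, [/\ y \in S, r x y, y != a & y != b].

Lemma adj_set1 A x y : y \in A -> r x y -> adj r [set x] A.
Proof. by move=> yA xy; apply/adjP; exists x, y; rewrite set11. Qed.

End InducedCycles.

Arguments segP {V w i j x}.
Arguments icycP {V r n w}.
Arguments periP {V r S X}.

Section PeripheralCycles.
Variables (V : finType) (r : rel V).
Hypothesis r_sym : symmetric r.
Implicit Types (A B K P Q R S X : {set V}) (x y z : V) (w : nat -> V).
Local Notation peri := (peri r).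
Local Notation deg3 := (deg3 r).
Local Notation icyc := (icyc r).

(** An arc [J] of [X1] leaves [X2] at [w 0] and first returns at [w p]. These two vertices cut [X2]
    into two arcs, which together with [J] form one side of the minor in [K33_core]; the third
    common vertex keeps both arcs nonempty. *)
Lemma peri_meet S X1 X2 : deg3 S -> peri S X1 -> peri S X2 -> X1 != X2 ->
  2 < #|X1 :&: X2| -> has_K33 r.
Proof.
move=> d3 /periP[[n [w0 [cw0 {X1}->]]] s1 c1].
case/periP=> -[m [z0 [cz0 {X2}->]]] s2 c2 ne lt2.
have := card_gt0P (ltn_trans (isT : 0 < 2) lt2).
case=> x /setIP[xX1 xX2].
have n12 : ~~ (seg w0 0 n \subset seg z0 0 m).
  by apply: contra ne => /(icyc_subset_eq r_sym cw0 cz0) ->.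
have n21 : ~~ (seg z0 0 m \subset seg w0 0 n).
  by apply: contra ne => /(icyc_subset_eq r_sym cz0 cw0) ->.
have exw : exists2 x, x \in seg w0 0 n & x \in seg z0 0 m by exists x.
have [w [cw ew w0X w1X]] := icyc_exit cw0 exw n12.
have [z [cz ez z0w]] := icyc_start cz0 w0X.
rewrite -{}ew -{}ez in s1 s2 c1 c2 lt2 w0X w1X n12 n21.
clear w0 cw0 z0 cz0 ne x xX1 xX2 exw.
set X1 := seg w 0 n in s1 s2 c1 c2 lt2 w0X w1X n12 n21 *.
set X2 := seg z 0 m in s1 s2 c1 c2 lt2 w0X w1X n12 n21 *.
have [n2 winj wadj] := icycP cw; have [m2 zinj zadj] := icycP cz.
have exj : exists j, [&& 0 < j, j < n & w j \in X2].
  have [/hasP[j]|/hasPn no] := boolP (has (fun j => w j \in X2) (index_iota 1 n)).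
    by rewrite mem_index_iota => /andP[j0 jn] jX; exists j; apply/and3P.
  suff : X1 :&: X2 \subset [set w 0] by move/subset_leq_card; rewrite cards1; nlia.
  apply/subsetP => y /setIP[/segP[j jn ->] jX2]; rewrite inE.
  have [->//|j0] := posnP j; have := no j; rewrite mem_index_iota jX2.
  by move=> /(_ _)/negP; case; nlia.
case: (ex_minnP exj) => p /and3P[p0 pn pX2] pmin.
have Jout k : 0 < k < p -> w k \notin X2.
  move=> /andP[k0 kp]; apply/negP => kX2; have := pmin k.
  by rewrite k0 kX2 (ltn_trans kp pn) leqNgt kp => /(_ isT).
have [q pq qX2] : exists2 q, p < q < n & w q \in X2.
  have [/hasP[j]|/hasPn no] := boolP (has (fun j => w j \in X2) (index_iota p.+1 n)).
    by rewrite mem_index_iota => jn jX; exists j.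
  suff : X1 :&: X2 \subset [set w 0; w p].
    by move/subset_leq_card; rewrite cards2; case: eqP => _ /=; nlia.
  apply/subsetP => y /setIP[/segP[j jn ->] jX2]; rewrite !inE.
  have [->|j0] := posnP j; first by rewrite eqxx.
  have [jp|pj|->] := ltngtP j p; last by rewrite eqxx orbT.
    by have := Jout j; rewrite j0 jp jX2 => /(_ isT).
  by have := no j; rewrite mem_index_iota jX2 => /(_ _)/negP; case; nlia.
have p1 : 1 < p by have := Jout 1; case: (p) p0 pX2 w1X => [|[|]] // _ ->.
have [l /andP[_ lm] el] := segP pX2.
have l0 : 0 < l.
  by case: l lm el => // _; rewrite z0w => /winj; nlia.
(* [w p] is not the successor of [w 0], which is off [X2], nor its predecessor, because [w q] comes
   later. Hence these vertices are not consecutive on [X2] either. *)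
have nr : ~~ r (w 0) (w p) by rewrite wadj; nlia.
have l2 : 1 < l < m.-1 by move: nr; rewrite -z0w el zadj; nlia.
pose J := seg w 1 p.
have sJ : J \subset X1.
  by apply/subsetP => y /segP[k kp ->]; apply: mem_seg; nlia.
have dJ : [disjoint J & X2].
  by apply: disjointI => y /segP[k kp ->]; apply/negP/Jout.
have X2E y : (y \in X2) = [|| y == w 0, y == w p, y \in seg z 1 l | y \in seg z l.+1 m].
  apply/segP/or4P.
    case=> k km ->; have [->|k0] := posnP k; first by rewrite z0w; constructor 1.
    have [kl|kl|->] := ltngtP k l; last by rewrite el; constructor 2.
      by constructor 3; apply: mem_seg; nlia.
    by constructor 4; apply: mem_seg; nlia.
  case=> [/eqP->|/eqP->|/segP[k kl ->]|/segP[k kl ->]].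
  - by exists 0; rewrite ?z0w //; nlia.
  - by exists l.
  - by exists k => //; nlia.
  - by exists k => //; nlia.
have wpX1 : w p \in X1 by apply: mem_seg; nlia.
have w0X1 : w 0 \in X1 by apply: mem_seg; nlia.
have wpw0 : w 0 != w p by apply/eqP => /winj; nlia.
have cJ : conn r J by apply: (seg_conn r_sym _ cw); nlia.
have cI : conn r (seg z 1 l) by apply: (seg_conn r_sym _ cz); nlia.
have cI' : conn r (seg z l.+1 m) by apply: (seg_conn r_sym _ cz); nlia.
have dI : [disjoint seg z 1 l & seg z l.+1 m].
  by apply: disjointI => y /segP[k kl ->] /segP[k' kl' /zinj]; nlia.
have nI : ~~ adj r (seg z 1 l) (seg z l.+1 m).
  apply/adjP => -[a [b [/segP[k kl ->] /segP[k' kl' ->]]]].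
  by rewrite zadj; nlia.
have z0I : w 0 \notin seg z 1 l.
  by rewrite -z0w; apply/segP => -[k kl /zinj]; nlia.
have z0I' : w 0 \notin seg z l.+1 m.
  by rewrite -z0w; apply/segP => -[k kl /zinj]; nlia.
have wpI : w p \notin seg z 1 l.
  by rewrite el; apply/segP => -[k kl /zinj]; nlia.
have wpI' : w p \notin seg z l.+1 m.
  by rewrite el; apply/segP => -[k kl /zinj]; nlia.
have a1 : adj r [set w 0] J.
  by apply: (@adj_set1 _ r _ _ (w 1)); [apply: mem_seg; nlia | rewrite wadj; nlia].
have a2 : adj r [set w p] J.
  by apply: (@adj_set1 _ r _ _ (w p.-1)); [apply: mem_seg; nlia | rewrite wadj; nlia].
have a3 : adj r [set w 0] (seg z 1 l).
  by rewrite -z0w; apply: (@adj_set1 _ r _ _ (z 1)); [apply: mem_seg; nlia | rewrite zadj; nlia].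
have a4 : adj r [set w 0] (seg z l.+1 m).
  by rewrite -z0w; apply: (@adj_set1 _ r _ _ (z m.-1)); [apply: mem_seg; nlia | rewrite zadj; nlia].
have a5 : adj r [set w p] (seg z 1 l).
  by rewrite el; apply: (@adj_set1 _ r _ _ (z l.-1)); [apply: mem_seg; nlia | rewrite zadj; nlia].
have a6 : adj r [set w p] (seg z l.+1 m).
  by rewrite el; apply: (@adj_set1 _ r _ _ (z l.+1)); [apply: mem_seg; nlia | rewrite zadj; nlia].
(* If [z k] and its neighbours on [X2] all lie in [X1], a third neighbour of [z k], different from
   the two on [X1], is off both cycles. *)
have out k (A := X1) : 0 < k < m -> z k \in X1 ->
    (forall k', k' < m -> r (z k) (z k') -> z k' \in X1) ->
    exists y, [/\ y \in S, y \notin X1, y \notin X2 & r (z k) y].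
  move=> km kX1 hk; have [a [b [ab aX bX xE]]] := icyc_nbr2 cw kX1.
  have kS : z k \in S by apply: (subsetP s1).
  have [y [yS xy ya yb]] := d3 _ a b kS.
  have yX1 : y \notin X1.
    by apply/negP => yX; move: (xE y yX); rewrite xy (negPf ya) (negPf yb).
  exists y; split=> //; apply: contra yX1 => /segP[k' /andP[_ k'm] e].
  by rewrite e; apply: hk => //; rewrite -e.
(* By [n21] the arcs are not both inside [X1]; one that is not takes the role of [I']. *)
have [nI'|I'X] := boolP (~~ (seg z l.+1 m \subset X1)).
  apply: (@K33_core _ r r_sym S X1 X2 J (seg z 1 l) (seg z l.+1 m) (w 0) (w p)) => // sI.
  have h1 : 0 < 1 < m by nlia.
  have [|k' k'm|y [? ? ? ?]] := out 1 h1.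
  - by apply: (subsetP sI); apply: mem_seg; nlia.
  - rewrite zadj; try nlia; move=> hk; have [->|k0] := posnP k'; first by rewrite z0w.
    have [->|k0'] := eqVneq k' l; first by rewrite -el.
    by apply: (subsetP sI); apply: mem_seg; nlia.
  by exists (z 1), y; split=> //; apply: mem_seg; nlia.
rewrite negbK in I'X.
apply: (@K33_core _ r r_sym S X1 X2 J (seg z l.+1 m) (seg z 1 l) (w 0) (w p)) => //.
- by move=> y; rewrite X2E; congr (_ || (_ || _)); rewrite orbC.
- by rewrite disjoint_sym.
- by rewrite adjC.
- apply: contra n21 => IX; apply/subsetP => y; rewrite X2E.
  case/or4P=> [/eqP->//|/eqP->//|/(subsetP IX)//|/(subsetP I'X)//].
move=> _; have h1 : 0 < l.+1 < m by nlia.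
have [|k' k'm|y [? ? ? ?]] := out l.+1 h1.
- by apply: (subsetP I'X); apply: mem_seg; nlia.
- rewrite zadj; try nlia; move=> hk; have [->|k0] := posnP k'; first by rewrite z0w.
  have [->|k0'] := eqVneq k' l; first by rewrite -el.
  by apply: (subsetP I'X); apply: mem_seg; nlia.
by exists (z l.+1), y; split=> //; apply: mem_seg; nlia.
Qed.

End PeripheralCycles.

(** * Three peripheral cycles through an edge *)

Section ThreePeripheralCycles.
Variables (V : finType) (r : rel V).
Hypothesis r_sym : symmetric r.
Implicit Types (A B K P Q R S X : {set V}) (w : nat -> V).
Local Notation peri := (peri r).
Local Notation deg3 := (deg3 r).
Local Notation icyc := (icyc r).
Local Notation conn := (conn r).
Local Notation adj := (adj r).

Lemma disjointUl A B K : [disjoint A :|: B & K] = [disjoint A & K] && [disjoint B & K].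
Proof. by rewrite -!setI_eq0 setIUl setU_eq0. Qed.

Lemma disjointUr A B K : [disjoint K & A :|: B] = [disjoint K & A] && [disjoint K & B].
Proof. by rewrite -!setI_eq0 setIUr setU_eq0. Qed.

Lemma adjUl A B K : adj (A :|: B) K = adj A K || adj B K.
Proof.
apply/adjP/orP => [[a [b [/setUP[aA|aB] bK ab]]]|].
- by left; apply/adjP; exists a, b.
- by right; apply/adjP; exists a, b.
by case=> /adjP[a [b [aA bK ab]]]; exists a, b; rewrite inE aA ?orbT.
Qed.

Lemma adjUr A B K : adj K (A :|: B) = adj K A || adj K B.
Proof. by rewrite ![adj K _](adjC r_sym) adjUl. Qed.

Lemma icyc_edge n w x y : icyc n w -> x \in seg w 0 n -> y \in seg w 0 n ->
  r x y ->
  exists w', [/\ icyc n w', seg w' 0 n = seg w 0 n, w' 0 = x & w' n.-1 = y].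
Proof.
move=> cw xw; have [w1 [cw1 <- <-]] := icyc_start cw xw.
case/segP=> k /andP[_ kn] ->; have [n2 winj wadj] := icycP cw1.
rewrite wadj; try nlia; move=> hk.
have [->|kn1] := eqVneq k n.-1; first by exists w1.
have {hk kn1} -> : k = 1 by nlia.
have n1n : n.-1 < n by nlia.
exists (rotw n n.-1 (revw n w1)); split.
- exact/icyc_rot/icyc_rev.
- by rewrite seg_rotw // seg_revw.
- by rewrite /rotw /revw add0n n1n subnn.
- rewrite /rotw /revw (_ : n.-1 + n.-1 < n = false); last nlia.
  by congr w1; nlia.
Qed.

(* [P] is the interior of a path from [x] to [y] completing the edge [xy] to a
   peripheral cycle of [S]; it can be cut between any two of its vertices. *)
Record ppath S x y P : Prop := PPath {
  pp_conn : conn P;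
  pp_adjx : adj [set x] P;
  pp_adjy : adj [set y] P;
  pp_disx : [disjoint [set x] & P];
  pp_disy : [disjoint [set y] & P];
  pp_sub : P \subset S;
  pp_out : conn (S :\: (x |: (y |: P)));
  pp_nbr : forall a, a \in P -> adj [set a] (S :\: (x |: (y |: P)));
  pp_split : forall a b, a \in P -> b \in P -> a != b -> exists A A',
    [/\ P = A :|: A', [disjoint A & A'], conn A /\ conn A',
        adj A A' & [/\ adj [set y] A, adj [set x] A' &
          (a \in A) && (b \in A') || (b \in A) && (a \in A')]] }.

Lemma ppath_neq0 S x y P : ppath S x y P -> P != set0.
Proof. by case=> _ /adjP[a [b [_ bP _]]] *; apply/set0Pn; exists b. Qed.

Lemma peri_ppath S X x y : deg3 S -> peri S X -> x \in X -> y \in X -> r x y ->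
  exists2 P, X = x |: (y |: P) & ppath S x y P.
Proof.
move=> d3 /periP[[n [w0 [cw0 {X}->]]] sX cX] xX yX xy.
have [w [cw ew wx wy]] := icyc_edge cw0 xX yX xy.
rewrite -{}ew -{}wx -{}wy in sX cX xX yX xy *; clear w0 cw0 x y.
have [n2 winj wadj] := icycP cw.
pose P := seg w 1 n.-1.
have XE : seg w 0 n = w 0 |: (w n.-1 |: P).
  apply/setP => z; rewrite !in_setU1.
  apply/segP/or3P => [[k kn ->]|[/eqP->|/eqP->|/segP[k kn ->]]].
  - have [->|k0] := posnP k; first by constructor 1.
    have [->|k1] := eqVneq k n.-1; first by constructor 2.
    by constructor 3; apply: mem_seg; nlia.
  - by exists 0 => //; nlia.
  - by exists n.-1 => //; nlia.
  - by exists k => //; nlia.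
exists P => //; split.
- by apply: (seg_conn r_sym _ cw); nlia.
- by apply: (@adj_set1 _ r _ _ (w 1)); [apply: mem_seg; nlia | rewrite wadj; nlia].
- by apply: (@adj_set1 _ r _ _ (w n.-2)); [apply: mem_seg; nlia | rewrite wadj; nlia].
- by apply: disjointI => z /set1P-> /segP[k kn /winj]; nlia.
- by apply: disjointI => z /set1P-> /segP[k kn /winj]; nlia.
- by apply: subset_trans sX; rewrite XE; apply/subsetP => z zP; rewrite !in_setU1 zP !orbT.
- by rewrite -XE.
- move=> a aP; rewrite -XE.
  have aX : a \in seg w 0 n by rewrite XE !in_setU1 aP !orbT.
  have [p [q [pq pX qX aE]]] := icyc_nbr2 cw aX.
  have [z [zS az zp zq]] := d3 a p q (subsetP sX _ aX).
  apply: (adj_set1 (y := z)) => //; rewrite in_setD zS andbT.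
  by apply/negP => /aE; rewrite az (negPf zp) (negPf zq).
move=> a b aP bP ab.
wlog [i [j [ij in1 ai bj]]] : a b aP bP ab /
    exists i j, [/\ 0 < i < j, j < n.-1, a = w i & b = w j].
  move=> th; have [i i_n ai] := segP aP; have [j jn bj] := segP bP.
  have [ij|ji|e] := ltngtP i j; last by rewrite ai bj e eqxx in ab.
    by apply: th => //; exists i, j; split=> //; nlia.
  have [] := th b a; rewrite // 1?eq_sym //.
    by exists j, i; split=> //; nlia.
  move=> A [A' [? ? ? ? [? ? h]]]; exists A, A'; split=> //.
  by split=> //; rewrite orbC.
exists (seg w i.+1 n.-1), (seg w 1 i.+1); split.
- apply/setP => z; rewrite in_setU; apply/segP/orP.
    move=> [k kn ->]; have [ki|ki] := ltnP i k; [left | right]; apply: mem_seg; nlia.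
  by case=> /segP[k kn ->]; exists k => //; nlia.
- by apply: disjointI => z /segP[k kn ->] /segP[k' kn' /winj]; nlia.
- by split; apply: (seg_conn r_sym _ cw); nlia.
- by apply/adjP; exists (w i.+1), (w i); split; [apply: mem_seg; nlia | apply: mem_seg; nlia | rewrite wadj; nlia].
- split.
  + by apply: (@adj_set1 _ r _ _ (w n.-2)); [apply: mem_seg; nlia | rewrite wadj; nlia].
  + by apply: (@adj_set1 _ r _ _ (w 1)); [apply: mem_seg; nlia | rewrite wadj; nlia].
  + by rewrite ai bj; apply/orP; right; rewrite !mem_seg; nlia.
Qed.

Ltac dj := rewrite ?disjointUl ?disjointUr; repeat (apply/andP; split);
  first [assumption | rewrite disjoint_sym; assumption].
Ltac aj := rewrite ?adjUl ?adjUr;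
  first [assumption | rewrite (adjC r_sym); assumption
    | apply/orP; left; aj | apply/orP; right; aj].

Section Core.
Variables (S : {set V}) (x y : V).
Hypothesis xy : adj [set x] [set y].
Hypothesis dxy : [disjoint [set x] & [set y]].
Hypothesis conn3 : forall W : {set V}, #|W| <= 2 -> conn (S :\: W).

Definition rest P1 P2 P3 := S :\: (x |: (y |: (P1 :|: P2 :|: P3))).

(** The complement of the third cycle is connected and contains [P1] and [P2], so [cross] applies in
    it. *)
Lemma link_paths P1 P2 P3 : ppath S x y P1 -> ppath S x y P2 -> ppath S x y P3 ->
  [disjoint P1 & P2] -> [disjoint P1 & P3] -> [disjoint P2 & P3] ->
  adj P1 P2 \/ exists R, [/\ conn R, R \subset rest P1 P2 P3, adj R P1 & adj R P2].
Proof.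
move=> p1 p2 p3 d12 d13 d23; have [a12|n12] := boolP (adj P1 P2); [by left | right].
have sub P : ppath S x y P -> [disjoint P & P3] -> P \subset S :\: (x |: (y |: P3)).
  move=> p d; apply/subsetP => z zP; rewrite !inE !negb_or (subsetP (pp_sub p)) //.
  rewrite (disjointFr d zP) !andbT /=; apply/andP; split; apply/eqP => e.
    by have := disjointFl (pp_disx p) zP; rewrite e set11.
  by have := disjointFl (pp_disy p) zP; rewrite e set11.
have [||||R [cR sR R1 R2]] := cross r_sym (pp_out p3) (sub _ p1 d13) (sub _ p2 d23).
- exact: ppath_neq0 p1.
- exact: ppath_neq0 p2.
- by [].
- by [].
exists R; split=> //; apply: (subset_trans sR); apply/subsetP => z.
by rewrite !inE !negb_or; case: (z == x); case: (z == y); case: (z \in P1);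
  case: (z \in P2); case: (z \in P3).
Qed.

(** The vertices [x], [y] and the set [R] form one side of the minor, the three paths the other. *)
Lemma K33_three P1 P2 P3 R : ppath S x y P1 -> ppath S x y P2 -> ppath S x y P3 ->
  [disjoint P1 & P2] -> [disjoint P1 & P3] -> [disjoint P2 & P3] ->
  conn R -> R \subset rest P1 P2 P3 -> adj R P1 -> adj R P2 -> adj R P3 ->
  has_K33 r.
Proof.
move=> [c1 ? ? ? ? ? _ _ _] [c2 ? ? ? ? ? _ _ _] [c3 ? ? ? ? ? _ _ _].
move=> d12 d13 d23 cR sR R1 R2 R3.
have [/andP[xR yR] /and3P[RP1 RP2 RP3]] :
    [disjoint [set x] & R] && [disjoint [set y] & R] /\
    [&& [disjoint R & P1], [disjoint R & P2] & [disjoint R & P3]].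
  have h z : z \in R -> z \notin x |: (y |: (P1 :|: P2 :|: P3)).
    by move/(subsetP sR); case/setDP.
  by split; [apply/andP|apply/and3P]; split; apply: disjointI => z;
    [move=> /set1P-> /h|move=> /set1P-> /h|move=> /h|move=> /h|move=> /h];
    rewrite !inE ?eqxx ?orbT // !negb_or => /and3P[_ _ /andP[/andP[/negP ? /negP ?] /negP ?]].
apply: (@has_K33I _ r [set x] [set y] R P1 P2 P3); split=> //; try exact: conn1; dj.
Qed.

(** [P1] is cut between its two attachments to [R], into [A] next to [y] and [A'] next to [x]. If
    [Q] touches [A], the sides are [R], [y], [Q] and [A'] with [x], [A], [P2]; if it touches [A'],
    the roles of [x] and [y] are exchanged. *)
Lemma K33_split P1 P2 Q R a b : ppath S x y P1 -> ppath S x y P2 ->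
  [disjoint P1 & P2] -> conn R -> conn Q ->
  [/\ [disjoint R & Q], [disjoint R & P1], [disjoint R & P2],
     [disjoint Q & P1] & [disjoint Q & P2]] ->
  [/\ [disjoint [set x] & R], [disjoint [set y] & R], [disjoint [set x] & Q]
    & [disjoint [set y] & Q]] ->
  [/\ adj [set x] Q, adj [set y] Q, adj Q P1 & adj Q P2] -> adj R P2 ->
  a \in P1 -> b \in P1 -> a != b -> adj R [set a] -> adj R [set b] -> has_K33 r.
Proof.
move=> p1 [c2 ? ? ? ? _ _ _ _] d12 cR cQ [? ? ? ? ?] [? ? ? ?] [? ? Q1 Q2] R2.
move=> aP bP ab Ra Rb; have [A [A' [PE dA [cA cA'] aA [yA xA' h]]]] := pp_split p1 aP bP ab.
have [RA RA'] : adj R A /\ adj R A'.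
  by case/orP: h => /andP[hA hA']; split;
  [move: Ra|move: Rb|move: Rb|move: Ra]; apply: adj_sub2; rewrite sub1set.
have [_ _ _ dx1 dy1 _ _ _ _] := p1.
move: dx1 dy1 d12 Q1; rewrite PE disjointUr => /andP[? ?]; rewrite disjointUr => /andP[? ?].
rewrite disjointUl => /andP[? ?]; rewrite adjUr.
have [dRA dRA'] : [disjoint R & A] /\ [disjoint R & A'].
  by apply/andP; rewrite -disjointUr -PE.
have [dQA dQA'] : [disjoint Q & A] /\ [disjoint Q & A'].
  by apply/andP; rewrite -disjointUr -PE.
case/orP=> [QA|QA'].
  have cX : conn ([set x] :|: A') by apply: connU => //; [apply: conn1 | rewrite xA'].
  by apply: (@has_K33I _ r R [set y] Q ([set x] :|: A') A P2); split=> //;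
    first [exact: conn1 | dj | aj].
have cX : conn ([set y] :|: A) by apply: connU => //; [apply: conn1 | rewrite yA].
by apply: (@has_K33I _ r R [set x] Q ([set y] :|: A) A' P2); split=> //;
  first [exact: conn1 | dj | aj].
Qed.

(** As no vertex is left over, each vertex of [P1] has a neighbour in [P2] or [P3]. So do both
    halves of [P1], and since [P1] touches both other paths, the halves can be matched with
    different ones. If [A] goes with [P2] and [A'] with [P3], the sides are [x], [A], [P3] and [y],
    [A'], [P2]. *)
Lemma K33_big P1 P2 P3 a b :
  ppath S x y P1 -> ppath S x y P2 -> ppath S x y P3 ->
  [disjoint P1 & P2] -> [disjoint P1 & P3] -> [disjoint P2 & P3] ->
  rest P1 P2 P3 = set0 -> adj P1 P2 -> adj P1 P3 -> adj P2 P3 ->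
  a \in P1 -> b \in P1 -> a != b -> has_K33 r.
Proof.
move=> p1 p2 p3 d12 d13 d23 M0 a12 a13 a23 aP bP ab.
have out z : z \in P1 -> adj [set z] (P2 :|: P3).
  move=> zP; apply: adj_sub2 (pp_nbr p1 zP); apply/subsetP => t tS.
  have : t \notin rest P1 P2 P3 by rewrite M0 inE.
  move: tS; rewrite !inE; case: (t == x); case: (t == y); case: (t \in P1) => //=.
  by move=> ->; rewrite andbT negbK.
have [A [A' [PE dA [cA cA'] aA [yA xA' h]]]] := pp_split p1 aP bP ab.
have [hA hA'] : adj A (P2 :|: P3) /\ adj A' (P2 :|: P3).
  by case/orP: h => /andP[hA hA']; split;
  [move: (out a aP)|move: (out b bP)|move: (out b bP)|move: (out a aP)];
  apply: adj_sub1; rewrite sub1set.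
have [_ _ _ dx1 dy1 _ _ _ _] := p1.
have [c2 ? ? ? ? _ _ _ _] := p2; have [c3 ? ? ? ? _ _ _ _] := p3.
move: dx1 dy1 d12 d13 a12 a13; rewrite PE !disjointUr !disjointUl !adjUl.
move=> /andP[? ?] /andP[? ?] /andP[? ?] /andP[? ?] a12 a13.
have [h1|h1] : (adj A P2 && adj A' P3) \/ (adj A P3 && adj A' P2).
  move: hA hA' a12 a13; rewrite !adjUr.
  case: (adj A P2); case: (adj A' P3); case: (adj A P3); case: (adj A' P2); rewrite //=; auto.
  case/andP: h1 => ? ?.
  by apply: (@has_K33I _ r [set x] A P3 [set y] A' P2); split=> //;
    first [exact: conn1 | dj | aj].
case/andP: h1 => ? ?.
by apply: (@has_K33I _ r [set x] A P2 [set y] A' P3); split=> //;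
  first [exact: conn1 | dj | aj].
Qed.

(** [P3] is enlarged outside [R] to a set [Q] touching [P1] and [P2]. If [R] touches [x], the sides
    are [R], [y], [Q] and [x], [P1], [P2]; likewise for [y]. Otherwise all attachments of [R] lie on
    [P1] and [P2], there are at least three of them by 3-connectivity, and two on the same path
    allow [K33_split]. *)
Lemma K33_two P1 P2 P3 z (R := component r (rest P1 P2 P3) z) :
  ppath S x y P1 -> ppath S x y P2 -> ppath S x y P3 ->
  [disjoint P1 & P2] -> [disjoint P1 & P3] -> [disjoint P2 & P3] ->
  z \in rest P1 P2 P3 -> adj R P1 -> adj R P2 -> ~~ adj R P3 -> has_K33 r.
Proof.
move=> p1 p2 p3 d12 d13 d23 zM R1 R2 nR3.
have cR : conn R by apply: comp_conn.
have sR : R \subset rest P1 P2 P3 by apply: comp_sub.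
have out A t : A \subset rest P1 P2 P3 -> t \in A ->
    [/\ t != x, t != y, t \notin P1, t \notin P2 & t \notin P3].
  move=> sA /(subsetP sA); rewrite !inE !negb_or.
  by move=> /andP[/and3P[-> -> /andP[/andP[-> ->] ->]]].
have outd A : A \subset rest P1 P2 P3 ->
   [/\ [disjoint [set x] & A], [disjoint [set y] & A], [disjoint A & P1],
     [disjoint A & P2] & [disjoint A & P3]].
  move=> sA; split; apply: disjointI => t.
  - by move=> /set1P-> /(out _ _ sA)[]; rewrite eqxx.
  - by move=> /set1P-> /(out _ _ sA)[_]; rewrite eqxx.
  - by move=> /(out _ _ sA)[_ _ /negP].
  - by move=> /(out _ _ sA)[_ _ _ /negP].
  - by move=> /(out _ _ sA)[_ _ _ _ /negP].
have [Rx Ry dR1 dR2 dR3] := outd _ sR.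
have [c1 x1 y1 dx1 dy1 s1 _ _ _] := p1; have [c2 x2 y2 dx2 dy2 s2 _ _ _] := p2.
have [c3 x3 y3 dx3 dy3 s3 _ _ _] := p3.
(* A connecting set [R'] that met the component [R] would be contained in it, but [R'] touches [P3]
   and [R] does not. *)
have grow P : (adj P3 P \/ exists R', [/\ conn R', R' \subset rest P1 P2 P3,
    adj R' P3 & adj R' P]) -> exists Q, [/\ conn Q, P3 \subset Q,
    Q \subset P3 :|: rest P1 P2 P3, [disjoint R & Q] & adj Q P].
  case=> [a3|[R' [cR' sR' R'3 R'P]]]; first by exists P3; split=> //; apply: subsetUl.
  exists (P3 :|: R'); split.
  - by apply: connU => //; rewrite (adjC r_sym) R'3.
  - exact: subsetUl.
  - exact: setUS.
  - rewrite disjointUr dR3; apply: contraNT nR3 => /pred0Pn[t /andP[/= tR tR']].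
    apply: adj_sub1 R'3; suff: R' \subset R by [].
    apply: (conn_closed cR' _ tR' tR) => a b aR _ bR' ab.
    exact: (comp_closed zM aR (subsetP sR' _ bR') ab).
  - by apply: adj_sub1 R'P; apply: subsetUr.
have rE13 : rest P3 P1 P2 = rest P1 P2 P3.
  by congr (_ :\: (_ |: (_ |: _))); rewrite -setUA setUC.
have rE23 : rest P3 P2 P1 = rest P1 P2 P3.
  by congr (_ :\: (_ |: (_ |: _))); rewrite setUC [P3 :|: P2]setUC setUA.
have [Q1 [cQ1 sQ1 sQ1' dQ1 aQ1]] : exists Q, [/\ conn Q, P3 \subset Q,
    Q \subset P3 :|: rest P1 P2 P3, [disjoint R & Q] & adj Q P1].
  by apply: grow; rewrite -rE13; apply: link_paths => //; rewrite disjoint_sym.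
have [Q2 [cQ2 sQ2 sQ2' dQ2 aQ2]] : exists Q, [/\ conn Q, P3 \subset Q,
    Q \subset P3 :|: rest P1 P2 P3, [disjoint R & Q] & adj Q P2].
  by apply: grow; rewrite -rE23; apply: link_paths => //; rewrite disjoint_sym.
pose Q := Q1 :|: Q2.
have cQ : conn Q.
  apply: connU => //; have /set0Pn[t tP] := ppath_neq0 p3.
  by apply/orP; right; apply/pred0Pn; exists t; rewrite /= (subsetP sQ1) ?(subsetP sQ2).
have sQ : P3 \subset Q by apply: subset_trans sQ1 (subsetUl _ _).
have sQ' : Q \subset P3 :|: rest P1 P2 P3 by rewrite subUset sQ1'.
have dQ : [disjoint R & Q] by rewrite disjointUr dQ1.
have aQ1' : adj Q P1 by apply: adj_sub1 aQ1; apply: subsetUl.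
have aQ2' : adj Q P2 by apply: adj_sub1 aQ2; apply: subsetUr.
have ax : adj [set x] Q by apply: adj_sub2 x3.
have ay : adj [set y] Q by apply: adj_sub2 y3.
have [Mx My dM1 dM2 dM3] := outd _ (subxx (rest P1 P2 P3)).
have dQP A : [disjoint A & P3] -> [disjoint A & rest P1 P2 P3] -> [disjoint A & Q].
  by move=> h1 h2; apply: disjointWr sQ' _; rewrite disjointUr h1.
have dQx : [disjoint [set x] & Q] by apply: dQP.
have dQy : [disjoint [set y] & Q] by apply: dQP.
have dQ1' : [disjoint Q & P1].
  by rewrite disjoint_sym; apply: dQP => //; rewrite disjoint_sym.
have dQ2' : [disjoint Q & P2].
  by rewrite disjoint_sym; apply: dQP => //; rewrite disjoint_sym.
clearbody Q.
have [Rxa|nRx] := boolP (adj R [set x]).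
  by apply: (@has_K33I _ r R [set y] Q [set x] P1 P2); split=> //;
    first [exact: conn1 | dj | aj].
have [Rya|nRy] := boolP (adj R [set y]).
  by apply: (@has_K33I _ r R [set x] Q [set y] P1 P2); split=> //;
    first [exact: conn1 | dj | aj].
pose W := [set t in S :\: R | adj R [set t]].
have sW : W \subset P1 :|: P2.
  apply/subsetP => t; rewrite [t \in W]inE in_setD in_setU => /andP[/andP[tR tS] Rt].
  apply: contraT => tP; move: (Rt) => /adjP[a [b [aR /set1P-> at_]]].
  have tx : t != x by apply: contraNneq nRx => <-.
  have ty : t != y by apply: contraNneq nRy => <-.
  have t3 : t \notin P3 by apply: contra nR3 => t3; apply: adj_sub2 Rt; rewrite sub1set.
  move/negP: tR; case; apply: (comp_closed zM aR _ at_).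
  by rewrite !inE (negPf tx) (negPf ty) (negPf t3) (negPf tP) tS.
have W3 : 2 < #|W|.
  rewrite ltnNge; apply/negP => /conn3 cW.
  have zR : z \in R by apply: comp_refl.
  have [zx zy z1 z2 z3] := out _ _ sR zR.
  have zS : z \in S by move: zM; rewrite inE => /andP[].
  have zW : z \in S :\: W by rewrite in_setD inE in_setD zR zS.
  have /subsetP sub : S :\: W \subset R.
    apply: (conn_closed cW _ zW zR) => a b aR _ bSW ab.
    move: bSW; rewrite in_setD inE in_setD => /andP[bW bS].
    apply: contraNT bW => bR; rewrite bR bS; apply/adjP; exists a, b.
    by rewrite set11.
  have /set0Pn[t t3] := ppath_neq0 p3; have : t \in S :\: W.
    rewrite in_setD (subsetP s3) // andbT; apply: contra nR3.
    by rewrite inE => /andP[_]; apply: adj_sub2; rewrite sub1set.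
  by move/sub => tR; have := disjointFr dR3 tR; rewrite t3.
have WP : (1 < #|W :&: P1|) || (1 < #|W :&: P2|).
  have : #|W| <= #|W :&: P1| + #|W :&: P2|.
    by rewrite -{1}(setIidPl sW) setIUr cardsU leq_subr.
  by clear -W3; move: #|W :&: P1| #|W :&: P2| #|W| W3 => a b c; lia.
have pick2 A : 1 < #|A| -> exists a b, [/\ a \in A, b \in A & a != b].
  by case/card_gt1P => a [b []]; exists a, b.
case/orP: WP => /pick2[a [b [/setIP[aW aP] /setIP[bW bP] ab]]].
  have [[_ Ra] [_ Rb]] : (a \in S :\: R /\ adj R [set a]) /\
      (b \in S :\: R /\ adj R [set b]).
    by move: aW bW; rewrite [a \in _]inE [b \in _]inE => /andP[? ?] /andP[? ?].
  by apply: (@K33_split P1 P2 Q R a b).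
have [[_ Ra] [_ Rb]] : (a \in S :\: R /\ adj R [set a]) /\
    (b \in S :\: R /\ adj R [set b]).
  by move: aW bW; rewrite [a \in _]inE [b \in _]inE => /andP[? ?] /andP[? ?].
by apply: (@K33_split P2 P1 Q R a b) => //; rewrite disjoint_sym.
Qed.

End Core.

(* Pairwise the cycles meet in [x] and [y] only. A vertex outside all three lies
   in a component that, having at least three attachments, completes a K33; if
   there is none, the three paths are adjacent to each other, which gives a K5,
   and a K33 as soon as one of the paths can be cut. *)
Theorem peri_edge3 S x y X1 X2 X3 : deg3 S ->
  (forall W : {set V}, #|W| <= 2 -> conn (S :\: W)) ->
  [/\ peri S X1, peri S X2 & peri S X3] -> [/\ X1 != X2, X1 != X3 & X2 != X3] ->
  [/\ x \in X1, x \in X2 & x \in X3] -> [/\ y \in X1, y \in X2 & y \in X3] ->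
  x != y -> r x y ->
  has_K33 r \/ #|S| = 5 /\ {in S &, forall a b, a != b -> r a b}.
Proof.
move=> d3 c3 [q1 q2 q3] [n12 n13 n23] [xX1 xX2 xX3] [yX1 yX2 yX3] nxy xy.
have xS : x \in S by case/periP: q1 => _ /subsetP/(_ _ xX1).
have yS : y \in S by case/periP: q1 => _ /subsetP/(_ _ yX1).
have [m12|m12] := ltnP 2 #|X1 :&: X2|; first by left; exact: (peri_meet r_sym d3 q1 q2 n12 m12).
have [m13|m13] := ltnP 2 #|X1 :&: X3|; first by left; exact: (peri_meet r_sym d3 q1 q3 n13 m13).
have [m23|m23] := ltnP 2 #|X2 :&: X3|; first by left; exact: (peri_meet r_sym d3 q2 q3 n23 m23).
have [P1 e1 p1] := peri_ppath d3 q1 xX1 yX1 xy.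
have [P2 e2 p2] := peri_ppath d3 q2 xX2 yX2 xy.
have [P3 e3 p3] := peri_ppath d3 q3 xX3 yX3 xy.
have dis P Q : ppath S x y P -> ppath S x y Q ->
    #|(x |: (y |: P)) :&: (x |: (y |: Q))| <= 2 -> [disjoint P & Q].
  move=> p q le2; apply: disjointI => t tP tQ; move: le2; apply/negP; rewrite -ltnNge.
  have tx : x != t by apply/eqP => e; have := disjointFl (pp_disx p) tP; rewrite e set11.
  have ty : y != t by apply/eqP => e; have := disjointFl (pp_disy p) tP; rewrite e set11.
  have -> : 3 = #|[set x; y; t]|.
    by rewrite -setUA cardsU1 cards2 !inE negb_or nxy tx ty.
  apply/subset_leq_card/subsetP => s; rewrite !inE -orbA.
  by case/or3P=> /eqP->; rewrite ?eqxx ?orbT ?tP ?tQ ?orbT.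
have d12 : [disjoint P1 & P2] by apply: dis; rewrite -?e1 -?e2.
have d13 : [disjoint P1 & P3] by apply: dis; rewrite -?e1 -?e3.
have d23 : [disjoint P2 & P3] by apply: dis; rewrite -?e2 -?e3.
have axy : adj [set x] [set y] by apply: (adj_set1 (y := y)); rewrite ?set11.
have dxy : [disjoint [set x] & [set y]].
  by apply: disjointI => t /set1P-> /set1P e; rewrite e eqxx in nxy.
have d21 := d12; have d31 := d13; have d32 := d23; rewrite disjoint_sym in d21.
rewrite disjoint_sym in d31; rewrite disjoint_sym in d32.
have rE1 : rest S x y P1 P3 P2 = rest S x y P1 P2 P3.
  by congr (_ :\: (_ |: (_ |: _))); rewrite setUAC.
have rE2 : rest S x y P2 P3 P1 = rest S x y P1 P2 P3.
  by congr (_ :\: (_ |: (_ |: _))); rewrite setUC setUA.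
have [M0|[z zM]] := set_0Vmem (rest S x y P1 P2 P3); last first.
  left; pose R := component r (rest S x y P1 P2 P3) z.
  (* The complement of the cycle through [T] is connected, and [R] is a component of it after
     removal of [P] and [Q], so [R] touches one of these. Hence [R] misses at most one of the three
     paths. *)
  have near P Q T : ppath S x y P -> ppath S x y Q -> ppath S x y T ->
      [disjoint P & Q] -> [disjoint P & T] -> [disjoint Q & T] ->
      rest S x y P Q T = rest S x y P1 P2 P3 -> adj R P || adj R Q.
    move=> p q t dPQ dPT dQT rE; rewrite -adjUr.
    have SE : (S :\: (x |: (y |: T))) :\: (P :|: Q) = rest S x y P1 P2 P3.
      rewrite -rE setDDl; congr (_ :\: _).
      by rewrite -!setUA; congr (_ :|: (_ :|: _)); rewrite setUC -setUA.
    rewrite /R -SE; apply: comp_adj (pp_out t) _ _; first by rewrite SE.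
    have /set0Pn[s sP] := ppath_neq0 p; apply/set0Pn; exists s.
    rewrite in_setI in_setU sP andbT in_setD (subsetP (pp_sub p)) // andbT.
    rewrite !in_setU1 (disjointFr dPT sP) orbF negb_or.
    by apply/andP; split; apply/eqP => e;
      [have := disjointFl (pp_disx p) sP|have := disjointFl (pp_disy p) sP];
      rewrite e set11.
  have cR : conn R by apply: comp_conn.
  have sR : R \subset rest S x y P1 P2 P3 by apply: comp_sub.
  have [R1|R1] := boolP (adj R P1); have [R2|R2] := boolP (adj R P2);
    have [R3|R3] := boolP (adj R P3).
  - exact: (K33_three dxy p1 p2 p3 d12 d13 d23 cR sR R1 R2 R3).
  - exact: (K33_two axy dxy c3 p1 p2 p3 d12 d13 d23 zM R1 R2 R3).
  - by apply: (K33_two axy dxy c3 p1 p3 p2 d13 d12 d32 (z := z)); rewrite rE1.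
  - by have := near P2 P3 P1 p2 p3 p1 d23 d21 d31 rE2; rewrite (negPf R2) (negPf R3).
  - by apply: (K33_two axy dxy c3 p2 p3 p1 d23 d21 d31 (z := z)); rewrite rE2.
  - by have := near P1 P3 P2 p1 p3 p2 d13 d12 d32 rE1; rewrite (negPf R1) (negPf R3).
  - by have := near P1 P2 P3 p1 p2 p3 d12 d13 d23 erefl; rewrite (negPf R1) (negPf R2).
  - by have := near P1 P2 P3 p1 p2 p3 d12 d13 d23 erefl; rewrite (negPf R1) (negPf R2).
have lnk P Q T : ppath S x y P -> ppath S x y Q -> ppath S x y T ->
    [disjoint P & Q] -> [disjoint P & T] -> [disjoint Q & T] ->
    rest S x y P Q T = rest S x y P1 P2 P3 -> adj P Q.
  move=> p q t dPQ dPT dQT rE.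
  case: (link_paths p q t dPQ dPT dQT) => // -[R [_]].
  rewrite rE M0 subset0 => /eqP-> /adjP[a [b []]]; by rewrite inE.
have a12 : adj P1 P2 by apply: (lnk _ _ _ p1 p2 p3).
have a13 : adj P1 P3 by apply: (lnk _ _ _ p1 p3 p2).
have a23 : adj P2 P3 by apply: (lnk _ _ _ p2 p3 p1).
have sing P : ppath S x y P -> (exists2 a, a \in P & exists2 b, b \in P & a != b)
    \/ exists a, P = [set a].
  move=> p; have /set0Pn[a aP] := ppath_neq0 p.
  have [P0|[b /setD1P[ba bP]]] := set_0Vmem (P :\ a).
    by right; exists a; rewrite -(setD1K aP) P0 setU0.
  by left; exists a => //; exists b; rewrite // eq_sym.
case: (sing _ p1) => [[a aP [b bP ab]]|[s1 P1E]].
  by left; apply: (K33_big axy dxy p1 p2 p3 _ _ _ _ _ _ _ aP bP ab).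
case: (sing _ p2) => [[a aP [b bP ab]]|[s2 P2E]].
  left; apply: (K33_big axy dxy p2 p3 p1 _ _ _ _ _ _ _ aP bP ab) => //;
  by rewrite ?rE2 // (adjC r_sym).
case: (sing _ p3) => [[a aP [b bP ab]]|[s3 P3E]].
  left; apply: (K33_big axy dxy p3 p1 p2 _ _ _ _ _ _ _ aP bP ab) => //;
  rewrite 1?(adjC r_sym) // -M0.
  by congr (_ :\: (_ |: (_ |: _))); rewrite -setUA setUC.
right; have SE : S = [set x; y; s1; s2; s3].
  apply/setP => t; rewrite !inE.
  have : t \notin rest S x y P1 P2 P3 by rewrite M0 inE.
  rewrite !inE P1E P2E P3E !inE.
  have sS P s : ppath S x y P -> P = [set s] -> s \in S.
    by move=> p Ps; apply: (subsetP (pp_sub p)); rewrite Ps set11.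
  have [->|/= _] := eqVneq t x; first by rewrite xS.
  have [->|/= _] := eqVneq t y; first by rewrite yS.
  have [->|/= _] := eqVneq t s1; first by rewrite (sS _ _ p1).
  have [->|/= _] := eqVneq t s2; first by rewrite (sS _ _ p2).
  have [->|/= _] := eqVneq t s3; first by rewrite (sS _ _ p3).
  exact/negPf.
have dn (a b : V) : [disjoint [set a] & [set b]] -> a != b.
  by apply: contraTneq => ->; rewrite -setI_eq0 setIid; apply/set0Pn; exists b; rewrite set11.
have ar a b : adj [set a] [set b] -> r a b.
  by move=> /adjP[a' [b' [/set1P-> /set1P->]]].
have [_ ax1 ay1 dx1 dy1 _ _ _ _] := p1; have [_ ax2 ay2 dx2 dy2 _ _ _ _] := p2.
have [_ ax3 ay3 dx3 dy3 _ _ _ _] := p3.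
subst P1 P2 P3.
move: (dn _ _ d12) (dn _ _ d13) (dn _ _ d23) (dn _ _ dx1) (dn _ _ dx2) (dn _ _ dx3)
  (dn _ _ dy1) (dn _ _ dy2) (dn _ _ dy3) => u1 u2 u3 u4 u5 u6 u7 u8 u9.
move: (ar _ _ a12) (ar _ _ a13) (ar _ _ a23) (ar _ _ ax1) (ar _ _ ax2) (ar _ _ ax3)
  (ar _ _ ay1) (ar _ _ ay2) (ar _ _ ay3) => v1 v2 v3 v4 v5 v6 v7 v8 v9.
split.
  have -> : S = [set z in [:: x; y; s1; s2; s3]].
    by rewrite SE; apply/setP => z; rewrite !inE -!orbA.
  rewrite cardsE; apply/card_uniqP.
  by rewrite /= !inE !negb_or nxy u1 u2 u3 u4 u5 u6 u7 u8 u9.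
move=> a b; rewrite SE !inE -!orbA.
by case/or4P=> [/eqP->|/eqP->|/eqP->|/orP[]/eqP->];
  case/or4P=> [/eqP->|/eqP->|/eqP->|/orP[]/eqP->]; rewrite ?eqxx // => _;
  rewrite // r_sym.
Qed.

End ThreePeripheralCycles.

(** * Even edge sets *)

Definition symd (T : finType) (A B : {set T}) := (A :\: B) :|: (B :\: A).

Lemma in_symd (T : finType) (A B : {set T}) x :
  (x \in symd A B) = (x \in A) (+) (x \in B).
Proof. by rewrite !inE; case: (x \in A); case: (x \in B). Qed.

Lemma big_symd (T : finType) (A B : {set T}) (f : T -> bool) :
  \big[addb/false]_(x in symd A B) f x =
  \big[addb/false]_(x in A) f x (+) \big[addb/false]_(x in B) f x.
Proof.
rewrite big_mkcond [X in _ = X (+) _]big_mkcond [X in _ = _ (+) X]big_mkcond.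
rewrite -big_split; apply: eq_bigr => x _; rewrite in_symd.
by case: (x \in A); case: (x \in B); case: (f x).
Qed.

Lemma symdC (T : finType) (A B : {set T}) : symd A B = symd B A.
Proof. by rewrite /symd setUC. Qed.

Lemma symdA (T : finType) : associative (@symd T).
Proof. by move=> A B K; apply/setP => x; rewrite !in_symd addbA. Qed.

Lemma symdv (T : finType) (A : {set T}) : symd A A = set0.
Proof. by rewrite /symd setDv setU0. Qed.

Lemma symd0 (T : finType) (A : {set T}) : symd A set0 = A.
Proof. by rewrite /symd setD0 set0D setU0. Qed.

Lemma symdK (T : finType) (A B : {set T}) : symd (symd A B) B = A.
Proof. by rewrite -symdA symdv symd0. Qed.

Lemma symd_sub (T : finType) (A B K : {set T}) : A \subset K -> B \subset K ->
  symd A B \subset K.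
Proof.
move=> /subsetP sA /subsetP sB; apply/subsetP => x; rewrite in_symd.
by case: (boolP (x \in A)) => [/sA //|_]; case: (boolP (x \in B)) => [/sB|].
Qed.

Section Sums.
Variables (I E : finType) (C : I -> {set E}).
Implicit Types s t : {set I}.

Definition cnt s e := \sum_(i in s) (e \in C i : nat).

(** The sum over GF(2). The unique union is the set where [cnt] is 1, so both agree where [cnt] is
    at most 2. *)
Definition fsum s := [set e | odd (cnt s e)].

Lemma odd_cnt s e : odd (cnt s e) = \big[addb/false]_(i in s) (e \in C i).
Proof.
rewrite /cnt (big_morph odd oddD (erefl : odd 0 = false)).
by apply: eq_bigr => i _; case: (e \in C i).
Qed.

Lemma in_fsum s e : (e \in fsum s) = \big[addb/false]_(i in s) (e \in C i).
Proof. by rewrite inE odd_cnt. Qed.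

Lemma fsum0 : fsum set0 = set0.
Proof. by apply/setP => e; rewrite in_fsum big_set0 inE. Qed.

Lemma fsum1 i : fsum [set i] = C i.
Proof. by apply/setP => e; rewrite in_fsum big_set1. Qed.

Lemma fsum_symd s t : fsum (symd s t) = symd (fsum s) (fsum t).
Proof. by apply/setP => e; rewrite in_symd !in_fsum big_symd. Qed.

End Sums.

Section CycleSpace.
Variables (V E : finType) (h : E -> V * V).
Implicit Types (Z Y T F : {set E}) (K : {set V}).

(** Incidence modulo 2: the ends of a loop cancel, so a loop by itself is an even set. *)
Definition inc e x := ((h e).1 == x) (+) ((h e).2 == x).

Definition bd Z x := \big[addb/false]_(e in Z) inc e x.

Definition even Z := [forall x, ~~ bd Z x].

Definition cyc F := [set Z : {set E} | (Z \subset F) && even Z].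

Definition joins e a b := (h e == (a, b)) || (h e == (b, a)).

Definition inside K := [set e | ((h e).1 \in K) && ((h e).2 \in K)].

(** The underlying simple graph, which is all that connectivity and K33 minors depend on. *)
Definition er F : rel V := fun x y => (x != y) && [exists e in F, joins e x y].

Lemma joinsC e a b : joins e a b = joins e b a.
Proof. by rewrite /joins orbC. Qed.

Lemma joins_h e : joins e (h e).1 (h e).2.
Proof. by rewrite /joins -surjective_pairing eqxx. Qed.

Lemma joins_inc e a b x : joins e a b -> inc e x = (x == a) (+) (x == b).
Proof.
by rewrite /inc /joins => /orP[]/eqP-> /=; rewrite ![x == _]eq_sym // addbC.
Qed.

Lemma joins_inside e a b K : joins e a b -> (e \in inside K) = (a \in K) && (b \in K).
Proof. by rewrite inE /joins => /orP[]/eqP-> //=; rewrite andbC. Qed.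

Lemma in_inside e K : (e \in inside K) = ((h e).1 \in K) && ((h e).2 \in K).
Proof. by rewrite inE. Qed.

Lemma er_sym F : symmetric (er F).
Proof.
move=> x y; rewrite /er eq_sym; congr andb; apply: eq_existsb => e.
by rewrite joinsC.
Qed.

Lemma erP F x y : reflect (x != y /\ exists2 e, e \in F & joins e x y) (er F x y).
Proof.
apply: (iffP andP) => -[xy].
  by case/exists_inP=> e; split=> //; exists e.
by case=> e eF exy; split=> //; apply/exists_inP; exists e.
Qed.

Lemma evenP Z : reflect (forall x, bd Z x = false) (even Z).
Proof. by apply: (iffP forallP) => H x; [exact: negbTE (H x) | rewrite H]. Qed.

Lemma cycP F Z : reflect (Z \subset F /\ forall x, bd Z x = false) (Z \in cyc F).
Proof. by rewrite inE; apply: (iffP andP) => -[? /evenP]. Qed.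

Lemma bd0 x : bd set0 x = false.
Proof. by rewrite /bd big_set0. Qed.

Lemma bd1 e x : bd [set e] x = inc e x.
Proof. by rewrite /bd big_set1. Qed.

Lemma bd_symd Z Y x : bd (symd Z Y) x = bd Z x (+) bd Y x.
Proof. exact: big_symd. Qed.

Lemma bd_fsum (I : finType) (C : I -> {set E}) s x :
  bd (fsum C s) x = \big[addb/false]_(i in s) bd (C i) x.
Proof.
rewrite /bd [RHS](eq_bigr (fun i => \big[addb/false]_e ((e \in C i) && inc e x))).
  rewrite exchange_big /= big_mkcond; apply: eq_bigr => e _.
  rewrite in_fsum; case: (inc e x); last by rewrite if_same big1 // => i; rewrite andbF.
  rewrite -[if _ then true else false]/(_ && true) andbT.
  by apply: eq_bigr => i _; rewrite andbT.
by move=> i _; rewrite big_mkcond.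
Qed.

Lemma even0 : even set0.
Proof. by apply/evenP => x; rewrite bd0. Qed.

Lemma even_symd Z Y : even Z -> even Y -> even (symd Z Y).
Proof. by move=> /evenP hZ /evenP hY; apply/evenP => x; rewrite bd_symd hZ hY. Qed.

Lemma cyc_symd F Z Y : Z \in cyc F -> Y \in cyc F -> symd Z Y \in cyc F.
Proof.
rewrite !inE => /andP[? ?] /andP[? ?]; rewrite even_symd // andbT.
exact: symd_sub.
Qed.

Lemma cyc_sub F F' : F \subset F' -> cyc F \subset cyc F'.
Proof.
by move=> s; apply/subsetP => Z; rewrite !inE => /andP[/subset_trans -> //].
Qed.

Lemma cyc_fsum (I : finType) (C : I -> {set E}) F (s : {set I}) :
  (forall i, i \in s -> C i \in cyc F) -> fsum C s \in cyc F.
Proof.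
move=> Ccyc; apply/cycP; split=> [|x].
  apply/subsetP => e; rewrite in_fsum; apply: contraTT => eF.
  rewrite big1 // => i /Ccyc; rewrite inE => /andP[/subsetP sC _].
  by apply: contraNF eF; apply: sC.
by rewrite bd_fsum big1 // => i /Ccyc/cycP[_].
Qed.

(** The handshake lemma: every edge is counted at both of its ends. *)
Lemma parity Z : \big[addb/false]_x bd Z x = false.
Proof.
rewrite exchange_big /= big1 // => e _; rewrite /inc big_split /=.
have one (a : V) : \big[addb/false]_x (a == x) = true.
  by rewrite (bigD1 a) //= eqxx big1 // => x /negPf; rewrite eq_sym.
by rewrite !one.
Qed.

Lemma bd_other Z x : bd Z x -> exists2 y, y != x & bd Z y.
Proof.
move=> Zx; apply/exists_inP; apply: contraPT (parity Z) => /exists_inPn no.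
by rewrite (bigD1 x) //= Zx big1 // => y /no/negPf.
Qed.

Lemma bd_out Z x : (forall e, e \in Z -> inc e x = false) -> bd Z x = false.
Proof. by move=> H; rewrite /bd big1. Qed.

Lemma eq_bd_at Z Y x :
  (forall e, inc e x -> (e \in Z) = (e \in Y)) -> bd Z x = bd Y x.
Proof.
move=> H; rewrite /bd big_mkcond [RHS]big_mkcond; apply: eq_bigr => e _.
case: (boolP (inc e x)) => [/H->//|_]; by rewrite !if_same.
Qed.

(** The handshake lemma is applied to the edges of [Z] inside the component [K] of [x]: on [K] they
    have the same degrees as [Z], elsewhere degree zero. *)
Lemma bd_linked Z x : bd Z x -> exists y, [/\ y != x, bd Z y & connect (er Z) x y].
Proof.
move=> Zx; pose K := [set y | connect (er Z) x y].
have KE y : (y \in K) = connect (er Z) x y by rewrite inE.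
clearbody K.
have clK e a b : e \in Z -> joins e a b -> (a \in K) = (b \in K).
  move=> eZ ab; have [->//|nab] := eqVneq a b; rewrite !KE.
  have ab' : connect (er Z) a b by apply/connect1/erP; split=> //; exists e.
  have ba' : connect (er Z) b a by rewrite (sym_connect_sym (er_sym Z)).
  by apply/idP/idP => /connect_trans; apply.
have bdK y : bd (Z :&: inside K) y = (y \in K) && bd Z y.
  case: (boolP (y \in K)) => yK.
    apply: eq_bd_at => e ey; rewrite in_setI; case: (boolP (e \in Z)) => //= eZ.
    have := clK e _ _ eZ (joins_h e); move: ey; rewrite inE /inc.
    by case: eqP => [->|_]; case: eqP => [->|_] //=; rewrite yK => _; [move=> <-|move=> ->].
  apply: bd_out => e; rewrite in_setI inE => /and3P[_ e1 e2]; rewrite /inc.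
  case: eqP => [e'|_]; first by rewrite e' (negPf yK) in e1.
  by case: eqP => [e'|//]; rewrite e' (negPf yK) in e2.
have xK : x \in K by rewrite KE.
have [|y yx] := @bd_other (Z :&: inside K) x; first by rewrite bdK xK.
by rewrite bdK KE => /andP[xy Zy]; exists y.
Qed.

(** [T] is the sum of the edges of a walk; repeated edges cancel, so the walk need not be a path. *)
Lemma join_path F K a b : conn (er F) K -> a \in K -> b \in K -> exists T,
  [/\ T \subset F, T \subset inside K & forall x, bd T x = (x == a) (+) (x == b)].
Proof.
move=> /connP cK aK bK; have /connectP[p + ->] := cK a b aK bK.
elim: p a {aK} => [|c p IH] a /=.
  by move=> _; exists set0; rewrite !sub0set; split=> // x; rewrite bd0 addbb.
case/andP=> /and3P[/erP[ac [e eF eac]] aK cK'] /IH[T [TF TK Tbd]].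
exists (symd [set e] T); split.
- by apply: symd_sub; rewrite // sub1set.
- by apply: symd_sub; rewrite // sub1set (joins_inside _ eac) aK.
- move=> x; rewrite bd_symd bd1 (joins_inc _ eac) Tbd.
  by case: (x == a); case: (x == c); case: (x == last c p).
Qed.

Lemma cyc_pendant F e x Z : Z \in cyc F -> inc e x ->
  (forall f, f \in F -> inc f x -> f = e) -> e \notin Z.
Proof.
move=> /cycP[/subsetP ZF Zev] ex one; apply/negP => eZ; have := Zev x.
rewrite (@eq_bd_at _ [set e]) ?bd1 ?ex // => f fx; rewrite inE.
by apply/idP/eqP => [/ZF/one|->//]; apply.
Qed.

Lemma cyc_splitE F1 F2 Z : [disjoint F1 & F2] -> Z \in cyc (F1 :|: F2) ->
  Z = symd (Z :&: F1) (Z :&: F2).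
Proof.
move=> dF /cycP[/subsetP ZF _]; apply/setP => f; rewrite in_symd !in_setI.
have := ZF f; have := disjointFr dF (x := f); rewrite in_setU.
by case: (f \in Z) => //; case: (f \in F1) => [/(_ isT)->//|_ /(_ isT) /= ->].
Qed.

Lemma bd_cyc_split F1 F2 Z x : [disjoint F1 & F2] -> Z \in cyc (F1 :|: F2) ->
  bd (Z :&: F1) x = bd (Z :&: F2) x.
Proof.
move=> dF Zc; have /cycP[_ /(_ x)] := Zc.
by rewrite {1}(cyc_splitE dF Zc) bd_symd; case: (bd _ _); case: (bd _ _).
Qed.

End CycleSpace.

(** * Even sets and graph cycles *)

Section Polygons.
Variables (G : mgraph) (h : edge G -> G * G).
Hypothesis hE : forall e, ends e = [set (h e).1; (h e).2].
Implicit Types (Z : {set edge G}).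

Lemma joins_ends e a b : joins h e a b = (ends e == [set a; b]).
Proof.
rewrite hE /joins; case: (h e) => c d /=; apply/orP/eqP => [[]/eqP[-> ->]//|].
  by rewrite setUC.
by case/set2_eq=> -[-> ->]; [left | right].
Qed.

(** Without the edge [e], the odd vertices of [Z] are exactly the ends of [e], so these are linked
    by the remaining edges. *)
Lemma even_not_forest Z : Z != set0 -> even h Z -> ~~ forest Z.
Proof.
case/set0Pn=> e eZ /evenP Zev; rewrite -(setD1K eZ).
apply: (linked_not_forest (u := (h e).1) (v := (h e).2)) => //.
  by rewrite setD11.
have [->|uv] := eqVneq (h e).1 (h e).2; first exact: connect0.
have D1 x : bd h (Z :\ e) x = inc h e x.
  have -> : Z :\ e = symd Z [set e].
    by apply/setP => f; rewrite in_symd !inE; case: eqP => [->|]; rewrite ?eZ ?addbF.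
  by rewrite bd_symd Zev bd1.
have [|y [yu Dy uy]] := @bd_linked _ _ h (Z :\ e) (h e).1.
  by rewrite D1 /inc eqxx eq_sym (negPf uv).
have -> : (h e).2 = y.
  by move: Dy; rewrite D1 /inc eq_sym (negPf yu) => /eqP.
apply: connect_sub uy => a b /erP[_ [f fZ fab]]; apply: connect1.
by apply/exists_inP; exists f => //; rewrite -joins_ends.
Qed.

Lemma polygon_even k (v : {ffun 'I_k -> G}) (g : {ffun 'I_k -> edge G}) :
  is_polygon v g -> even h [set g i | i : 'I_k].
Proof.
case/and3P=> vinj ginj /forallP vg; apply/evenP => x.
rewrite /bd big_imset /=; last by move=> i j _ _; apply/injectiveP.
rewrite (eq_bigr (fun i => (x == v i) (+) (x == v (ordS i)))).
  rewrite big_split /= [X in _ (+) X](_ : _ = \big[addb/false]_(i : 'I_k) (x == v i)).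
    by rewrite addbb.
  rewrite [RHS](reindex (@ordS k)) //=.
  exists (@ord_pred k) => i _; [exact: ordSK | exact: ord_predK].
by move=> i _; apply: joins_inc; rewrite joins_ends.
Qed.

Lemma dependent_even Z : ~~ forest Z ->
  exists Y : {set edge G}, [/\ Y \subset Z, Y != set0 & even h Y].
Proof.
case/forestPn=> k [v [g [vg gZ]]]; exists [set g i | i : 'I_k.+1]; split.
- by apply/subsetP => _ /imsetP[i _ ->].
- by apply/set0Pn; exists (g ord0); apply: imset_f.
- exact: polygon_even vg.
Qed.

End Polygons.

Section MinimalEvenSets.
Variables (V E : finType) (h : E -> V * V).
Implicit Types (Z Y F : {set E}).

Definition minimal_even Z := [/\ Z != set0, even h Z
  & forall Y, Y \subset Z -> even h Y -> Y = set0 \/ Y = Z].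

Lemma hgraph_proof e : 0 < #|[set (h e).1; (h e).2]| <= 2.
Proof. by rewrite cards2; case: (_ != _). Qed.

(** This makes the results on [forest] and [ends] available for a bare end map. *)
Definition hgraph : mgraph := MGraph hgraph_proof.

(** [Z] is not a forest, so it contains a polygon, whose edges form an even set; by minimality that
    set is [Z]. *)
Lemma minimal_even_polygon Z : minimal_even Z -> exists n (w : nat -> V) (d : nat -> E),
  [/\ 0 < n, forall i j, i < n -> j < n -> w i = w j -> i = j,
    forall i j, i < n -> j < n -> d i = d j -> i = j,
    forall i, i.+1 < n -> joins h (d i) (w i) (w i.+1)
    & joins h (d n.-1) (w n.-1) (w 0) /\ Z = seg d 0 n].
Proof.
case=> Z0 Zev Zmin.
have hE : forall e : edge hgraph, ends e = [set (h e).1; (h e).2] by [].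
have /forestPn[k [v [g [vg gZ]]]] := even_not_forest hE Z0 Zev.
have Ysub : [set g i | i : 'I_k.+1] \subset Z.
  by apply/subsetP => _ /imsetP[i _ ->].
have [Y0|YZ] := Zmin _ Ysub (polygon_even hE vg).
  have : g ord0 \in [set g i | i : 'I_k.+1] by apply: imset_f.
  by rewrite Y0 inE.
case/and3P: vg => /injectiveP vinj /injectiveP ginj /forallP vg.
have ordE i : i < k.+1 -> (inord i : 'I_k.+1) = i :> nat by move=> ?; rewrite inordK.
exists k.+1, (fun i => v (inord i)), (fun i => g (inord i)); split=> //.
- by move=> i j ik jk /vinj e; rewrite -(ordE i) // -(ordE j) // e.
- by move=> i j ik jk /ginj e; rewrite -(ordE i) // -(ordE j) // e.
- move=> i ik; rewrite (joins_ends hE) (eqP (vg _)) /=.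
  rewrite (_ : ordS (inord i) = inord i.+1) //; apply: val_inj => /=.
  by rewrite !inordK ?modn_small // ltnW.
split.
  rewrite (joins_ends hE) (eqP (vg _)) /=.
  rewrite (_ : ordS (inord k) = inord 0) //; apply: val_inj => /=.
  by rewrite !inordK ?modnn.
rewrite -YZ; apply/setP => e; apply/imsetP/segP => [[i _ ->]|[i /andP[_ ik] ->]].
  by exists i; rewrite ?ltn_ord // inord_val.
by exists (inord i).
Qed.

End MinimalEvenSets.

(** * Peripheral cycles span the even sets *)

Section Spans.
Variables (E : finType) (P : {set {set E}}).
Implicit Types Z Y : {set E}.

Definition spanned Z := [exists s : {set {set E}}, (s \subset P) && (Z == fsum id s)].

Lemma spannedP Z : reflect (exists2 s : {set {set E}}, s \subset P & Z = fsum id s)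
  (spanned Z).
Proof.
apply: (iffP existsP) => [[s /andP[sP /eqP ->]]|[s sP ->]]; first by exists s.
by exists s; rewrite sP eqxx.
Qed.

Lemma spanned0 : spanned set0.
Proof. by apply/spannedP; exists set0; rewrite ?sub0set ?fsum0. Qed.

Lemma spanned_mem Z : Z \in P -> spanned Z.
Proof. by move=> ZP; apply/spannedP; exists [set Z]; rewrite ?sub1set ?fsum1. Qed.

Lemma spanned_symd Z Y : spanned Z -> spanned Y -> spanned (symd Z Y).
Proof.
move=> /spannedP[s sP ->] /spannedP[t tP ->]; rewrite -fsum_symd.
by apply/spannedP; exists (symd s t) => //; apply: symd_sub.
Qed.

End Spans.

Section Tutte.
Variables (V E : finType) (h : E -> V * V) (F : {set E}) (S : {set V}).
Implicit Types (Z Y T : {set E}) (A B D K X : {set V}).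
Local Notation r := (er h F).
Local Notation joins := (joins h).
Local Notation inside := (inside h).
Local Notation cyc := (cyc h F).

Hypothesis F_S : F \subset inside S.
Hypothesis loopless : forall e, e \in F -> (h e).1 != (h e).2.
Hypothesis simple : forall e f a b,
  e \in F -> f \in F -> joins e a b -> joins f a b -> e = f.
Hypothesis conn3 : forall W : {set V}, #|W| <= 2 -> conn r (S :\: W).

Definition induced X := F :&: inside X.

Definition peri_edges := [set induced X | X in [set X | peri r S X]].

Local Notation spanned := (spanned peri_edges).

Let r_sym : symmetric r := er_sym h F.

Lemma insideS K K' : K \subset K' -> inside K \subset inside K'.
Proof.
move=> /subsetP s; apply/subsetP => e; rewrite !inE => /andP[/s -> /s ->].
by [].
Qed.

Lemma joins_uniq e a b a' b' : joins e a b -> joins e a' b' ->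
  (a = a' /\ b = b') \/ (a = b' /\ b = a').
Proof.
move=> /orP[]/eqP hab /orP[]/eqP; rewrite hab => -[-> ->]; auto.
Qed.

Lemma joins_neq e a b : e \in F -> joins e a b -> a != b.
Proof. by move=> /loopless + /orP[]/eqP he; rewrite he //= eq_sym. Qed.

Lemma rP a b : reflect (exists2 e, e \in F & joins e a b) (r a b).
Proof.
apply: (iffP (erP h F a b)) => [[]//|[e eF eab]]; split; last by exists e.
exact: joins_neq eab.
Qed.

Definition next n k := if k.+1 < n then k.+1 else 0.

Record polygon n (w : nat -> V) (d : nat -> E) Z : Prop := Polygon {
  pg_icyc : icyc r n w;
  pg_inj : forall i j, i < n -> j < n -> d i = d j -> i = j;
  pg_joins : forall k, k < n -> joins (d k) (w k) (w (next n k));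
  pg_seg : Z = seg d 0 n;
  pg_induced : Z = induced (seg w 0 n) }.

Lemma bd_arc n w d : (forall k, k < n -> joins (d k) (w k) (w (next n k))) ->
  (forall i j, i < n -> j < n -> d i = d j -> i = j) ->
  forall i j, i <= j < n -> forall x, bd h (seg d i j) x = (x == w i) (+) (x == w j).
Proof.
move=> dj dinj i j ij x; elim: j ij => [|j IH] ij.
  have -> : i = 0 by nlia.
  by rewrite seg_nil // bd0 addbb.
have [->|nij] := eqVneq i j.+1; first by rewrite seg_nil // bd0 addbb.
have -> : seg d i j.+1 = symd (seg d i j) [set d j].
  rewrite segS; last nlia; apply/setP => e; rewrite in_symd in_setU in_set1.
  have [->|_] := eqVneq e (d j); last by rewrite orbF addbF.
  rewrite orbT addbT; symmetry; apply/negP => /segP[k kj /dinj].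
  by nlia.
rewrite bd_symd bd1 IH; last nlia.
have jn : j < n by nlia.
rewrite (joins_inc _ (dj j jn)) /next (_ : j.+1 < n); last nlia.
by case: (x == w i); case: (x == w j); case: (x == w j.+1).
Qed.

Lemma card_seg (T' : finType) (d : nat -> T') n i j : (forall i j, i < n -> j < n -> d i = d j -> i = j) ->
  j <= n -> #|seg d i j| = j - i.
Proof.
move=> dinj jn; rewrite /seg cardsE; have /card_uniqP -> : uniq [seq d k | k <- index_iota i j].
  rewrite map_inj_in_uniq ?iota_uniq // => a b.
  by rewrite !mem_index_iota => ? ? /dinj; nlia.
by rewrite size_map size_iota.
Qed.

(** A smallest even set that is not spanned is never a sum of two smaller ones. So it has no proper
    nonempty even subset, which makes it a polygon, and the polygon has no chord, since a chord
    would split it into two shorter ones. *)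
Lemma minimal_polygon (Y : {set V}) Z : Z \in cyc -> Z \subset inside Y -> ~~ spanned Z ->
  (forall Z', Z' \in cyc -> Z' \subset inside Y -> #|Z'| < #|Z| -> spanned Z') ->
  exists n w d, polygon n w d Z /\ seg w 0 n \subset Y.
Proof.
move=> Zcyc ZY nZ Zmin; have /cycP[ZF Zev] := Zcyc.
have split T : T \in cyc -> T \subset inside Y -> #|T| < #|Z| -> #|symd Z T| < #|Z| -> False.
  move=> Tcyc TY T1 T2; move/negP: nZ; apply; rewrite -(symdK Z T).
  by apply: spanned_symd; apply: Zmin => //; [apply: cyc_symd | apply: symd_sub].
have : minimal_even h Z.
  split; first by apply: contraNneq nZ => ->; apply: spanned0.
    by apply/evenP.
  move=> T TZ Tev; have [->|T0] := eqVneq T set0; first by left.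
  have [->|TneZ] := eqVneq T Z; first by right.
  have sT : symd Z T = Z :\: T by rewrite /symd (eqP (_ : T :\: Z == set0)) ?setU0 ?setD_eq0.
  case: (split T).
  - by rewrite inE (subset_trans TZ).
  - exact: subset_trans ZY.
  - by apply: proper_card; rewrite properEneq TneZ.
  - rewrite sT; apply: proper_card; rewrite properEneq subsetDl andbT.
    have /set0Pn[e eT] := T0; apply/eqP => ZE.
    by have := subsetP TZ _ eT; rewrite -ZE inE eT.
case/minimal_even_polygon=> n [w [d [n0 winj dinj dj [dl ZE]]]].
have djn k : k < n -> joins (d k) (w k) (w (next n k)).
  move=> kn; rewrite /next; case: ifP => [/dj //|kn1].
  by have -> : k = n.-1 by nlia.
have dF k : k < n -> d k \in F.
  by move=> kn; apply: (subsetP ZF); rewrite ZE; apply: mem_seg.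
have wY k : k < n -> w k \in Y.
  move=> kn; have := subsetP ZY (d k); rewrite ZE mem_seg // => /(_ isT).
  by rewrite (joins_inside _ (djn k kn)) => /andP[].
have n2 : 2 < n.
  case: n n0 winj dinj dj dl ZE djn dF wY => [|[|[|n]]] // _ winj dinj dj dl ZE djn dF wY.
    by have := joins_neq (dF 0 isT) (djn 0 isT); rewrite eqxx.
  have := simple (dF 0 isT) (dF 1 isT) (djn 0 isT); rewrite joinsC => /(_ (djn 1 isT)).
  by move/dinj => /(_ isT isT).
have nomid i j : i < j -> j < n -> r (w i) (w j) -> (j == i.+1) || (i == 0) && (j == n.-1).
  move=> ij jn /rP[e eF eij]; apply: contraT => nij.
  have iT : i <= j < n by nlia.
  have Tbd := bd_arc djn dinj iT.
  have sZ : seg d i j \subset Z.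
    by rewrite ZE; apply/subsetP => f /segP[k kij ->]; apply: mem_seg; nlia.
  have cZ : #|Z| = n by rewrite ZE (card_seg _ dinj) // subn0.
  have cT : #|seg d i j| = j - i by apply: (card_seg _ dinj); nlia.
  have csymd (A B : {set E}) : #|symd A B| <= #|A| + #|B|.
    apply: leq_trans (_ : #|A :\: B| + #|B :\: A| <= _).
      by rewrite /symd cardsU leq_subr.
    by apply: leq_add; apply/subset_leq_card/subsetDl.
  case: (split (symd [set e] (seg d i j))).
  - apply/cycP; split; first by rewrite symd_sub ?sub1set // (subset_trans sZ).
    by move=> x; rewrite bd_symd bd1 Tbd (joins_inc _ eij) addbb.
  - apply: symd_sub; last exact: subset_trans ZY.
    by rewrite sub1set (joins_inside _ eij) !wY //; nlia.
  - by have := csymd [set e] (seg d i j); rewrite cards1 cT cZ; nlia.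
  - rewrite [symd [set e] _]symdC symdA.
    have -> : symd Z (seg d i j) = Z :\: seg d i j.
      by rewrite /symd (eqP (_ : _ :\: Z == set0)) ?setU0 ?setD_eq0.
    have := csymd (Z :\: seg d i j) [set e]; rewrite cards1 cardsD (setIidPr sZ) cT cZ.
    by nlia.
have cw : icyc r n w.
  apply/icycP; split=> // i j i_n j_n; apply/idP/idP.
    have [ij|ji|->] := ltngtP i j.
    - by move/(nomid i j ij j_n); nlia.
    - by rewrite r_sym => /(nomid j i ji i_n); nlia.
    - by move=> /rP[e eF /(joins_neq eF)]; rewrite eqxx.
  have rn k : k < n -> r (w k) (w (next n k)).
    by move=> kn; apply/rP; exists (d k); [apply: dF | apply: djn].
  have rs k : k.+1 < n -> r (w k) (w k.+1).
    by move=> kn; have := rn k; rewrite /next kn; apply; nlia.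
  have rl : r (w n.-1) (w 0).
    by have := rn n.-1; rewrite /next (_ : n.-1.+1 < n = false); [apply; nlia | nlia].
  case/or4P=> [/eqP e|/eqP e|/andP[/eqP e /eqP e']|/andP[/eqP e /eqP e']]; subst.
  - exact: rs.
  - by rewrite r_sym; apply: rs.
  - by rewrite r_sym.
  - exact: rl.
exists n, w, d; split; last by apply/subsetP => x /segP[k kn ->]; apply: wY; nlia.
split=> //; apply/setP => e; apply/idP/idP.
  rewrite ZE => /segP[k kn ->]; rewrite inE dF //= (joins_inside _ (djn k _)) //.
  by rewrite !mem_seg // /next; case: ifP; nlia.
rewrite inE => /andP[eF]; rewrite inE => /andP[/segP[i i_n ei] /segP[j j_n ej]].
have eij : joins e (w i) (w j) by rewrite -ei -ej joins_h.
have : r (w i) (w j) by apply/rP; exists e.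
have [_ _ wadj] := icycP cw; rewrite wadj; try nlia; move=> hij.
have dk k : k < n -> joins e (w k) (w (next n k)) -> e \in Z.
  by move=> kn ek; rewrite (simple eF (dF k kn) ek (djn k kn)) ZE mem_seg.
case/or4P: hij => [/eqP e0|/eqP e0|/andP[/eqP e0 /eqP e1]|/andP[/eqP e0 /eqP e1]]; subst.
- by apply: (dk i) => //; rewrite /next (_ : i.+1 < n).
- by apply: (dk j) => //; rewrite joinsC /next (_ : j.+1 < n).
- apply: (dk n.-1); first nlia.
  by rewrite joinsC /next (_ : n.-1.+1 < n = false) //; nlia.
- apply: (dk n.-1); first nlia.
  by rewrite /next (_ : n.-1.+1 < n = false) //; nlia.
Qed.

Lemma mem_segE (d : nat -> E) n m i j :
  (forall i j, i < n -> j < n -> d i = d j -> i = j) -> m < n -> j <= n ->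
  (d m \in seg d i j) = (i <= m < j).
Proof.
move=> dinj mn jn; apply/segP/idP => [[k kij /dinj e]|mij]; last by exists m.
by rewrite e //; nlia.
Qed.

Lemma seg_inside n w d i j K : (forall k, k < n -> joins (d k) (w k) (w (next n k))) ->
  j <= n -> (forall k, i <= k < j -> w k \in K /\ w (next n k) \in K) ->
  seg d i j \subset inside K.
Proof.
move=> dj jn hK; apply/subsetP => e /segP[k kij ->].
rewrite (joins_inside _ (dj k _)); last nlia.
by have [-> ->] := hK k kij.
Qed.

(* The induction step: [B] is a connected set, [A] the set of its neighbours in the
   complement [Y], and all even sets in [Y] that miss a vertex of [A] are spanned;
   [Z] is a smallest even set in [Y] that is not. *)
Section Step.
Variables (B : {set V}) (Z : {set E}) (n : nat) (w : nat -> V) (d : nat -> E).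
Let Y := S :\: B.
Let A := [set a in Y | adj r [set a] B].
Let X := seg w 0 n.
Hypothesis missing : forall a Z', a \in A -> Z' \in cyc -> Z' \subset inside (Y :\ a) ->
  spanned Z'.
Hypothesis pg : polygon n w d Z.
Hypothesis XY : X \subset Y.
Hypothesis Zcyc : Z \in cyc.
Hypothesis nZ : ~~ spanned Z.

Let wY k : k < n -> w k \in Y.
Proof. by move=> kn; apply: (subsetP XY); apply: mem_seg. Qed.

Let next_lt k : k < n -> next n k < n.
Proof. by rewrite /next; case: ifP => //; nlia. Qed.

Let winj i j : i < n -> j < n -> w i = w j -> i = j.
Proof. by have [_ H _] := icycP (pg_icyc pg); apply: H. Qed.

(** Were [X] to miss a vertex of [A], [missing] would span [Z]. *)
Lemma attach_X : A \subset X.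
Proof.
apply/subsetP => a aA; apply: contraNT nZ => aX; apply: missing aA _ _ => //.
rewrite (pg_induced pg); apply/subsetP => e /setIP[eF].
rewrite !in_inside => /andP[e1 e2].
rewrite !in_setD1 (subsetP XY _ e1) (subsetP XY _ e2) !andbT.
by apply/andP; split; [apply: contraNneq aX => <- | apply: contraNneq aX => <-].
Qed.

(* A path through [D] splits [Z] into two cycles, and one of them would miss a
   vertex of [A] if [A] had elements on both arcs. *)
Lemma arc_misses D i j : conn r D -> D \subset Y :\: X -> i < j -> j < n ->
  adj r [set w i] D -> adj r [set w j] D ->
  (forall k, i < k < j -> w k \notin A) \/
  (forall k, k < n -> (k < i) || (j < k) -> w k \notin A).
Proof.
move=> cD sD ij jn ai aj.
have dj := pg_joins pg.
have [/hasP[k]|/hasPn no] := boolP (has (fun k => w k \in A) (index_iota i.+1 j)); last first.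
  by left=> k kij; apply: no; rewrite mem_index_iota.
rewrite mem_index_iota => kij kA; right => l ln lij; apply/negP => lA.
have DX x : x \in D -> x \in Y /\ x \notin X by move/(subsetP sD) => /setDP[].
pose K := [set w i] :|: (D :|: [set w j]).
have cK : conn r K.
  apply: connU => //; [exact: conn1 | | by rewrite (adj_sub2 _ ai) // subsetUl].
  by apply: connU => //; [apply: conn1 | rewrite (adjC r_sym) aj].
have [T [TF TK Tbd]] : exists T, [/\ T \subset F, T \subset inside K
    & forall x, bd h T x = (x == w i) (+) (x == w j)].
  by apply: join_path => //; rewrite !inE eqxx ?orbT.
have arcbd := bd_arc dj (pg_inj pg) (_ : i <= j < n).
have KY m : m < n -> m != i -> m != j -> K \subset Y :\ w m.
  move=> mn mi mj; apply/subsetP => x; rewrite !in_setU !in_set1 in_setD1.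
  have e m' : m' < n -> m != m' -> (w m' != w m) && (w m' \in Y).
    by move=> mn' ne; rewrite wY // andbT; apply: contraNneq ne => /winj <-.
  case/or3P=> [/eqP->|/DX[-> xX]|/eqP->]; [by apply: e; nlia | | by apply: e; nlia].
  by rewrite andbT; apply: contraNneq xX => ->; apply: mem_seg; nlia.
have ZF : Z \subset F by case/cycP: Zcyc.
have segF a b : b <= n -> seg d a b \subset F.
  move=> bn; apply: subset_trans ZF; rewrite (pg_seg pg).
  by apply/subsetP => x /segP[m mab ->]; apply: mem_seg; nlia.
have ijn : i <= j < n by nlia.
pose Z1 := symd (seg d i j) T.
have Z1c : Z1 \in cyc.
  apply/cycP; split; first by apply: symd_sub => //; apply: segF; nlia.
  by move=> x; rewrite bd_symd Tbd arcbd // addbb.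
have spZ1 : spanned Z1.
  apply: missing lA Z1c _; apply: symd_sub; last first.
    by apply: subset_trans TK (insideS _); apply: KY; nlia.
  apply: (seg_inside dj); first nlia.
  move=> m mij; rewrite !in_setD1 !wY ?next_lt //; try nlia; rewrite !andbT.
  split; apply/eqP; rewrite /next; try case: ifP => ?; move/winj; nlia.
have spZ2 : spanned (symd Z Z1).
  apply: missing kA _ _; first exact: cyc_symd.
  have -> : symd Z Z1 = symd (seg d 0 i :|: seg d j n) T.
    rewrite /Z1 symdA; congr symd; apply/setP => e; rewrite in_symd in_setU.
    rewrite (pg_seg pg); have [/segP[m mn ->]|no] := boolP (e \in seg d 0 n).
      by rewrite !(mem_segE _ (pg_inj pg)); nlia.
    have out a b : b <= n -> (e \in seg d a b) = false.
      by move=> bn; apply: contraNF no => /segP[m mab ->]; apply: mem_seg; nlia.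
    by rewrite !out //; nlia.
  apply: symd_sub; last first.
    by apply: subset_trans TK (insideS _); apply: KY; nlia.
  rewrite subUset; apply/andP; split; apply: (seg_inside dj); try nlia;
    move=> m mij; rewrite !in_setD1 !wY ?next_lt //; try nlia; rewrite !andbT.
    by split; apply/eqP; rewrite /next; try case: ifP => ?; move/winj; nlia.
  by split; apply/eqP; rewrite /next; try case: ifP => ?; move/winj; nlia.
by move/negP: nZ; apply; rewrite -(symdK Z Z1); apply: spanned_symd.
Qed.

(** The triangle is the sum of three even sets, each made of one of its edges and a connection
    through [D]. Each misses the opposite corner, which is in [A], so each is spanned. The
    connection in [Z2] is the sum of the other two, so everything inside [D] cancels. *)
Lemma not_triangle D : conn r D -> D \subset Y :\: X -> n = 3 ->
  (forall k, k < 3 -> w k \in A /\ adj r [set w k] D) -> False.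
Proof.
move=> cD sD n3 hw; have dj := pg_joins pg.
have DX x : x \in D -> x \in Y /\ x \notin X by move/(subsetP sD) => /setDP[].
have ex k : k < 3 -> exists e x, [/\ e \in F, x \in D & joins e (w k) x].
  move=> /hw[_ /adjP[a [b [/set1P-> bD /rP[e eF eab]]]]]; by exists e, b.
have [e0 [x0 [e0F x0D j0]]] := ex 0 isT.
have [e1 [x1 [e1F x1D j1]]] := ex 1 isT.
have [e2 [x2 [e2F x2D j2]]] := ex 2 isT.
have [T [TF TD Tbd]] := join_path cD x0D x1D.
have [U [UF UD Ubd]] := join_path cD x1D x2D.
have [d0 d1 d2] : [/\ joins (d 0) (w 0) (w 1), joins (d 1) (w 1) (w 2)
    & joins (d 2) (w 2) (w 0)].
  by move: (dj 0) (dj 1) (dj 2); rewrite /next n3 /= => -> // -> // -> //.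
have [g0 g1 g2] : [/\ d 0 \in F, d 1 \in F & d 2 \in F].
  have ZF : Z \subset F by case/cycP: Zcyc.
  by split; apply: (subsetP ZF); rewrite (pg_seg pg) mem_seg ?n3.
have wn k k' : k < 3 -> k' < 3 -> k != k' -> w k \in Y :\ w k'.
  move=> k3 k3' ne; rewrite in_setD1 wY ?n3 // andbT.
  by apply: contraNneq ne => /winj; rewrite n3 => ->.
have Dn k : k < 3 -> D \subset Y :\ w k.
  move=> k3; apply/subsetP => x /DX[xY xX]; rewrite in_setD1 xY andbT.
  by apply: contraNneq xX => ->; apply: mem_seg; rewrite n3.
have in1 e a b K : joins e a b -> a \in K -> b \in K -> [set e] \subset inside K.
  by move=> j aK bK; rewrite sub1set (joins_inside _ j) aK.
have inD k x : k < 3 -> x \in D -> x \in Y :\ w k.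
  by move=> k3; apply: (subsetP (Dn k k3)).
have ins k T' : k < 3 -> T' \subset inside D -> T' \subset inside (Y :\ w k).
  by move=> k3 /subset_trans; apply; apply/insideS/Dn.
pose Z0 := symd [set d 0] (symd [set e0] (symd T [set e1])).
pose Z1 := symd [set d 1] (symd [set e1] (symd U [set e2])).
pose Z2 := symd [set d 2] (symd [set e2] (symd U (symd T [set e0]))).
have Z0c : spanned Z0.
  have [a2 _] := hw 2 isT; apply: missing a2 _ _.
    apply/cycP; split; first by do ?[apply: symd_sub]; rewrite ?sub1set.
    move=> x; rewrite !bd_symd !bd1 Tbd (joins_inc _ d0) (joins_inc _ j0) (joins_inc _ j1).
    by case: (x == w 0); case: (x == w 1); case: (x == x0); case: (x == x1).
  by do ?[apply: symd_sub]; try (by apply: ins);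
    [apply: (in1 _ _ _ _ d0)|apply: (in1 _ _ _ _ j0)|apply: (in1 _ _ _ _ j1)]; rewrite ?wn ?inD.
have Z1c : spanned Z1.
  have [a0 _] := hw 0 isT; apply: missing a0 _ _.
    apply/cycP; split; first by do ?[apply: symd_sub]; rewrite ?sub1set.
    move=> x; rewrite !bd_symd !bd1 Ubd (joins_inc _ d1) (joins_inc _ j1) (joins_inc _ j2).
    by case: (x == w 1); case: (x == w 2); case: (x == x1); case: (x == x2).
  by do ?[apply: symd_sub]; try (by apply: ins);
    [apply: (in1 _ _ _ _ d1)|apply: (in1 _ _ _ _ j1)|apply: (in1 _ _ _ _ j2)]; rewrite ?wn ?inD.
have Z2c : spanned Z2.
  have [a1 _] := hw 1 isT; apply: missing a1 _ _.
    apply/cycP; split; first by do ?[apply: symd_sub]; rewrite ?sub1set.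
    move=> x; rewrite !bd_symd !bd1 Ubd Tbd (joins_inc _ d2) (joins_inc _ j2) (joins_inc _ j0).
    by case: (x == w 0); case: (x == w 2); case: (x == x0); case: (x == x1); case: (x == x2).
  by do ?[apply: symd_sub]; try (by apply: ins);
    [apply: (in1 _ _ _ _ d2)|apply: (in1 _ _ _ _ j2)|apply: (in1 _ _ _ _ j0)]; rewrite ?wn ?inD.
have ZE : Z = symd [set d 0] (symd [set d 1] [set d 2]).
  apply/setP => e; rewrite !in_symd !in_set1 (pg_seg pg) n3.
  have dne i j : i < 3 -> j < 3 -> i != j -> (d i == d j) = false.
    by move=> i3 j3; apply: contraNF => /eqP/(pg_inj pg) ->; rewrite ?n3.
  apply/segP/idP => [[[|[|[|k]]] // _ ->]|]; rewrite ?eqxx ?dne //.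
  have [->|_] := eqVneq e (d 0); first by exists 0.
  have [->|_ /= /eqP->] := eqVneq e (d 1); first by exists 1.
  by exists 2.
move/negP: nZ; apply; suff -> : Z = symd Z0 (symd Z1 Z2).
  by apply: spanned_symd Z0c _; apply: spanned_symd.
rewrite ZE; apply/setP => e; rewrite !in_symd.
by case: (e \in [set d 0]); case: (e \in [set d 1]); case: (e \in [set d 2]);
  case: (e \in T); case: (e \in U); case: (e \in [set e0]); case: (e \in [set e1]);
  case: (e \in [set e2]).
Qed.

Hypothesis B0 : B != set0.
Hypothesis BS : B \subset S.

Let AP x : x \in Y -> adj r [set x] B -> x \in A.
Proof. by move=> xY xB; rewrite inE xY. Qed.

Section Separation.
Variables p q : nat.
Hypotheses (pq : p < q) (qn : q < n) (pA : w p \in A) (qA : w q \in A).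
Let Mid := seg w p.+1 q.
Let Out := seg w 0 p :|: seg w q.+1 n.

Let MidP x : x \in Mid -> exists2 k, p < k < q & x = w k.
Proof. by case/segP=> k; exists k. Qed.

Let OutP x : x \in Out -> exists2 k, k < n & x = w k /\ (k < p \/ q < k).
Proof.
case/setUP=> /segP[k kn ->]; exists k; try nlia.
  by split=> //; left; nlia.
by split=> //; right; nlia.
Qed.

Let mid_out : ~~ adj r Mid Out.
Proof.
apply/adjP => -[a [b [/MidP[k kpq ->] /OutP[l ln [-> lpq]]]]].
by have [_ _ wadj] := icycP (pg_icyc pg); rewrite wadj; nlia.
Qed.

(** The ends of such a bridge would have [w p] and [w q] on different arcs, which [arc_misses]
    excludes because both are in [A]. *)
Let no_bridge D : conn r D -> D \subset Y :\: X -> adj r D Mid -> adj r D Out -> False.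
Proof.
move=> cD sD /adjP[a [b [aD /MidP[k kpq ->] ak]]] /adjP[a' [b' [aD' /OutP[l ln [-> lpq]] al]]].
have kD : adj r [set w k] D by apply: (adj_set1 aD); rewrite r_sym.
have lD : adj r [set w l] D by apply: (adj_set1 aD'); rewrite r_sym.
have [kl|lk|e] := ltngtP k l; last by nlia.
  have kn : k < n by nlia.
  case: (arc_misses cD sD kl ln kD lD) => [/(_ q)|/(_ p)]; rewrite ?pA ?qA => H.
    by have /negP := H ltac:(nlia).
  by have /negP := H ltac:(nlia) ltac:(nlia).
have kn : k < n by nlia.
case: (arc_misses cD sD lk kn lD kD) => [/(_ p)|/(_ q)]; rewrite ?pA ?qA => H.
  by have /negP := H ltac:(nlia).
by have /negP := H ltac:(nlia) ltac:(nlia).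
Qed.

(** Deleting [w p] and [w q] leaves [S] connected, so some [R] joins [J] to [J'] or to [B]. As [R]
    avoids [X], and hence [A], it cannot touch [B]; so it is a bridge between the arcs. *)
Lemma separation J J' : (J = Mid /\ J' = Out) \/ (J = Out /\ J' = Mid) ->
  J != set0 -> [disjoint J & A] -> False.
Proof.
move=> JJ' J0 JA.
have JX x : x \in J :|: J' -> exists2 k, k < n & [/\ x = w k, k != p & k != q].
  have M y : y \in Mid -> exists2 k, k < n & [/\ y = w k, k != p & k != q].
    by move/MidP=> [k kpq ->]; exists k; [nlia | split=> //; nlia].
  have O y : y \in Out -> exists2 k, k < n & [/\ y = w k, k != p & k != q].
    by move/OutP=> [k kn [-> kpq]]; exists k; [nlia | split=> //; nlia].
  by case: JJ' => -[-> ->] /setUP[]; auto.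
have XJ x : x \in X -> [|| x == w p, x == w q, x \in J | x \in J'].
  move/segP=> [k kn ->]; have [->|kp] := eqVneq k p; first by rewrite eqxx.
  have [->|kq] := eqVneq k q; first by rewrite eqxx orbT.
  have : (w k \in Mid) || (w k \in Out).
    have [/andP[h1 h2]|nmid] := boolP (p < k < q); first by rewrite mem_seg ?h1.
    by apply/orP; right; apply/setUP; have [kp'|pk] := ltnP k p;
      [left | right]; apply: mem_seg; nlia.
  by case: JJ' => -[-> ->]; case/orP=> ->; rewrite ?orbT.
have nJJ' : ~~ adj r J J' by case: JJ' => -[-> ->]; rewrite // (adjC r_sym).
have JY x : x \in J :|: J' -> x \in Y /\ x \in S :\: [set w p; w q].
  move/JX=> [k kn [-> kp kq]]; have kY := wY kn; split=> //.
  rewrite in_setD in_set2 (subsetP (subsetDl S B) _ kY) andbT negb_or.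
  by apply/andP; split; [move: kp | move: kq]; apply: contraNneq => /winj ->//; nlia.
have cK : conn r (S :\: [set w p; w q]).
  by apply: conn3; rewrite cards2; case: (_ != _).
have BY x : x \in B -> x \notin Y by move=> xB; rewrite in_setD xB.
have pY : w p \in Y by apply: wY; nlia.
have qY : w q \in Y by apply: wY; nlia.
have [||||||R [cR sR RJ RJ']] := cross r_sym cK (P := J) (Q := J' :|: B).
- by apply/subsetP => x xJ; case: (JY x) => //; rewrite inE xJ.
- apply/subsetP => x /setUP[xJ|xB]; first by case: (JY x) => //; rewrite inE xJ orbT.
  rewrite in_setD in_set2 (subsetP BS _ xB) andbT negb_or; have := BY x xB.
  by move=> xY; apply/andP; split; apply: contraNneq xY => ->.
- exact: J0.
- have /set0Pn[b bB] := B0; by apply/set0Pn; exists b; rewrite inE bB orbT.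
- rewrite disjointUr; apply/andP; split.
    apply: disjointI => x; case: JJ' => -[-> ->].
      by move=> /MidP[k kpq ->] /OutP[l ln [/winj e lpq]]; have := e ltac:(nlia) ln; nlia.
    by move=> /OutP[l ln [-> lpq]] /MidP[k kpq /winj e]; have := e ln ltac:(nlia); nlia.
  apply: disjointI => x xJ /BY; case: (JY x) => [|->//]; by rewrite inE xJ.
- rewrite adjUr // negb_or nJJ' /=; apply/negP => /adjP[a [b [aJ bB ab]]].
  have aA : a \in A.
    apply: AP; last exact: adj_set1 ab.
    by case: (JY a) => //; rewrite inE aJ.
  by have := disjointFr JA aJ; rewrite aA.
have sR' : R \subset Y :\: X.
  apply/subsetP => x /(subsetP sR); rewrite !in_setD !in_setU !in_set1 !negb_or.
  case/andP=> /and3P[xJ xJ' xB] /andP[/andP[xp xq] xS]; rewrite xB xS !andbT.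
  by apply/negP => /XJ; rewrite (negPf xp) (negPf xq) (negPf xJ) (negPf xJ').
have {}RJ' : adj r R J'.
  move: RJ'; rewrite adjUr // => /orP[//|/adjP[a [b [aR bB ab]]]].
  have /setDP[aY aX] := subsetP sR' _ aR.
  by rewrite (subsetP attach_X) // in aX; apply: AP => //; apply: adj_set1 ab.
by case: JJ' RJ RJ' => -[-> ->] RJ RJ'; apply: (no_bridge cR sR').
Qed.

End Separation.

(** If all of [X] is in [A], a component [D] of [Y :\: X] has three attachments on [X] by
    3-connectivity. By [arc_misses] they are pairwise consecutive, so [X] is a triangle, contrary to
    [not_triangle]. Otherwise a vertex [w t] outside [A] lies on an arc between two members of [A]
    that has none inside, contrary to [separation]. *)
Lemma step_false : X != Y -> False.
Proof.
move=> XneY; have [n2 _ _] := icycP (pg_icyc pg).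
have BY x : x \in B -> x \notin Y by move=> xB; rewrite in_setD xB.
have YP x : x \in S -> x \notin B -> x \in Y by move=> xS xB; rewrite in_setD xB.
have [b bB] := set0Pn _ B0.
have bS : b \in S by apply: (subsetP BS).
have XS : X \subset S by apply: subset_trans XY (subsetDl _ _).
have cX : #|X| = n by rewrite /X (card_seg (n := n)) ?subn0.
(* Otherwise [S :\: A] is connected and hence inside [B], though [X] has a vertex outside [A]. *)
have A3 : 2 < #|A|.
  rewrite ltnNge; apply/negP => leA.
  have [x xX xA] : exists2 x, x \in X & x \notin A.
    apply/subsetPn; apply: contraL leA => /subset_leq_card.
    by rewrite cX -ltnNge; apply: leq_trans.
  have bA : b \notin A by rewrite inE negb_and (BY b bB).
  have bSA : b \in S :\: A by rewrite in_setD bA.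
  have /subsetP/(_ x) : S :\: A \subset B.
    apply: (conn_closed (conn3 leA) _ bSA bB) => c e cB' _.
    rewrite in_setD => /andP[eA eS] ce; apply: contraNT eA => eB.
    by apply: AP (YP _ eS eB) _; apply: adj_set1 cB' _; rewrite r_sym.
  rewrite in_setD xA (subsetP XS) // => /(_ isT) /BY.
  by rewrite (subsetP XY).
have [y yY yX] : exists2 y, y \in Y & y \notin X.
  by apply/subsetPn; apply: contra XneY => YX; rewrite eqEsubset XY.
have yYX : y \in Y :\: X by rewrite in_setD yX.
pose D := component r (Y :\: X) y.
have cD : conn r D by apply: comp_conn.
have sD : D \subset Y :\: X by apply: comp_sub.
have [AX|] := boolP (X \subset A).
  pose U := [set x in X | adj r [set x] D].
  have U3 : 2 < #|U|.
    rewrite ltnNge; apply/negP => /conn3 cU.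
    have yS : y \in S by move: yY; rewrite in_setD => /andP[].
    have yU : y \in S :\: U by rewrite in_setD inE (negPf yX).
    have bU : b \in S :\: U.
      rewrite in_setD bS andbT inE negb_and; apply/orP; left.
      by apply: contraL bB => /(subsetP XY); rewrite in_setD => /andP[].
    have /subsetP/(_ b bU) : S :\: U \subset D.
      apply: (conn_closed cU _ yU); last exact: comp_refl.
      move=> c e cD' _; rewrite in_setD => /andP[eU eS] ce.
      have /setDP[cY cX'] := subsetP sD _ cD'.
      have eX : e \notin X.
        apply: contra eU => eX; rewrite inE eX; apply: adj_set1 cD' _.
        by rewrite r_sym.
      have eB : e \notin B.
        apply: contra cX' => eB; apply: (subsetP attach_X).
        exact: AP cY (adj_set1 eB ce).
      by apply: (comp_closed yYX cD' _ ce); rewrite in_setD eX YP.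
    by move/(subsetP sD); rewrite in_setD => /andP[_]; apply/negP/BY.
  have [a [c [e [aU cU eU [nac nce nea]]]]] : exists a c e,
      [/\ a \in U, c \in U, e \in U & [/\ a != c, c != e & e != a]].
    by case/card_gt2P: U3 => a [c [e [[? ? ?] ?]]]; exists a, c, e.
  have UP x : x \in U -> exists2 k, k < n & x = w k /\ adj r [set w k] D.
    by rewrite inE => /andP[/segP[k kn ->] kD]; exists k.
  have [i i_n [ai iD]] := UP a aU; have [j j_n [cj jD]] := UP c cU.
  have [k k_n [ek kD]] := UP e eU.
  have wA l : l < n -> w l \in A.
    by move=> ln; apply: (subsetP AX); apply: mem_seg.
  have two i' j' : i' < j' -> j' < n -> adj r [set w i'] D -> adj r [set w j'] D ->
      j' = i'.+1 \/ i' = 0 /\ j' = n.-1.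
    move=> ij jn iD' jD'; case: (arc_misses cD sD ij jn iD' jD') => H.
      left; apply/eqP; apply: contraT => ne; have := H i'.+1.
      by rewrite wA; [move=> /(_ _)/negP; case; nlia | nlia].
    right; split.
      apply/eqP; apply: contraT => ne; have := H 0.
      by rewrite wA; [move=> /(_ _ _)/negP; case; nlia | nlia].
    apply/eqP; apply: contraT => ne; have := H n.-1.
    by rewrite wA; [move=> /(_ _ _)/negP; case; nlia | nlia].
  have nij : i != j by apply: contraNneq nac => e'; rewrite ai cj e'.
  have njk : j != k by apply: contraNneq nce => e'; rewrite cj ek e'.
  have nki : k != i by apply: contraNneq nea => e'; rewrite ai ek e'.
  have any i' j' : i' != j' -> i' < n -> j' < n -> adj r [set w i'] D ->
      adj r [set w j'] D -> [\/ j' = i'.+1, i' = j'.+1,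
        i' = 0 /\ j' = n.-1 | j' = 0 /\ i' = n.-1].
    move=> ne i'n j'n iD' jD'; have [ij|ji|e'] := ltngtP i' j'; last by rewrite e' eqxx in ne.
      by case: (two _ _ ij j'n iD' jD') => ?; [constructor 1 | constructor 3].
    by case: (two _ _ ji i'n jD' iD') => ?; [constructor 2 | constructor 4].
  have h1 := any i j nij i_n j_n iD jD; have h2 := any j k njk j_n k_n jD kD.
  have h3 := any k i nki k_n i_n kD iD.
  have n3 : n = 3.
    by clear -h1 h2 h3 n2 i_n j_n k_n; case: h1 => ?; case: h2 => ?; case: h3 => ?; lia.
  apply: (not_triangle cD sD n3) => l l3; split; first by apply: wA; rewrite n3.
  have : [|| l == i, l == j | l == k].
    by clear -l3 n3 i_n j_n k_n nij njk nki; lia.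
  by case/or3P=> /eqP->.
case/subsetPn=> _ /segP[t /andP[_ tn] ->] tA.
have [a [c [aA cA ac]]] : exists a c, [/\ a \in A, c \in A & a != c].
  by have /card_gt1P[a [c [? ? ?]]] := ltnW A3; exists a, c.
have [i i_n ai] := segP (subsetP attach_X _ aA).
have [j j_n cj] := segP (subsetP attach_X _ cA).
have nij : i != j by apply: contraNneq ac => e; rewrite ai cj e.
have iA : w i \in A by rewrite -ai.
have jA : w j \in A by rewrite -cj.
have above : (exists k, (k < n) && (w k \in A) && (t < k)) \/
    (forall k, k < n -> w k \in A -> k < t).
  have [/hasP[k]|/hasPn no] := boolP (has (fun k => w k \in A) (index_iota t.+1 n)).
    by rewrite mem_index_iota => kn kA; left; exists k; rewrite kA; nlia.
  right=> k kn kA; rewrite ltnNge; apply/negP => tk.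
  have [e|ne] := eqVneq t k; first by rewrite e kA in tA.
  by have := no k; rewrite mem_index_iota kA => /(_ _)/negP; case; nlia.
have below : (exists k, (k < n) && (w k \in A) && (k < t)) \/
    (forall k, k < n -> w k \in A -> t < k).
  have [/hasP[k]|/hasPn no] := boolP (has (fun k => w k \in A) (index_iota 0 t)).
    by rewrite mem_index_iota => kn kA; left; exists k; rewrite kA; nlia.
  right=> k kn kA; rewrite ltnNge; apply/negP => kt.
  have [e|ne] := eqVneq k t; first by rewrite -e kA in tA.
  by have := no k; rewrite mem_index_iota kA => /(_ _)/negP; case; nlia.
(* If all indices of [A] lie on one side of [t], the arc around [w t] passes through index 0 and is
   bounded by the largest and the smallest of them. *)
have outer : (forall k, k < n -> w k \in A -> k < t) \/ (forall k, k < n -> w k \in A -> t < k)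
    -> False.
  move=> side.
  have exA : exists k, (k < n) && (w k \in A) by exists i; rewrite iA andbT; nlia.
  have bndA k : (k < n) && (w k \in A) -> k <= n by move/andP=> [/ltnW].
  case: (ex_minnP exA) => p /andP[pn pA] pmin.
  case: (ex_maxnP exA bndA) => q /andP[qn qA] qmax.
  have ip : p <= i by apply: pmin; rewrite iA andbT; nlia.
  have jp : p <= j by apply: pmin; rewrite jA andbT; nlia.
  have iq : i <= q by apply: qmax; rewrite iA andbT; nlia.
  have jq : j <= q by apply: qmax; rewrite jA andbT; nlia.
  have pq : p < q by nlia.
  apply: (separation pq qn pA qA (or_intror (conj erefl erefl))).
    apply/set0Pn; exists (w t); apply/setUP.
    by case: side => side; [right | left]; apply: mem_seg;
      have := side p pn pA; have := side q qn qA; nlia.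
  apply: disjointI => x /setUP[]/segP[k kk ->] kA.
    by have := pmin k; rewrite kA andbT; nlia.
  by have := qmax k; rewrite kA andbT; nlia.
case: above => [exq|above]; last by apply: outer; left.
case: below => [exp|below]; last by apply: outer; right.
have bndp k : (k < n) && (w k \in A) && (k < t) -> k <= n by move/andP=> [/andP[/ltnW]].
case: (ex_minnP exq) => q /andP[/andP[qn qA] tq] qmin.
case: (ex_maxnP exp bndp) => p /andP[/andP[pn pA] pt] pmax.
apply: (separation (ltn_trans pt tq) qn pA qA (or_introl (conj erefl erefl))).
  by apply/set0Pn; exists (w t); apply: mem_seg; nlia.
apply: disjointI => x /segP[k kk ->] kA.
have [kt|tk|e] := ltngtP k t; last by rewrite -e kA in tA.
  by have := pmax k; rewrite kA kt andbT; nlia.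
by have := qmin k; rewrite kA tk andbT; nlia.
Qed.

End Step.

Lemma minimal_counterexample (Y : {set V}) :
  (exists Z, [/\ Z \in cyc, Z \subset inside Y & ~~ spanned Z]) ->
  exists Z n w d, [/\ Z \in cyc, Z \subset inside Y, ~~ spanned Z, polygon n w d Z
    & seg w 0 n \subset Y].
Proof.
case=> Z0 [Z0c Z0Y nZ0].
pose bad Z := [&& Z \in cyc, Z \subset inside Y & ~~ spanned Z].
have bad0 : bad Z0 by rewrite /bad Z0c Z0Y.
case: (@arg_minnP _ Z0 bad (fun Z => #|Z|) bad0) => Z /and3P[Zc ZY nZ] Zmin.
have [|n [w [d [pg sX]]]] := minimal_polygon Zc ZY nZ.
  move=> Z' Z'c Z'Y; apply: contraLR => nZ'; rewrite -leqNgt; apply: Zmin.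
  by rewrite /bad Z'c Z'Y.
by exists Z, n, w, d.
Qed.

(** Adding a neighbour of [B] to [B] keeps it connected, so the induction hypothesis is the
    assumption [missing]. By [step_false] a minimal counterexample uses every vertex outside [B];
    its complement is then the connected set [B], so it is peripheral. *)
Lemma tutte_avoiding m B : #|S :\: B| <= m -> conn r B -> B != set0 -> B \subset S ->
  forall Z, Z \in cyc -> Z \subset inside (S :\: B) -> spanned Z.
Proof.
elim: m B => [|m IH] B leB cB B0 BS Z Zc ZY.
  move: leB; rewrite leqn0 cards_eq0 => /eqP Y0; move: ZY; rewrite Y0.
  have -> : inside set0 = set0 by apply/setP => e; rewrite !inE.
  by rewrite subset0 => /eqP ->; apply: spanned0.
apply: contraT => nZ.
have [|{Zc ZY nZ}Z [n [w [d [Zc ZY nZ pg XY]]]]] := @minimal_counterexample (S :\: B).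
  by exists Z.
case: (step_false _ pg XY Zc nZ B0 BS).
  move=> a Z' aA Z'c Z'Y; have := aA; rewrite inE => /andP[/setDP[aS aB] aadj].
  have SE : S :\: (a |: B) = (S :\: B) :\ a by rewrite setDDl setUC.
  apply: (IH (a |: B)) => //; last by rewrite SE.
  - rewrite SE; rewrite (cardsD1 a) in_setD aS aB in leB; exact: leB.
  - by apply: connU => //; [apply: conn1 | rewrite aadj].
  - by apply/set0Pn; exists a; rewrite setU11.
  - by rewrite subUset sub1set aS.
apply: contraNneq nZ => XE; apply: spanned_mem; rewrite (pg_induced pg).
apply: imset_f; rewrite inE; apply/periP; split.
- by exists n, w; split=> //; apply: pg_icyc pg.
- by rewrite XE subsetDl.
- by rewrite XE setDDr setDv set0U (setIidPr BS).
Qed.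

Theorem tutte Z : deg3 r S -> Z \in cyc -> spanned Z.
Proof.
move=> d3 Zc; apply: contraT => nZ.
have ZS : Z \subset inside S by case/cycP: (Zc) => ZF _; apply: subset_trans ZF F_S.
have [|{Zc nZ ZS}Z [n [w [d [Zc ZS nZ pg XS]]]]] := @minimal_counterexample S.
  by exists Z.
have cw := pg_icyc pg; have [n2 _ _] := icycP cw.
have w0X : w 0 \in seg w 0 n by apply: mem_seg; nlia.
have [p [q [_ _ _ nbr]]] := icyc_nbr2 cw w0X.
have [y [yS wy yp yq]] := d3 _ p q (subsetP XS _ w0X).
have yX : y \notin seg w 0 n.
  by apply/negP => /nbr; rewrite wy (negPf yp) (negPf yq).
(* The induced cycle misses the third neighbour [y] of its vertex [w 0], and a single vertex is
   connected. *)
rewrite (@tutte_avoiding _ [set y] (leqnn _)) ?conn1 ?sub1set // in nZ.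
  by apply/set0Pn; exists y; rewrite set11.
rewrite (pg_induced pg) in ZS *; apply: subset_trans (subsetIr _ _) _.
apply: insideS; apply/subsetP => x xX; rewrite in_setD1 (subsetP XS _ xX) andbT.
by apply: contraNneq yX => <-.
Qed.

End Tutte.

(** * Cycle systems of subgraphs *)

Section Counting.
Variables (I E : finType) (C : I -> {set E}).
Implicit Types s t : {set I}.

Lemma cntE s e : cnt C s e = #|[set i in s | e \in C i]|.
Proof.
rewrite /cnt -sum1_card big_mkcond [RHS]big_mkcond; apply: eq_bigr => i _.
by rewrite inE; case: (i \in s) => //=; case: (e \in C i).
Qed.

Lemma cnt_sub s t e : s \subset t -> cnt C s e <= cnt C t e.
Proof.
move=> /subsetP st; rewrite !cntE; apply/subset_leq_card/subsetP => i.
by rewrite !inE => /andP[/st -> ->].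
Qed.

Lemma cntD1 s i e : i \in s -> cnt C s e = (e \in C i) + cnt C (s :\ i) e.
Proof.
move=> iS; rewrite /cnt (bigD1 i) //=; congr addn; apply: eq_bigl => j.
by rewrite !inE andbC.
Qed.

Lemma cnt1P s e : cnt C s e = 1 -> exists i, [/\ i \in s, e \in C i
  & forall j, j \in s -> e \in C j -> j = i].
Proof.
rewrite cntE => /eqP/cards1P[i iE]; have : i \in [set i] by rewrite set11.
rewrite -iE inE => /andP[iS ei]; exists i; split=> // j jS ej; apply/set1P.
by rewrite -iE inE jS.
Qed.

Lemma cnt0 s e : (forall i, i \in s -> e \notin C i) -> cnt C s e = 0.
Proof. by move=> H; rewrite /cnt big1 // => i /H/negPf->. Qed.

Lemma fsumD1 s i : i \in s -> fsum C s = symd (C i) (fsum C (s :\ i)).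
Proof.
move=> iS; rewrite -(fsum1 C i) -fsum_symd; congr (fsum C _); apply/setP => j.
by rewrite in_symd !inE; case: eqP => [->|].
Qed.

Lemma eq_fsum C' s : (forall i, i \in s -> C i = C' i) -> fsum C s = fsum C' s.
Proof.
by move=> H; apply/setP => e; rewrite !in_fsum; apply: eq_bigr => i /H ->.
Qed.

Lemma fsum_inj s : (forall t, t \subset s -> t != set0 -> fsum C t != set0) ->
  {in powerset s &, injective (fsum C)}.
Proof.
move=> ind t t'; rewrite !inE => ts ts' e; have := ind (symd t t').
rewrite symd_sub // fsum_symd e symdv eqxx => /(_ isT).
case: eqP => [e0 _|_ /(_ isT)//]; by rewrite -(symdK t t') e0 symdC symd0.
Qed.

End Counting.

Section Bases.
Variable E : finType.
Implicit Types (P B s t : {set {set E}}) (Z : {set E}).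

Definition independent B :=
  [forall s : {set {set E}}, (s \subset B) ==> (s != set0) ==> (fsum id s != set0)].

Lemma independentP B : reflect
  (forall s : {set {set E}}, s \subset B -> s != set0 -> fsum id s != set0)
  (independent B).
Proof.
apply: (iffP forallP) => [H s sB s0|H s]; last by apply/implyP => ?; apply/implyP; apply: H.
by have /implyP/(_ sB)/implyP/(_ s0) := H s.
Qed.

Lemma spanned_fsum P s : (forall X, X \in s -> spanned P X) -> spanned P (fsum id s).
Proof.
move: {2}#|s| (leqnn #|s|) => n; elim: n s => [|n IH] s.
  by rewrite leqn0 cards_eq0 => /eqP-> _; rewrite fsum0 spanned0.
have [->|[X Xs]] := set_0Vmem s; first by rewrite fsum0 spanned0.
rewrite (cardsD1 X) Xs => sn sP; rewrite (fsumD1 _ Xs); apply: spanned_symd.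
  exact: sP.
by apply: IH => // Y /setD1P[_ /sP].
Qed.

Lemma basis_exists P : exists2 B : {set {set E}}, B \subset P &
  independent B /\ forall Z, spanned P Z -> spanned B Z.
Proof.
have i0 : independent set0.
  by apply/independentP => s; rewrite subset0 => ->.
pose ok B := (B \subset P) && independent B.
have [B /maxsetP[/andP[BP indB] Bmax] _] := @maxset_exists _ ok set0
  (introT andP (conj (sub0set P) i0)).
exists B => //; split=> // Z /spannedP[s sP ->]; apply: spanned_fsum => X Xs.
have XP := subsetP sP _ Xs; have [XB|XB] := boolP (X \in B); first exact: spanned_mem.
have : ~~ independent (X |: B).
  apply: contra XB => ind; rewrite -(Bmax (X |: B)) ?setU11 ?subsetUr //.
  by rewrite /ok ind subUset sub1set XP BP.
rewrite negb_forall => /existsP[t]; rewrite !negb_imply => /and4P[tX t0 /eqP ft _].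
have Xt : X \in t.
  apply: contraT => Xt; have tB : t \subset B.
    apply/subsetP => Y Yt; have := subsetP tX _ Yt; rewrite in_setU1.
    by case/orP=> // /eqP e; rewrite -e Yt in Xt.
  by have := independentP _ indB t tB t0; rewrite ft eqxx.
apply/spannedP; exists (t :\ X); first by rewrite subDset.
have e := ft; rewrite (fsumD1 _ Xt) in e.
by rewrite -[LHS](symdK X (fsum id (t :\ X))) [symd X _]e symdC symd0.
Qed.

End Bases.

Section Systems.
Variables (V E : finType).
Implicit Types (h : E -> V * V) (F Z Y : {set E}) (e f : E).

(* Spanning replaces the count of the members in the definition of a cycle
   system: independence follows from the third condition. The last condition,
   for arbitrary [e], is what makes 2-sums along [e] possible. *)
Definition system_at h F e := exists (I : finType) (J : {set I}) (C : I -> {set E}),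
  [/\ forall i, i \in J -> C i \in cyc h F,
      forall Z, Z \in cyc h F -> exists2 s : {set I}, s \subset J & Z = fsum C s,
      forall s : {set I}, s \subset J -> s != set0 ->
        exists Y, [/\ Y \in cyc h F, Y != set0 & forall f, f \in Y -> cnt C s f = 1]
    & (exists2 Z, Z \in cyc h F & e \in Z) -> cnt C J e = 1].

(* If [e] is covered twice, one of the two members is replaced by the sum of the
   basis (for a plane graph, a bounded face by the outer face). *)
Lemma system_of_2basis h F (B : {set {set E}}) : B \subset cyc h F -> independent B ->
  (forall Z, Z \in cyc h F -> spanned B Z) -> (forall f, cnt id B f <= 2) ->
  forall e, system_at h F e.
Proof.
move=> /subsetP Bcyc /independentP ind span cnt2 e.
have finish (C : {set E} -> {set E}) :
    (forall i, i \in B -> C i \in cyc h F) -> (forall f, cnt C B f <= 2) ->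
    forall s : {set {set E}}, s \subset B -> fsum C s != set0 ->
    exists Y, [/\ Y \in cyc h F, Y != set0 & forall f, f \in Y -> cnt C s f = 1].
  move=> Ccyc C2 s sB s0; exists (fsum C s); split=> //.
    by apply: cyc_fsum => X /(subsetP sB)/Ccyc.
  move=> f; rewrite inE; have := leq_trans (cnt_sub C f sB) (C2 f).
  by case: (cnt C s f) => [|[|[|]]].
have [e2|e2] := eqVneq (cnt id B e) 2; last first.
  exists {set E}, B, id; split=> //.
  - by move=> Z /span/spannedP[s]; exists s.
  - by move=> s sB s0; apply: finish => //; apply: ind.
  - case=> Z /span/spannedP[s sB ->]; rewrite inE.
    have := cnt_sub id e sB; have := cnt2 e.
    by move: e2; case: (cnt id B e) => [|[|[|]]] //; case: (cnt id s e).
have [X0 X0B eX0] : exists2 X, X \in B & e \in X.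
  move: e2; rewrite cntE; have [->|[X]] := set_0Vmem [set i in B | e \in i].
    by rewrite cards0.
  by rewrite inE => /andP[XB eX] _; exists X.
pose C X := if X == X0 then fsum id B else X.
have CD (s : {set {set E}}) : X0 \notin s -> fsum C s = fsum id s.
  move=> X0s; apply: eq_fsum => X Xs; rewrite /C ifN //.
  by apply: contraNneq X0s => <-.
have CX0 : C X0 = fsum id B by rewrite /C eqxx.
have Ccyc X : X \in B -> C X \in cyc h F.
  by move=> XB; rewrite /C; case: ifP => _; [apply: cyc_fsum | apply: Bcyc].
have CB f : cnt C B f = (f \in fsum id B) + cnt id (B :\ X0) f.
  rewrite (cntD1 _ _ X0B) CX0; congr addn; apply: eq_bigr => X /setD1P[/negPf XX0 _].
  by rewrite /C XX0.
have C2 f : cnt C B f <= 2.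
  rewrite CB inE; have := cnt2 f; rewrite (cntD1 _ _ X0B).
  by case: (f \in id X0); case: (cnt id (B :\ X0) f) => [|[|[|]]].
have compl (s : {set {set E}}) : s \subset B -> symd (fsum id B) (fsum id s) = fsum id (B :\: s).
  move=> sB; rewrite -fsum_symd; congr fsum; apply/setP => X; rewrite in_symd inE.
  have := subsetP sB X; case: (X \in s); last by rewrite addbF.
  by move=> ->.
exists {set E}, B, C; split=> //.
- move=> Z /span/spannedP[s sB ->]; have [X0s|X0s] := boolP (X0 \in s); last first.
    by exists s => //; rewrite CD.
  (* [C X0] is the sum of all of [B]; adding to it the members outside [s] leaves the sum over
     [s]. *)
  exists (X0 |: (B :\: s)); first by rewrite subUset sub1set X0B subsetDl.
  rewrite (fsumD1 _ (setU11 _ _)) CX0 setU1K ?inE ?X0s // CD ?inE ?X0s //.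
  by rewrite compl ?subsetDl // setDDr setDv set0U (setIidPr sB).
- move=> s sB s0; apply: finish => //; have [X0s|X0s] := boolP (X0 \in s).
    rewrite (fsumD1 _ X0s) CX0 CD ?setD11 // compl; last by apply: subset_trans (subD1set _ _) sB.
    apply: ind; first exact: subsetDl.
    by apply/set0Pn; exists X0; rewrite inE setD11.
  by rewrite CD //; apply: ind.
(* Lying in two members, [e] is not in the total, so only the member other than [X0] still covers
   it. *)
- move=> _; rewrite CB inE e2 /=; move: e2; rewrite (cntD1 _ _ X0B) /= eX0.
  by case.
Qed.

(** A basis with at most two members is always a 2-basis. This base case leaves graphs with more
    than four even sets, which is what later provides four edges and four vertices. *)
Lemma small_system h F : #|cyc h F| <= 4 -> forall e, system_at h F e.
Proof.
move=> le4; have [B BP [ind spn]] := basis_exists (cyc h F).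
apply: (system_of_2basis BP ind) => [Z Zc|f]; first exact/spn/spanned_mem.
have := fsum_inj (independentP _ ind) => /card_in_imset ce.
have : #|B| <= 2.
  rewrite -(leq_exp2l (m := 2)) //; apply: leq_trans le4.
  rewrite -card_powerset -ce; apply/subset_leq_card/subsetP => Z /imsetP[s].
  rewrite inE => sB ->; apply: cyc_fsum => X Xs.
  exact: subsetP BP _ (subsetP sB _ Xs).
apply: leq_trans; rewrite cntE; apply/subset_leq_card/subsetP => X.
by rewrite inE => /andP[].
Qed.

Section SumIndex.
Variables (I1 I2 : finType) (C : I1 + I2 -> {set E}).
Implicit Types s : {set I1 + I2}.

Definition setsum (s1 : {set I1}) (s2 : {set I2}) : {set I1 + I2} :=
  [set x | match x with inl i => i \in s1 | inr j => j \in s2 end].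

Definition lpart s : {set I1} := [set i | inl i \in s].
Definition rpart s : {set I2} := [set j | inr j \in s].

Lemma lpart_setsum (s1 : {set I1}) (s2 : {set I2}) : lpart (setsum s1 s2) = s1.
Proof. by apply/setP => i; rewrite !inE. Qed.

Lemma rpart_setsum (s1 : {set I1}) (s2 : {set I2}) : rpart (setsum s1 s2) = s2.
Proof. by apply/setP => i; rewrite !inE. Qed.

Lemma cnt_sum s f : cnt C s f =
  cnt (fun i => C (inl i)) (lpart s) f + cnt (fun j => C (inr j)) (rpart s) f.
Proof.
rewrite /cnt big_mkcond big_sumType /= -!big_mkcond /=.
by congr addn; apply: eq_bigl => i; rewrite inE.
Qed.

Lemma setsum_sub s (s1 : {set I1}) (s2 : {set I2}) : (s \subset setsum s1 s2) = (lpart s \subset s1) && (rpart s \subset s2).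
Proof.
apply/subsetP/andP => [H|[/subsetP H1 /subsetP H2] [i|j]].
- by split; apply/subsetP => i; rewrite inE => /H; rewrite inE.
- by move=> h; rewrite inE; apply: H1; rewrite inE.
- by move=> h; rewrite inE; apply: H2; rewrite inE.
Qed.

Lemma part_neq0 s : s != set0 -> lpart s = set0 -> rpart s != set0.
Proof.
case/set0Pn=> -[i|j] xs l0; last by apply/set0Pn; exists j; rewrite inE.
by have : i \in lpart s by [rewrite inE]; rewrite l0 inE.
Qed.

End SumIndex.

(** The direct sum, which covers loops, bridges, disconnected graphs and cut vertices alike. For a
    unique union, the even set given by either side works, as the members from the other side do not
    meet it. *)
Lemma system_split h F1 F2 e : [disjoint F1 & F2] ->
  (forall Z, Z \in cyc h (F1 :|: F2) -> even h (Z :&: F1)) ->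
  system_at h F1 e -> system_at h F2 e -> system_at h (F1 :|: F2) e.
Proof.
move=> dF hev [I1 [J1 [C1 [c1 g1 u1 e1]]]] [I2 [J2 [C2 [c2 g2 u2 e2]]]].
pose C (x : I1 + I2) := match x with inl i => C1 i | inr j => C2 j end.
have cC x : x \in setsum J1 J2 -> C x \in cyc h (F1 :|: F2).
  case: x => [i|j]; rewrite inE => /=.
    by move/c1; apply/subsetP/cyc_sub/subsetUl.
  by move/c2; apply/subsetP/cyc_sub/subsetUr.
have part Z : Z \in cyc h (F1 :|: F2) -> [/\ Z :&: F1 \in cyc h F1,
    Z :&: F2 \in cyc h F2 & Z = symd (Z :&: F1) (Z :&: F2)].
  move=> Zc; have /evenP ev1 := hev Z Zc; split; last exact: cyc_splitE dF Zc.
    by rewrite inE subsetIr hev.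
  by rewrite inE subsetIr; apply/evenP => x; rewrite -(bd_cyc_split _ dF Zc) ev1.
have out1 f i : i \in J1 -> f \in C1 i -> f \in F1.
  by move/c1/cycP=> [/subsetP H _]; apply: H.
have out2 f j : j \in J2 -> f \in C2 j -> f \in F2.
  by move/c2/cycP=> [/subsetP H _]; apply: H.
have cnt1F (s : {set I1}) f : s \subset J1 -> f \in F2 -> cnt C1 s f = 0.
  move=> /subsetP sJ fF; apply: cnt0 => i /sJ iJ; apply/negP => /(out1 _ _ iJ) fF1.
  by rewrite (disjointFr dF fF1) in fF.
have cnt2F (s : {set I2}) f : s \subset J2 -> f \in F1 -> cnt C2 s f = 0.
  move=> /subsetP sJ fF; apply: cnt0 => i /sJ iJ; apply/negP => /(out2 _ _ iJ) fF2.
  by rewrite (disjointFr dF fF) in fF2.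
exists (I1 + I2)%type, (setsum J1 J2), C; split=> //.
- move=> Z /part[/g1[s1 s1J Z1] /g2[s2 s2J Z2] ->].
  exists (setsum s1 s2); first by rewrite setsum_sub lpart_setsum rpart_setsum s1J.
  apply/setP => f; rewrite in_symd Z1 Z2 !inE -oddD; congr odd.
  by rewrite cnt_sum lpart_setsum rpart_setsum.
- move=> s; rewrite setsum_sub => /andP[s1J s2J] s0.
  have [l0|l0] := eqVneq (lpart s) set0.
    have [Y [Yc Y0 Yu]] := u2 _ s2J (part_neq0 s0 l0); exists Y; split=> //.
      by move: Yc; apply/subsetP/cyc_sub/subsetUr.
    by move=> f fY; rewrite cnt_sum l0 [X in X + _]cnt0 ?Yu // => i; rewrite inE.
  have [Y [Yc Y0 Yu]] := u1 _ s1J l0; exists Y; split=> //.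
    by move: Yc; apply/subsetP/cyc_sub/subsetUl.
  move=> f fY; rewrite cnt_sum [X in _ + X](cnt2F _ _ s2J) ?addn0 ?Yu //.
  by case/cycP: Yc => /subsetP/(_ f fY).
- case=> Z /part[Z1 Z2 ->]; rewrite in_symd cnt_sum lpart_setsum rpart_setsum => eZ.
  have [eZ1|eZ1] := boolP (e \in Z :&: F1).
    have eF : e \in F1 by case/setIP: eZ1.
    by rewrite (cnt2F J2) // addn0; apply: e1; exists (Z :&: F1).
  have eZ2 : e \in Z :&: F2 by move: eZ; rewrite (negPf eZ1).
  have eF : e \in F2 by case/setIP: eZ2.
  by rewrite (cnt1F J1) // add0n; apply: e2; exists (Z :&: F2).
Qed.

Definition reattach h p (uv : V * V) f := if f == p then uv else h f.

Lemma bd_reattach h p u v Z x : bd (reattach h p (u, v)) Z x =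
  bd h (Z :\ p) x (+) ((p \in Z) && ((x == u) (+) (x == v))).
Proof.
have D : bd (reattach h p (u, v)) (Z :\ p) x = bd h (Z :\ p) x.
  rewrite /bd; apply: eq_bigr => f; rewrite !inE => /andP[/negPf fp _].
  by rewrite /inc /reattach fp.
have [pZ|pZ] := boolP (p \in Z); last first.
  by rewrite addbF -D (_ : Z :\ p = Z) //; apply/setDidPl; rewrite disjoint_sym disjoints1.
have ZE : Z = symd (Z :\ p) [set p].
  by apply/setP => f; rewrite in_symd !inE; case: eqP => [->|]; rewrite ?addbF.
by rewrite {1}ZE bd_symd D bd1 /inc /reattach eqxx /= ![_ == x]eq_sym.
Qed.

Lemma cyc_reattach h p u v F Z : Z \in cyc (reattach h p (u, v)) (p |: F) ->
  Z :\ p \subset F /\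
  forall x, bd h (Z :\ p) x = (p \in Z) && ((x == u) (+) (x == v)).
Proof.
case/cycP=> ZF Zev; split=> [|x]; first by rewrite subDset.
by have := Zev x; rewrite bd_reattach; case: (bd _ _ _); case: (_ && _).
Qed.

Lemma reattach_cyc h p u v F Z (b : bool) : p \notin F -> Z \subset F ->
  (forall x, bd h Z x = b && ((x == u) (+) (x == v))) ->
  (if b then p |: Z else Z) \in cyc (reattach h p (u, v)) (p |: F).
Proof.
move=> pF ZF Zbd; have pZ : p \notin Z by apply: contra pF; apply: (subsetP ZF).
apply/cycP; split=> [|x].
  by case: b {Zbd}; [apply: setUS | apply: subset_trans ZF (subsetUr _ _)].
rewrite bd_reattach; have -> : (if b then p |: Z else Z) :\ p = Z.
  have D : Z :\ p = Z by apply/setDidPl; rewrite disjoint_sym disjoints1.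
  by case: b {Zbd}; rewrite ?setU1K.
by rewrite Zbd; case: b {Zbd}; rewrite ?setU11 ?(negPf pZ) //= addbb.
Qed.

End Systems.

(* A 2-sum along [uv]: edges of the other side, [p] and [q], are reused as the
   virtual edges of the two parts. *)
Section TwoSum.
Variables (V E : finType) (h : E -> V * V) (F1 F2 : {set E}) (u v : V) (p q e : E).
Hypotheses (dF : [disjoint F1 & F2]) (uv : u != v) (pF2 : p \in F2) (qF1 : q \in F1).
Let F := F1 :|: F2.
Let uvb x := (x == u) (+) (x == v).
Hypothesis sep : forall Z, Z \in cyc h F -> forall x,
  bd h (Z :&: F1) x = bd h (Z :&: F1) u && uvb x.
Variable Z0 : {set E}.
Hypotheses (Z0c : Z0 \in cyc h F) (Z0u : bd h (Z0 :&: F1) u).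
Hypothesis eF2 : e \notin F2.

Let pF1 : p \notin F1.
Proof. by rewrite (disjointFl dF pF2). Qed.

Let qF2 : q \notin F2.
Proof. by rewrite (disjointFr dF qF1). Qed.

Let F12 f : f \in F1 -> f \in F2 = false.
Proof. by move/(disjointFr dF). Qed.

Let sep2 Z : Z \in cyc h F -> forall x,
  bd h (Z :&: F2) x = bd h (Z :&: F1) u && uvb x.
Proof.
by move=> Zc x; rewrite -(sep Zc) (bd_cyc_split _ dF Zc).
Qed.

(* The members of the first system that contain the virtual edge [p] are completed
   by [C2 j0], the only member of the second one that contains [q]. *)
Lemma two_sum : system_at (reattach h p (u, v)) (p |: F1) e ->
  system_at (reattach h q (u, v)) (q |: F2) q -> system_at h F e.
Proof.
move=> [I1 [J1 [C1 [c1 g1 u1 e1]]]] [I2 [J2 [C2 [c2 g2 u2 e2]]]].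
(* By [sep] the part of [Z] on one side is either even or odd exactly at [u] and [v]; in the second
   case the virtual edge closes it. *)
pose D1 Z := if bd h (Z :&: F1) u then p |: (Z :&: F1) else Z :&: F1.
pose D2 Z := if bd h (Z :&: F1) u then q |: (Z :&: F2) else Z :&: F2.
have cD1 Z : Z \in cyc h F -> D1 Z \in cyc (reattach h p (u, v)) (p |: F1).
  by move=> Zc; apply: reattach_cyc => //; [apply: subsetIr | apply: sep].
have cD2 Z : Z \in cyc h F -> D2 Z \in cyc (reattach h q (u, v)) (q |: F2).
  by move=> Zc; apply: reattach_cyc => //; [apply: subsetIr | apply: sep2].
have D1E Z f : f \in F1 -> (f \in D1 Z) = (f \in Z).
  move=> fF1; have fp : f != p by apply: contraNneq pF1 => <-.
  by rewrite /D1; case: ifP; rewrite !inE fF1 ?(negPf fp) ?andbT.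
have D2E Z f : f \in F2 -> (f \in D2 Z) = (f \in Z).
  move=> fF; have fq : f != q by apply: contraNneq qF2 => <-.
  by rewrite /D2; case: ifP; rewrite !inE fF ?(negPf fq) ?andbT.
have D1p Z : (p \in D1 Z) = bd h (Z :&: F1) u.
  by rewrite /D1; case: ifP; rewrite !inE ?eqxx // (negPf pF1) andbF.
have D2q Z : (q \in D2 Z) = bd h (Z :&: F1) u.
  by rewrite /D2; case: ifP; rewrite !inE ?eqxx // (negPf qF2) andbF.
have cq : cnt C2 J2 q = 1 by apply: e2; exists (D2 Z0); rewrite ?cD2 ?D2q.
have [j0 [j0J qj0 j0u]] := cnt1P cq.
pose R := C2 j0 :\ q.
pose C (x : I1 + I2) := match x with
  | inl i => symd (C1 i :\ p) (if p \in C1 i then R else set0)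
  | inr j => C2 j end.
pose J := setsum J1 (J2 :\ j0).
have [RF Rbd] := cyc_reattach (c2 _ j0J); rewrite qj0 /= in Rbd.
have C1F i f : i \in J1 -> f \in C1 i -> f != p -> f \in F1.
  by case/c1/cycP => /subsetP H _ /H; rewrite in_setU1 => /orP[/eqP->|//]; rewrite eqxx.
have C2q j : j \in J2 :\ j0 -> q \notin C2 j.
  by case/setD1P=> jj0 jJ; apply: contra jj0 => /(j0u _ jJ) ->.
have C2F j f : j \in J2 :\ j0 -> f \in C2 j -> f \in F2.
  move=> jJ fj; have fq : f != q by apply: contraTneq fj => ->; apply: C2q.
  move: jJ => /setD1P[_ /c2/cycP[/subsetP H _]]; have := H _ fj.
  by rewrite in_setU1 (negPf fq).
have Cl1 i f : i \in J1 -> f \in F1 -> (f \in C (inl i)) = (f \in C1 i).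
  move=> iJ fF; have fp : f != p by apply: contraNneq pF1 => <-.
  have fR : f \notin R by apply/negP => /(subsetP RF); rewrite F12.
  rewrite in_symd in_setD1 fp /=; case: ifP; rewrite ?(negPf fR) ?inE addbF //.
have Cl2 i f : i \in J1 -> f \in F2 -> (f \in C (inl i)) = (p \in C1 i) && (f \in C2 j0).
  move=> iJ fF; have fq : f != q by apply: contraNneq qF2 => <-.
  have fC : f \in C1 i :\ p = false.
    by apply/negP => /setD1P[fp /(C1F _ _ iJ)/(_ fp)] /F12; rewrite fF.
  by rewrite in_symd fC; case: ifP; rewrite !inE ?fq.
have Cr1 j f : j \in J2 :\ j0 -> f \in F1 -> (f \in C (inr j)) = false.
  by move=> jJ fF; apply/negP => /(C2F _ _ jJ); rewrite F12.
have cntF1 (s : {set I1 + I2}) f : s \subset J -> f \in F1 -> cnt C s f = cnt C1 (lpart s) f.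
  rewrite setsum_sub => /andP[/subsetP s1 /subsetP s2] fF; rewrite cnt_sum.
  rewrite [X in _ + X]cnt0 ?addn0; last by move=> j /s2 jJ; rewrite Cr1.
  by apply: eq_bigr => i /s1 iJ; rewrite Cl1.
have cntF2 (s : {set I1 + I2}) f : s \subset J -> f \in F2 ->
    cnt C s f = (f \in C2 j0) * cnt C1 (lpart s) p + cnt C2 (rpart s) f.
  rewrite setsum_sub => /andP[/subsetP s1 _] fF; rewrite cnt_sum; congr addn.
  rewrite /cnt big_distrr /=; apply: eq_bigr => i /s1 iJ; rewrite Cl2 //.
  by rewrite -mulnb mulnC.
have Ccyc x : x \in J -> C x \in cyc h F.
  case: x => [i|j]; rewrite inE => xJ.
    have [sC bC] := cyc_reattach (c1 i xJ); apply/cycP; split=> [|x].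
      apply: symd_sub; first by apply: subset_trans sC (subsetUl _ _).
      by case: ifP => _; [apply: subset_trans RF (subsetUr _ _) | apply: sub0set].
    rewrite bd_symd bC; case: ifP => _; last by rewrite bd0.
    by rewrite Rbd /= addbb.
  have [jj0 jJ] := setD1P xJ; have [sC bC] := cyc_reattach (c2 j jJ).
  have CE : C2 j :\ q = C2 j by apply/setDidPl; rewrite disjoint_sym disjoints1 C2q.
  rewrite CE (negPf (C2q j xJ)) /= in sC bC; apply/cycP; split=> //.
  exact: subset_trans sC (subsetUr _ _).
exists (I1 + I2)%type, J, C; split=> //.
- move=> Z Zc; have [s1 s1J Z1] := g1 _ (cD1 Z Zc); have [s2 s2J Z2] := g2 _ (cD2 Z Zc).
  pose s := setsum s1 (s2 :\ j0).
  have sJ : s \subset J by rewrite setsum_sub lpart_setsum rpart_setsum s1J setSD.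
  exists s => //; apply/setP => f; rewrite [RHS]inE.
  have sc : fsum C s \in cyc h F by apply: cyc_fsum => x /(subsetP sJ)/Ccyc.
  have [fF1|fF1] := boolP (f \in F1).
    by rewrite -(D1E Z f fF1) Z1 inE cntF1 // lpart_setsum.
  have [fF|fF] := boolP (f \in F2); last first.
    have fnF : f \notin F by rewrite inE negb_or fF1.
    have /cycP[/subsetP/(_ f) ZF _] := Zc; have /cycP[/subsetP/(_ f) sF _] := sc.
    rewrite -[RHS](_ : (f \in fsum C s) = _); last by rewrite inE.
    by apply/idP/idP => [/ZF|/sF]; rewrite (negPf fnF).
  rewrite -(D2E Z f fF) Z2 inE cntF2 // lpart_setsum rpart_setsum oddD oddM oddb.
  (* Both sides of [Z] use their virtual edges or neither does, and [q] is in the sum over [s2]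
     exactly if [j0] is in [s2]. So the copies of [R] in the completed members make up for dropping
     [j0]. *)
  have -> : odd (cnt C1 s1 p) = (j0 \in s2).
    have <- : (p \in D1 Z) = odd (cnt C1 s1 p) by rewrite Z1 inE.
    rewrite D1p -D2q Z2 inE; have [j0s|j0s] := boolP (j0 \in s2).
      rewrite (cntD1 _ _ j0s) qj0 cnt0 // => j /setD1P[jj0 js].
      by apply: C2q; rewrite in_setD1 jj0 (subsetP s2J).
    rewrite cnt0 // => j js; apply: C2q; rewrite in_setD1 (subsetP s2J) // andbT.
    by apply: contraNneq j0s => <-.
  have [j0s|j0s] := boolP (j0 \in s2).
    by rewrite (cntD1 _ _ j0s) oddD oddb andbT.
  rewrite andbF /=; congr (odd (cnt _ _ _)); apply/esym/setDidPl.
  by rewrite disjoint_sym disjoints1.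
- move=> s sJ s0; have := sJ; rewrite setsum_sub => /andP[s1J s2J].
  have s2J' : rpart s \subset J2 by apply: subset_trans s2J (subD1set _ _).
  have lift1 Y : Y \in cyc (reattach h p (u, v)) (p |: F1) -> p \notin Y ->
      Y \in cyc h F /\ Y \subset F1.
    move=> /cyc_reattach[sY bY] pY.
    have YE : Y :\ p = Y by apply/setDidPl; rewrite disjoint_sym disjoints1.
    rewrite YE (negPf pY) in sY bY; split=> //; apply/cycP; split=> //.
    exact: subset_trans sY (subsetUl _ _).
  have lift2 Y : Y \in cyc (reattach h q (u, v)) (q |: F2) -> q \notin Y ->
      Y \in cyc h F /\ Y \subset F2.
    move=> /cyc_reattach[sY bY] qY.
    have YE : Y :\ q = Y by apply/setDidPl; rewrite disjoint_sym disjoints1.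
    rewrite YE (negPf qY) in sY bY; split=> //; apply/cycP; split=> //.
    exact: subset_trans sY (subsetUr _ _).
  have [l0|l0] := eqVneq (lpart s) set0.
    have [Y [Yc Y0 Yu]] := u2 _ s2J' (part_neq0 s0 l0).
    have qY : q \notin Y.
      apply/negP => /Yu; rewrite cnt0 // => j js; apply: C2q.
      exact: subsetP s2J _ js.
    have [Ych YF] := lift2 Y Yc qY; exists Y; split=> // f fY.
    rewrite cntF2 ?(subsetP YF) // l0 [cnt C1 _ _]cnt0 ?muln0 ?Yu // => i.
    by rewrite inE.
  have [Y [Yc Y0 Yu]] := u1 _ s1J l0; have [pY|pY] := boolP (p \in Y); last first.
    have [Ych YF] := lift1 Y Yc pY; exists Y; split=> // f fY.
    by rewrite cntF1 ?(subsetP YF) // Yu.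
  have [YF Ybd] := cyc_reattach Yc; rewrite pY /= in Ybd.
  (* As [p] is covered once by the first part of [s], exactly one copy of [R] occurs. So on [F2] the
     family [s] counts like [rpart s] with [j0] added, and the second system is applied to that. *)
  have j0r : j0 \notin rpart s.
    by apply/negP => /(subsetP s2J); rewrite setD11.
  have sub2 : j0 |: rpart s \subset J2 by rewrite subUset sub1set j0J.
  have n0 : j0 |: rpart s != set0 by apply/set0Pn; exists j0; rewrite setU11.
  have [W [Wc W0 Wu]] := u2 _ sub2 n0.
  have cntW f : f \in F2 -> f \in W -> cnt C s f = 1.
    move=> fF /Wu; rewrite cntF2 // (Yu p pY) muln1 => <-.
    by rewrite (cntD1 _ _ (setU11 _ _)) setU1K.
  have [qW|qW] := boolP (q \in W); last first.
    have [Wch WF] := lift2 W Wc qW; exists W; split=> // f fW.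
    by apply: cntW => //; apply: (subsetP WF).
  have [WF Wbd] := cyc_reattach Wc; rewrite qW /= in Wbd.
  exists (symd (Y :\ p) (W :\ q)); split.
  - apply/cycP; split=> [|x]; last by rewrite bd_symd Ybd Wbd addbb.
    by apply: symd_sub; [apply: subset_trans YF (subsetUl _ _) |
      apply: subset_trans WF (subsetUr _ _)].
  - apply/negP => /eqP S0; have : bd h (Y :\ p) u by rewrite Ybd eqxx (negPf uv).
    have YW : Y :\ p = W :\ q.
      by rewrite -(symdK (Y :\ p) (W :\ q)) S0 symdC symd0.
    have Y00 : Y :\ p = set0.
      apply/setP => f; rewrite in_set0; apply/negP => fY.
      by have := F12 (subsetP YF _ fY); rewrite (subsetP WF) // -YW.
    by rewrite Y00 bd0.
  - move=> f; rewrite in_symd; have [fY _|fY /= fW] := boolP (f \in Y :\ p).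
      rewrite cntF1 ?(subsetP YF) // Yu //.
      by case/setD1P: fY.
    apply: cntW; first exact: subsetP WF _ fW.
    by case/setD1P: fW.
- case=> Z Zc eZ; have eF1 : e \in F1.
    by have /cycP[/subsetP/(_ e eZ) + _] := Zc; rewrite inE (negPf eF2) orbF.
  rewrite cntF1 // lpart_setsum; apply: e1; exists (D1 Z); rewrite ?cD1 //.
  by rewrite D1E.
Qed.

End TwoSum.

(** * K33 minors of the parts of a 2-sum *)

Section MinorTransfer.
Variable V : finType.
Implicit Types (r : rel V) (K : {set V}).

Lemma conn_sub r r' K : (forall a b, a \in K -> b \in K -> r' a b -> r a b) ->
  conn r' K -> conn r K.
Proof.
move=> s /connP cK; apply/connP => a b aK bK; apply: connect_sub (cK a b aK bK).
by move=> x y /and3P[xy xK yK]; apply: connect1; rewrite /restr xK yK s.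
Qed.

Lemma adj_subrel r r' (A B : {set V}) : subrel r' r -> adj r' A B -> adj r A B.
Proof. by move=> s /adjP[a [b [aA bB /s ab]]]; apply/adjP; exists a, b. Qed.

Lemma has_K33_sub r r' : subrel r' r -> has_K33 r' -> has_K33 r.
Proof.
move=> s [B [dB cB aB]]; exists B; split=> // [x|i j].
  by apply: conn_sub (cB x) => a b _ _; apply: s.
exact: adj_subrel (aB i j).
Qed.

(* The edge [uv] of [r'] is replaced by a path through [K]. *)
Lemma has_K33_subdivide r r' u v K : symmetric r -> symmetric r' ->
  (forall a b, r' a b -> [\/ r a b, a = u /\ b = v | a = v /\ b = u]) ->
  conn r K -> adj r [set u] K -> adj r [set v] K ->
  (forall x y, x \in K -> ~~ r' x y) -> has_K33 r' -> has_K33 r.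
Proof.
move=> rs rs' rr' cK uK vK isoK [B [dB cB aB]].
(* Each branch set is connected and contains an end of an edge of [r'], so it has no vertex isolated
   in [r']. *)
have KB x s : x \in K -> x \in B s -> False.
  move=> xK xB; have [a [b [aB' ab]]] : exists a b, a \in B s /\ r' a b.
    case: s xB => [i|j] _.
      by have /adjP[a [b [? _ ?]]] := aB i ord0; exists a, b.
    by have /adjP[a [b [_ ? ab]]] := aB ord0 j; exists b, a; rewrite rs'.
  have /connectP[[|c l] /=] := connP (cB s) x a xB aB'.
    by move=> _ e; have := isoK x b xK; rewrite -e ab.
  by move=> /andP[/and3P[xc _ _] _] _; have := isoK x c xK; rewrite xc.
(* [K] is added to the branch set of [u], which then reaches [v] whether [uv] was used inside a
   branch set or between two. *)
pose B' s := if u \in B s then B s :|: K else B s.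
have BB' s : B s \subset B' s by rewrite /B'; case: ifP => // _; apply: subsetUl.
exists B'; split=> [s t st|s|i j].
- apply: disjointI => x; rewrite /B'; have dst := dB s t st.
  case: ifP => us; case: ifP => ut.
  + by have := disjointFr dst us; rewrite ut.
  + case/setUP => [xs xt|xK /(KB _ _ xK)//]; by have := disjointFr dst xs; rewrite xt.
  + move=> xs /setUP[xt|xK]; last exact: (KB _ _ xK xs).
    by have := disjointFr dst xs; rewrite xt.
  + by move=> xs xt; have := disjointFr dst xs; rewrite xt.
- rewrite /B'; case: ifP => us; last first.
    apply: conn_sub (cB s) => a b aB' bB' /rr'[//|[e _]|[_ e]].
      by rewrite -e aB' in us.
    by rewrite -e bB' in us.
  have cKu x : x \in K -> connect (restr r (B s :|: K)) u x.
    case/adjP: uK => _ [k [/set1P-> kK uk]] xK.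
    apply: (connect_trans (y := k)); first by apply: connect1; rewrite /restr uk !inE us kK orbT.
    by apply: connect_restrS (connP cK k x kK xK); apply: subsetUr.
  have cuv : v \in B s -> connect (restr r (B s :|: K)) u v.
    case/adjP: vK => _ [k [/set1P-> kK vk]] vB; apply: connect_trans (cKu k kK) _.
    by apply: connect1; rewrite /restr rs vk !inE vB kK orbT.
  apply: (@connI _ _ rs _ u) => y /setUP[yB|]; last exact: cKu.
  apply: connect_sub (connP (cB s) u y us yB) => a b /and3P[/rr' ab aB' bB'].
  case: ab => [ab|[ea eb]|[ea eb]].
  + by apply: connect1; rewrite /restr ab !inE aB' bB'.
  + by rewrite ea eb; apply: cuv; rewrite -eb.
  + by rewrite ea eb (connect_restr_sym rs); apply: cuv; rewrite -ea.
have /adjP[a [b [aA bB' /rr'[ab|[ea eb]|[ea eb]]]]] := aB i j.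
- by apply/adjP; exists a, b; split=> //; apply: (subsetP (BB' _)).
- rewrite (adjC rs); apply: adj_mono vK; first by rewrite sub1set -eb (subsetP (BB' _)).
  by rewrite /B' -ea aA subsetUr.
- apply: adj_mono vK; first by rewrite sub1set -ea (subsetP (BB' _)).
  by rewrite /B' -eb bB' subsetUr.
Qed.

Variable E : finType.
Implicit Types (h : E -> V * V) (F Z : {set E}).

Definition touches h F x := [exists e in F, (x == (h e).1) || (x == (h e).2)].

Lemma touchesP h F x : reflect (exists2 e, e \in F & (x = (h e).1) \/ (x = (h e).2))
  (touches h F x).
Proof.
apply: (iffP exists_inP) => -[e eF H]; exists e => //.
  by case/orP: H => /eqP; [left | right].
by case: H => ->; rewrite eqxx ?orbT.
Qed.

Lemma joins_touches h F e a b : e \in F -> joins h e a b -> touches h F a.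
Proof.
by move=> eF /orP[]/eqP he; apply/touchesP; exists e; rewrite // he; [left | right].
Qed.

Lemma er_sub h F F' : F \subset F' -> subrel (er h F) (er h F').
Proof.
by move=> /subsetP s x y /erP[xy [e /s eF exy]]; apply/erP; split=> //; exists e.
Qed.

(** The virtual edge stands for a connection of [u] and [v] in [F2]. Its interior avoids [u] and
    [v], so no edge of [F1] touches it, and [has_K33_subdivide] applies. If [F2] has an edge [uv],
    the relation is just included. *)
Lemma has_K33_part h F1 F2 u v p : u != v -> p \notin F1 ->
  (forall x, touches h F1 x -> touches h F2 x -> x \in [set u; v]) ->
  connect (er h F2) u v ->
  has_K33 (er (reattach h p (u, v)) (p |: F1)) -> has_K33 (er h (F1 :|: F2)).
Proof.
move=> uv pF1 sep cuv; set r' := er _ _; set r := er h (F1 :|: F2).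
have rs : symmetric r := er_sym h _; have rs' : symmetric r' := er_sym _ _.
have rr' a b : r' a b -> [\/ er h F1 a b, a = u /\ b = v | a = v /\ b = u].
  case/erP=> ab [e]; rewrite in_setU1 /joins /reattach.
  have [-> _ /orP[]/eqP[-> ->]|ep /= eF eab] := eqVneq e p;
    [by constructor 2 | by constructor 3 | constructor 1].
  by apply/erP; split=> //; exists e.
have s1 : subrel (er h F1) r by apply: er_sub; apply: subsetUl.
have s2 : subrel (er h F2) r by apply: er_sub; apply: subsetUr.
have rr a b : r' a b -> [\/ r a b, a = u /\ b = v | a = v /\ b = u].
  by case/rr' => [/s1|?|?]; [constructor 1 | constructor 2 | constructor 3].
have [ruv|nruv] := boolP (er h F2 u v).
  apply: has_K33_sub => a b /rr[//|[-> ->]|[-> ->]]; first exact: s2.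
  by rewrite rs; apply: s2.
pose r2 := er h F2; have rs2 : symmetric r2 := er_sym h F2.
pose K0 := component r2 setT u.
have restrT : restr r2 setT =2 r2 by move=> x y; rewrite /restr !inE !andbT.
have vK0 : v \in K0 by rewrite inE (eq_connect restrT).
have uK0 : u \in K0 by apply: comp_refl.
have cK0 : conn r2 K0 by apply: comp_conn.
have [|||||| R [cR sR Ru Rv]] := @cross _ _ rs2 K0 [set u] [set v] cK0.
- by rewrite sub1set.
- by rewrite sub1set.
- by apply/set0Pn; exists u; rewrite set11.
- by apply/set0Pn; exists v; rewrite set11.
- by rewrite disjoints1 inE.
- by apply: contra nruv => /adjP[a [b [/set1P-> /set1P->]]].
have K0t x : x \in K0 -> x != u -> touches h F2 x.
  rewrite inE (eq_connect restrT) => ux xu; rewrite (sym_connect_sym rs2) in ux.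
  case/connectP: ux => [[|c l] /=]; first by move=> _ e; rewrite e eqxx in xu.
  by move=> /andP[/erP[_ [e eF]]] + _ _; apply: joins_touches.
apply: (@has_K33_subdivide r r' u v R) => //.
- by apply: conn_sub cR => a b _ _; apply: s2.
- by rewrite (adjC rs); apply: adj_subrel Ru; apply: s2.
- by rewrite (adjC rs); apply: adj_subrel Rv; apply: s2.
move=> x y /(subsetP sR); rewrite !inE negb_or -!andbA => /and3P[xu xv].
rewrite (eq_connect restrT) => ux; apply/negP => xy.
have xt2 : touches h F2 x by apply: K0t => //; rewrite inE (eq_connect restrT).
case/rr': xy => [/erP[_ [e eF exy]]|[e _]|[e _]].
- by have := sep x (joins_touches eF exy) xt2; rewrite !inE (negPf xu) (negPf xv).
- by rewrite e eqxx in xu.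
- by rewrite e eqxx in xv.
Qed.

End MinorTransfer.

(** * Cycle systems of cones *)

Section Cones.
Variables (V E : finType) (h : E -> V * V) (F : {set E}) (z : V).
Hypothesis loopless : forall e, e \in F -> (h e).1 != (h e).2.
Hypothesis simple : forall e f a b,
  e \in F -> f \in F -> joins h e a b -> joins h f a b -> e = f.
Hypothesis apex : forall x, touches h F x -> x != z -> er h F x z.

(* A forest on [m] vertices has fewer than [m] edges. *)
Lemma no_leaf_cycle (U : {set E}) : U \subset F -> U != set0 ->
  (forall x, x != z -> #|[set e in U | inc h e x]| != 1) ->
  exists Y, [/\ Y \in cyc h F, Y != set0 & Y \subset U].
Proof.
move=> UF U0 nleaf.
case: (boolP [exists Y : {set E}, [&& Y \in cyc h F, Y != set0 & Y \subset U]]).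
  by case/existsP=> Y /and3P[? ? ?]; exists Y.
rewrite negb_exists => /forallP acyc; exfalso.
pose W := [set x | touches h U x].
pose deg x := #|[set e in U | inc h e x]|.
have [e0 e0U] := set0Pn _ U0.
have e0W : (h e0).1 \in W by rewrite inE; apply/touchesP; exists e0; auto.
(* [w] absorbs the one possible leaf: it is [z] if [U] touches [z], and arbitrary otherwise. All
   other vertices of [W] have degree at least 2. *)
have [w wW wz] : exists2 w, w \in W & forall x, x \in W :\ w -> x != z.
  have [zW|zW] := boolP (z \in W); first by exists z => // x /setD1P[].
  by exists (h e0).1 => // x /setD1P[_]; apply: contraTneq => ->.
(* As [U] contains no cycle, its subsets are told apart by their odd vertices other than [w], the
   parity at [w] being determined by the handshake lemma. *)
have leU : #|U| <= #|W :\ w|.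
  rewrite -(leq_exp2l (m := 2)) // -!card_powerset.
  pose odd_at T := [set x in W :\ w | bd h T x].
  rewrite -(card_in_imset (f := odd_at) (D := powerset U)).
    apply/subset_leq_card/subsetP => _ /imsetP[T _ ->]; rewrite inE.
    by apply/subsetP => x; rewrite inE => /andP[].
  move=> T T'; rewrite !inE => TU TU' eTT'; pose D := symd T T'.
  have DU : D \subset U by apply: symd_sub.
  have Dbd x : x != w -> bd h D x = false.
    move=> xw; have [xW|xW] := boolP (x \in W).
      have := congr1 (fun A : {set V} => x \in A) eTT'.
      by rewrite !inE xw -[touches _ _ _]in_set -/W xW bd_symd /= => ->; rewrite addbb.
    apply: bd_out => e /(subsetP DU) eU; apply: contraNF xW; rewrite inE => ex.
    apply/touchesP; exists e => //; move: ex; rewrite /inc.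
    by case: eqP => [->|_] /=; [left | move/eqP => ->; right].
  have Dev : even h D.
    apply/evenP => x; have [->|] := eqVneq x w; last exact: Dbd.
    by apply/negP => /bd_other[y yw]; rewrite Dbd.
  have := acyc D; rewrite inE (subset_trans DU UF) Dev DU andbT /=; case: eqP => // D0 _.
  by rewrite -(symdK T T') -/D D0 symdC symd0.
have deg_ge x : x \in W -> 0 < deg x.
  rewrite inE => /touchesP[e eU ex]; apply/card_gt0P; exists e; rewrite inE eU /=.
  have := loopless (subsetP UF _ eU); rewrite /inc.
  by case: ex => ->; rewrite eqxx 1?eq_sym => /negPf->.
have deg_ge2 x : x \in W :\ w -> 1 < deg x.
  move=> xW; have := nleaf x (wz x xW); have /deg_ge : x \in W by case/setD1P: xW.
  by rewrite -/(deg x); case: (deg x) => [|[|]].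
have sum2 : \sum_x deg x = 2 * #|U|.
  under eq_bigr => x _ do rewrite /deg -sum1_card.
  rewrite (eq_bigr (fun x => \sum_(e in U) (inc h e x : nat))); last first.
    move=> x _; rewrite big_mkcond [RHS]big_mkcond; apply: eq_bigr => e _.
    by rewrite inE; case: (e \in U) => //=; case: (inc h e x).
  rewrite exchange_big /= -sum1_card big_distrr /=; apply: eq_bigr => e eU.
  rewrite muln1; have ne := loopless (subsetP UF _ eU).
  have -> : 2 = #|[set (h e).1; (h e).2]| by rewrite cards2 ne.
  rewrite -sum1_card [RHS]big_mkcond; apply: eq_bigr => x _; rewrite !inE /inc.
  rewrite ![x == _]eq_sym; case: ((h e).1 =P x) => [e1|_]; case: ((h e).2 =P x) => [e2|_] //.
  by rewrite e1 e2 eqxx in ne.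
(* The degree at [w] contributes the extra 1, which contradicts [leU] together with [sum2]. *)
have : 2 * #|W :\ w| + 1 <= \sum_x deg x.
  rewrite (bigD1 w) //= addnC; apply: leq_add; first exact: deg_ge.
  apply: leq_trans (_ : \sum_(x in W :\ w) 2 <= _); first by rewrite sum_nat_const mulnC.
  apply: leq_trans (_ : \sum_(x in W :\ w) deg x <= _); first exact: leq_sum.
  rewrite [X in _ <= X](bigID (fun x => x \in W)) /=.
  apply: leq_trans (leq_addr _ _); rewrite leq_eqVlt; apply/orP; left; apply/eqP.
  by apply: eq_bigl => x; rewrite in_setD1.
by rewrite sum2; move: leU; clear; move: #|U| #|_| => a b; lia.
Qed.

(** Kept as a set so that it can be summed without choosing an edge; by simplicity it is a singleton
    for the vertices that matter. *)
Let spoke x := [set e in F | joins h e x z].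
Let C f := symd [set f] (symd (spoke (h f).1) (spoke (h f).2)).
Let J := [set f in F | ~~ inc h f z].

Let spoke1 x : touches h F x -> x != z -> exists2 e, e \in F & joins h e x z /\ spoke x = [set e].
Proof.
move=> xF xz; have /erP[_ [e eF ex]] := apex xF xz; exists e => //; split=> //.
apply/setP => f; rewrite !inE; apply/andP/eqP => [[fF fx]|->//].
exact: simple fx ex.
Qed.

Let JP f : f \in J -> [/\ f \in F, (h f).1 != z & (h f).2 != z].
Proof.
rewrite inE => /andP[fF]; have ne := loopless fF; rewrite /inc.
case: ((h f).1 =P z) => [e1|_]; case: ((h f).2 =P z) => [e2|_] //.
by rewrite e1 e2 eqxx in ne.
Qed.

Let Ccyc f : f \in J -> C f \in cyc h F.
Proof.
move=> fJ; have [fF f1 f2] := JP fJ.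
have t1 : touches h F (h f).1 by apply/touchesP; exists f; auto.
have t2 : touches h F (h f).2 by apply/touchesP; exists f; auto.
have [s1 s1F [j1 E1]] := spoke1 t1 f1; have [s2 s2F [j2 E2]] := spoke1 t2 f2.
apply/cycP; split=> [|x]; first by rewrite /C E1 E2 !symd_sub ?sub1set.
rewrite /C E1 E2 !bd_symd !bd1 (joins_inc _ j1) (joins_inc _ j2) (joins_inc _ (joins_h h f)).
by case: (x == _); case: (x == _); case: (x == z).
Qed.

Let rim f g : g \in J -> (g \in C f) = (g == f).
Proof.
move=> gJ; have [gF g1 g2] := JP gJ.
have out x : g \in spoke x = false.
  by rewrite inE gF /=; apply/negP => /orP[]/eqP hg; rewrite hg /= ?eqxx in g1 g2.
by rewrite !in_symd !out /= addbF in_set1.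
Qed.

Let spokeC f g x : f \in J -> g \in F -> joins h g x z -> x != z -> (g \in C f) = inc h f x.
Proof.
move=> fJ gF gx xz; have [fF f1 f2] := JP fJ.
have gf : g \in [set f] = false.
  rewrite inE; apply/eqP => e; move: fJ; rewrite -e inE gF /=.
  by rewrite (joins_inc _ gx) eqxx eq_sym (negPf xz).
have sp y : g \in spoke y = (x == y).
  rewrite inE gF /=; apply/idP/eqP => [gy|<-//].
  by case: (joins_uniq gx gy) => -[] // e1 e2; rewrite e1 -e2.
by rewrite !in_symd gf !sp /inc /= ![x == _]eq_sym.
Qed.

(* The triangles with apex [z] on the edges of [J]: an edge of [J] lies in one of
   them only, and a spoke is covered once by [s] iff it ends in a leaf of [s]. *)
Lemma cone_system e : ~~ inc h e z -> system_at h F e.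
Proof.
move=> ez; have other f : f \in F -> f \notin J ->
    exists x, [/\ joins h f x z, x != z & inc h f x].
  move=> fF; rewrite inE fF negbK /= /inc => fz; have := loopless fF.
  move: fz; have [e1 _ ne|ne /= /eqP e2 _] := eqVneq (h f).1 z.
    exists (h f).2; rewrite joinsC -e1 joins_h eqxx; split=> //; first by rewrite eq_sym.
    by rewrite (negPf ne).
  exists (h f).1; split=> //; first by rewrite -e2 joins_h.
  by rewrite eqxx e2 eq_sym (negPf ne).
have cntJ (s : {set E}) g : g \in J -> cnt C s g = (g \in s).
  move=> gJ; rewrite cntE; have [gs|gs] := boolP (g \in s).
    rewrite (_ : [set i in s | g \in C i] = [set g]) ?cards1 //; apply/setP => f.
    by rewrite in_set1 [LHS]in_set rim // eq_sym; case: eqP => [->|]; rewrite ?gs ?andbF.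
  rewrite (_ : [set i in s | g \in C i] = set0) ?cards0 //; apply/setP => f.
  by rewrite in_set0 [LHS]in_set rim // eq_sym; case: eqP => [->|]; rewrite ?(negPf gs) ?andbF.
have cntS (s : {set E}) g x : s \subset J -> g \in F -> joins h g x z -> x != z ->
    cnt C s g = #|[set f in s | inc h f x]|.
  move=> /subsetP sJ gF gx xz; rewrite cntE; apply: eq_card => f; rewrite [LHS]in_set [RHS]in_set.
  by case: (boolP (f \in s)) => //= /sJ fJ; rewrite (spokeC fJ gF gx).
exists E, J, C; split=> //.
- move=> Z Zc; exists (Z :&: J); first exact: subsetIr.
  have Dc : symd Z (fsum C (Z :&: J)) \in cyc h F.
    by apply: cyc_symd => //; apply: cyc_fsum => f /setIP[_ /Ccyc].
  set D := symd _ _ in Dc; have DJ g : g \in J -> g \in D = false.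
    by move=> gJ; rewrite in_symd [g \in fsum _ _]inE cntJ // inE gJ andbT oddb addbb.
  (* [D] is even and consists of spokes only; the end of a spoke other than [z] would meet just one
     edge of [D]. *)
  suff D0 : D = set0 by rewrite -[LHS](symdK Z (fsum C (Z :&: J))) -/D D0 symdC symd0.
  apply/setP => g; rewrite in_set0; apply/negP => gD.
  have [DF Dev] := cycP _ _ _ Dc; have gF := subsetP DF _ gD.
  have [|x [gx xz gix]] := other g gF; first by apply: contraL gD => /DJ ->.
  have : g \notin D.
    apply: (@cyc_pendant _ _ h D g x) => //; first by apply/cycP.
    move=> f fD fx; have fF := subsetP DF _ fD.
    have [|y [fy yz _]] := other f fF; first by apply: contraL fD => /DJ ->.
    move: fx; rewrite (joins_inc _ fy) (negPf xz) addbF => /eqP xy.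
    by rewrite -xy in fy; apply: simple fy gx.
  by rewrite gD.
- move=> s sJ s0; pose U := [set g in F | cnt C s g == 1].
  have sU : s \subset U.
    apply/subsetP => g gs; have gJ := subsetP sJ _ gs; rewrite inE cntJ // gs.
    by have [-> _ _] := JP gJ.
  have [|||Y [Yc Y0 YU]] := @no_leaf_cycle U.
  - by apply/subsetP => g; rewrite inE => /andP[].
  - by have /set0Pn[g /(subsetP sU) gU] := s0; apply/set0Pn; exists g.
  (* If the only edge of [U] at [x] is in [J], it is the only edge of [s] at [x], so the spoke at
     [x] is covered once and is a second edge of [U]. If it is the spoke, then exactly one edge of
     [s] is at [x], and it is in [U] too. *)
  - move=> x xz; apply/negP => /cards1P[g gE].
    have gA f : f \in U -> inc h f x -> f = g.
      by move=> fU fx; apply/set1P; rewrite -gE inE fU.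
    have /andP[gU gx] : (g \in U) && inc h g x.
      by have := set11 g; rewrite -gE inE.
    have gF : g \in F by move: gU; rewrite inE => /andP[].
    have [gJ|gJ] := boolP (g \in J).
      have gs : g \in s by move: gU; rewrite inE cntJ // gF eqb1.
      have tx : touches h F x.
        apply/touchesP; exists g => //; move: gx; rewrite /inc.
        by case: eqP => [->|_ /eqP->]; auto.
      have [f fF [fx _]] := spoke1 tx xz.
      have sx : #|[set f in s | inc h f x]| = 1.
        apply/eqP/cards1P; exists g; apply/setP => f'; rewrite !inE.
        apply/andP/eqP => [[f's f'x]|->//].
        by apply: gA => //; apply: (subsetP sU).
      have fU : f \in U by rewrite inE fF (cntS _ _ x) // sx.
      have fg : f = g by apply: gA => //; rewrite (joins_inc _ fx) eqxx (negPf xz).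
      move: gJ; rewrite -fg inE fF /=; rewrite (joins_inc _ fx) eqxx eq_sym.
      by rewrite (negPf xz).
    have [y [gy yz _]] := other g gF gJ.
    have xy : x = y by apply/eqP; move: gx; rewrite (joins_inc _ gy) (negPf xz) addbF.
    rewrite -{y}xy in gy yz; have := gU; rewrite inE gF (cntS _ _ x) //= => /cards1P[f fE].
    have : f \in [set f] by rewrite set11.
    rewrite -fE inE => /andP[fs fx]; have fg := gA f (subsetP sU _ fs) fx.
    by rewrite -fg (subsetP sJ _ fs) in gJ.
  exists Y; split=> // f /(subsetP YU); rewrite inE => /andP[_ /eqP].
  by [].
- case=> Z /cycP[ZF _] eZ; have eJ : e \in J by rewrite inE (subsetP ZF _ eZ).
  by rewrite cntJ // eJ.
Qed.

End Cones.

(** * Decomposition *)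

Section Reductions.
Variables (V E : finType).
Implicit Types (h : E -> V * V) (F Z : {set E}) (e f : E) (x y u v : V).

Lemma bd_touches h F Z x : Z \subset F -> bd h Z x -> touches h F x.
Proof.
move=> /subsetP ZF; apply: contraTT => nx; rewrite bd_out // => e /ZF eF.
apply: contraNF nx => ex; apply/touchesP; exists e => //; move: ex; rewrite /inc.
by case: eqP => [->|_] /=; [left | move/eqP => ->; right].
Qed.

Lemma touches_inc h F x : (forall e, e \in F -> (h e).1 != (h e).2) ->
  touches h F x -> exists2 e, e \in F & inc h e x.
Proof.
move=> nl /touchesP[e eF ex]; exists e => //; have := nl e eF; rewrite /inc.
by case: ex => ->; rewrite eqxx 1?eq_sym => /negPf->.
Qed.

(** Odd vertices of [Z :&: F1] are touched by both sides, so only [u] and [v] qualify, and by the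
    handshake lemma both are odd or neither is. *)
Lemma bd_separated h F1 F2 u v Z x : [disjoint F1 & F2] -> u != v ->
  (forall x, touches h F1 x -> touches h F2 x -> x \in [set u; v]) ->
  Z \in cyc h (F1 :|: F2) ->
  bd h (Z :&: F1) x = bd h (Z :&: F1) u && ((x == u) (+) (x == v)).
Proof.
move=> dF uv sep Zc.
have out y : bd h (Z :&: F1) y -> y \in [set u; v].
  move=> By; apply: sep; first by apply: bd_touches By; apply: subsetIr.
  by rewrite (bd_cyc_split _ dF Zc) in By; apply: bd_touches By; apply: subsetIr.
have [->|xu] := eqVneq x u; first by rewrite (negPf uv) andbT.
have [->|xv] /= := eqVneq x v; last first.
  by rewrite andbF; apply/negP => /out; rewrite !inE (negPf xu) (negPf xv).
rewrite andbT; apply/idP/idP => /bd_other[y yx By]; have := out y By;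
  by rewrite !inE (negPf yx) ?orbF => /eqP <-.
Qed.

Section Induction.
Variables (h : E -> V * V) (F : {set E}).
Hypothesis IH : forall h' F', #|F'| < #|F| -> ~ has_K33 (er h' F') ->
  forall e, system_at h' F' e.
Hypothesis noK33 : ~ has_K33 (er h F).

Lemma split_step F1 e : F1 \subset F -> F1 != set0 -> F1 != F ->
  (forall Z, Z \in cyc h F -> even h (Z :&: F1)) -> system_at h F e.
Proof.
move=> sF F10 F1F ev; have FE : F = F1 :|: (F :\: F1).
  by rewrite setDE setUIr setUCr setIT (setUidPr sF).
have dF : [disjoint F1 & F :\: F1].
  by apply: disjointI => f f1; rewrite inE f1.
have small F' : F' \proper F -> system_at h F' e.
  move=> F'F; apply: IH; first exact: proper_card.
  by move=> /(has_K33_sub (er_sub (proper_sub F'F))).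
rewrite FE; apply: system_split => //.
- by move=> Z; rewrite -FE; apply: ev.
- by apply: small; rewrite properEneq F1F.
- apply: small; rewrite properEneq subsetDl andbT; apply/eqP => E0.
  have /set0Pn[f f1] := F10.
  by have := subsetP sF f f1; rewrite -E0 inE f1.
Qed.

(** With two edges on each side, either part stays smaller than [F] even with its virtual edge. The
    even set that crosses shows that [u] and [v] are linked on both sides, so the parts inherit the
    absence of K33 minors. *)
Lemma two_sum_step F1 F2 u v e : F = F1 :|: F2 -> [disjoint F1 & F2] ->
  1 < #|F1| -> 1 < #|F2| -> u != v ->
  (forall x, touches h F1 x -> touches h F2 x -> x \in [set u; v]) ->
  (exists2 Z, Z \in cyc h F & ~~ even h (Z :&: F1)) ->
  e \notin F2 -> system_at h F e.
Proof.
move=> FE dF F1gt F2gt uv sep [Z0 Z0c nev] eF2; rewrite FE in Z0c *.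
have dF' : [disjoint F2 & F1] by rewrite disjoint_sym.
have bdE Z x : Z \in cyc h (F1 :|: F2) ->
    bd h (Z :&: F1) x = bd h (Z :&: F1) u && ((x == u) (+) (x == v)).
  exact: bd_separated.
have Z0u : bd h (Z0 :&: F1) u.
  by apply: contraNT nev => /negPf b0; apply/evenP => x; rewrite bdE // b0.
have cuv F' Z : Z \subset F' -> (forall x, bd h Z x = (x == u) (+) (x == v)) ->
    connect (er h F') u v.
  move=> ZF' bZ; have [|y [yu By uy]] := @bd_linked _ _ h Z u.
    by rewrite bZ eqxx (negPf uv).
  move: By; rewrite bZ (negPf yu) => /eqP yv; rewrite -yv.
  by apply: connect_sub uy => a b ab; apply: connect1; apply: er_sub ab.
have c1 : connect (er h F1) u v.
  by apply: (@cuv _ (Z0 :&: F1)); [apply: subsetIr | move=> x; rewrite bdE // Z0u].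
have c2 : connect (er h F2) u v.
  apply: (@cuv _ (Z0 :&: F2)); [exact: subsetIr | move=> x].
  by rewrite -(bd_cyc_split _ dF Z0c) bdE // Z0u.
have [p pF2] : exists p, p \in F2 by apply/card_gt0P; apply: ltnW.
have [q qF1] : exists q, q \in F1 by apply/card_gt0P; apply: ltnW.
have pF1 : p \notin F1 by rewrite (disjointFl dF pF2).
have qF2 : q \notin F2 by rewrite (disjointFr dF qF1).
have cF : #|F| = #|F1| + #|F2|.
  by rewrite FE cardsU (disjoint_setI0 dF) cards0 subn0.
apply: (two_sum dF uv pF2 qF1 (fun Z Zc x => bdE Z x Zc) Z0c Z0u eF2).
  apply: IH; first by rewrite cF cardsU1 pF1 /=; nlia.
  by move/(has_K33_part uv pF1 sep c2); rewrite -FE.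
apply: IH; first by rewrite cF cardsU1 qF2 /=; nlia.
have sep' x : touches h F2 x -> touches h F1 x -> x \in [set u; v] by move=> ? ?; apply: sep.
by move/(has_K33_part uv qF2 sep' c1); rewrite setUC -FE.
Qed.

End Induction.

(** Two even sets that agree off [e] differ by an even subset of [[set e]], which is empty as [e] is
    not a loop. *)
Lemma card_cyc h F e : e \in F -> (h e).1 != (h e).2 -> #|cyc h F| <= 2 ^ #|F :\ e|.
Proof.
move=> eF nl; rewrite -card_powerset.
rewrite -(card_in_imset (f := fun Z : {set E} => Z :\ e) (D := cyc h F)).
  apply/subset_leq_card/subsetP => _ /imsetP[Z /cycP[ZF _] ->].
  by rewrite inE setSD.
move=> Z Z' Zc Z'c eZ; pose D := symd Z Z'.
have /cycP[_ Dev] : D \in cyc h F by apply: cyc_symd.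
have De f : f \in D -> f = e.
  rewrite in_symd => fD; apply/eqP; apply: contraTT fD => fe.
  by have := congr1 (fun A : {set E} => f \in A) eZ; rewrite !inE fe /= => ->; rewrite addbb.
have D0 : D = set0.
  apply/setP => f; rewrite in_set0; apply/negP => fD.
  have fe := De f fD; have DE : D = [set e].
    by apply/setP => g; rewrite inE; apply/idP/eqP => [/De|->] //; rewrite -fe.
  by have := Dev (h e).1; rewrite DE bd1 /inc eqxx eq_sym (negPf nl).
by rewrite -(symdK Z Z') -/D D0 symdC symd0.
Qed.

End Reductions.

(** * Simple 3-connected graphs *)

Section ThreeConnected.
Variables (V E : finType) (h : E -> V * V) (F : {set E}).
Implicit Types (Z : {set E}) (e f : E) (x y u v : V) (X W : {set V}).
Hypothesis loopless : forall e, e \in F -> (h e).1 != (h e).2.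
Hypothesis simple : forall e f a b,
  e \in F -> f \in F -> joins h e a b -> joins h f a b -> e = f.
Let S := [set x | touches h F x].
Let r := er h F.
Hypothesis conn3 : forall W, #|W| <= 2 -> conn r (S :\: W).
Hypothesis S4 : 3 < #|S|.
Hypothesis noK33 : ~ has_K33 r.

Let r_sym : symmetric r := er_sym h F.

Let F_S : F \subset inside h S.
Proof.
by apply/subsetP => e eF; rewrite !inE; apply/andP; split; apply/touchesP;
  exists e => //; [left | right].
Qed.

(** Deleting [a] and [b], except [x] itself, leaves a connected graph with another vertex, so [x]
    still has a neighbour. *)
Lemma min_degree3 : deg3 r S.
Proof.
move=> x a b xS; pose W := [set a; b] :\ x.
have leW : #|W| <= 2.
  by apply: leq_trans (subset_leq_card (subD1set _ _)) _; rewrite cards2; case: eqP.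
have xSW : x \in S :\: W by rewrite in_setD xS setD11.
have [t tSW tx] : exists2 t, t \in S :\: W & t != x.
  have : 0 < #|(S :\: W) :\ x|.
    have := cardsD1 x (S :\: W); rewrite xSW cardsD.
    have := subset_leq_card (subsetIr S W); move: leW S4.
    move: #|_ :\ x| #|S :&: W| #|W| #|S| => *; lia.
  by case/card_gt0P=> t /setD1P[tx tSW]; exists t.
have /connectP[[|y l] /=] := connP (conn3 leW) x t xSW tSW.
  by move=> _ e; rewrite e eqxx in tx.
case/andP=> /and3P[xy _ ySW] _ _; exists y.
have yx : y != x by case/erP: xy; rewrite eq_sym.
move: ySW; rewrite in_setD in_setD1 yx in_set2 negb_or => /andP[/andP[ya yb] yS].
by split.
Qed.

Lemma induced_cyc X : icycle_set r X -> induced h F X \in cyc h F.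
Proof.
case/icycle_setP=> n [w [cw ->]]; apply/cycP; split=> [|x]; first exact: subsetIl.
have [xX|xX] := boolP (x \in seg w 0 n); last first.
  apply: bd_out => e /setIP[_]; rewrite in_inside => /andP[e1 e2]; rewrite /inc.
  case: eqP => [e'|_]; first by rewrite e' (negPf xX) in e1.
  by case: eqP => [e'|//]; rewrite e' (negPf xX) in e2.
have [a [b [ab aX bX nbr]]] := icyc_nbr2 cw xX.
have edge y : y \in seg w 0 n -> r x y ->
    exists2 e, e \in F & joins h e x y /\ x != y.
  by move=> _ /erP[xy [e eF exy]]; exists e.
have [ea eaF [ja xa]] : exists2 e, e \in F & joins h e x a /\ x != a.
  by apply: edge; rewrite ?nbr ?eqxx.
have [eb ebF [jb xb]] : exists2 e, e \in F & joins h e x b /\ x != b.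
  by apply: edge; rewrite ?nbr ?eqxx ?orbT.
rewrite (@eq_bd_at _ _ h _ (symd [set ea] [set eb])).
  by rewrite bd_symd !bd1 (joins_inc _ ja) (joins_inc _ jb) eqxx (negPf xa) (negPf xb).
move=> e ex; have nab : ea != eb.
  apply: contraNneq ab => e'; rewrite -e' in jb.
  by case: (joins_uniq ja jb) => -[e1 e2]; rewrite e2 -?e1.
have -> : (e \in symd [set ea] [set eb]) = (e == ea) || (e == eb).
  by rewrite in_symd !inE; case: eqP => [->|_]; rewrite ?(negPf nab).
have [y ey] : exists y, joins h e x y.
  move: ex; rewrite /inc; case: eqP => [<- _|_ /= /eqP<-].
    by exists (h e).2; apply: joins_h.
  by exists (h e).1; rewrite joinsC joins_h.
apply/setIP/orP => [[eF]|].
  rewrite (joins_inside _ ey) => /andP[_ yX].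
  have : r x y by apply/erP; split; [apply: (joins_neq loopless eF ey) | exists e].
  rewrite nbr // => /orP[]/eqP ye; [left | right]; apply/eqP.
    by apply: (simple eF eaF ey); rewrite ye.
  by apply: (simple eF ebF ey); rewrite ye.
by case=> /eqP->; split=> //; rewrite ?(joins_inside _ ja) ?(joins_inside _ jb) xX.
Qed.

Theorem three_connected_system e : system_at h F e.
Proof.
have d3 := min_degree3.
have Pcyc : peri_edges h F S \subset cyc h F.
  apply/subsetP => _ /imsetP[X + ->]; rewrite inE => /and3P[cX _ _].
  exact: induced_cyc.
have [B BP [ind spn]] := basis_exists (peri_edges h F S).
have spanB Z : Z \in cyc h F -> spanned B Z.
  by move=> Zc; apply: spn; apply: tutte.
have [/forallP c2|] := boolP [forall f, cnt id B f <= 2].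
  by apply: (system_of_2basis (subset_trans BP Pcyc) ind).
rewrite negb_forall => /existsP[f]; rewrite -ltnNge cntE => /card_gt2P.
case=> Y1 [Y2 [Y3 [[h1 h2 h3] [n12 n23 n31]]]].
have per Y : Y \in [set i in B | f \in id i] ->
    exists X, [/\ peri r S X, Y = induced h F X, (h f).1 \in X & (h f).2 \in X].
  rewrite inE => /andP[/(subsetP BP)/imsetP[X + ->]]; rewrite inE => pX.
  by rewrite inE in_inside => /and3P[_ ? ?]; exists X.
have fF : f \in F.
  by move: h1; rewrite inE => /andP[/(subsetP BP)/(subsetP Pcyc)/cycP[/subsetP H _] /H].
have [X1 [p1 e1 x1 y1]] := per _ h1; have [X2 [p2 e2 x2 y2]] := per _ h2.
have [X3 [p3 e3 x3 y3]] := per _ h3.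
have ne X X' Y Y' : Y = induced h F X -> Y' = induced h F X' -> Y != Y' -> X != X'.
  by move=> -> ->; apply: contraNneq => ->.
have xy := loopless fF.
have rxy : r (h f).1 (h f).2 by apply/erP; split=> //; exists f; rewrite ?joins_h.
have nn12 := ne _ _ _ _ e1 e2 n12; have nn23 := ne _ _ _ _ e2 e3 n23.
have nn13 : X1 != X3 by rewrite eq_sym; apply: ne e3 e1 n31.
have [//|[S5 full]] := @peri_edge3 _ r r_sym S (h f).1 (h f).2 X1 X2 X3 d3 conn3
  (And3 p1 p2 p3) (And3 nn12 nn13 nn23) (And3 x1 x2 x3) (And3 y1 y2 y3) xy rxy.
(* In K5 any vertex can be the apex; it is taken off [e], so that [e] is a rim edge and lies in one
   triangle only. *)
have [z zS ze] : exists2 z, z \in S & z \notin [set (h e).1; (h e).2].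
  apply/subsetPn; apply/negP => /subset_leq_card; rewrite S5 cards2.
  by case: (_ != _).
apply: (@cone_system _ _ h F z) => //.
  move=> x xF xz; apply: full => //; by rewrite inE.
move: ze; rewrite !inE negb_or /inc ![z == _]eq_sym => /andP[/negPf-> /negPf->].
by [].
Qed.

End ThreeConnected.

Section Decomposition.
Variables (V E : finType).
Implicit Types (h : E -> V * V) (F Z : {set E}) (e f : E) (x y u v : V) (W : {set V}).

(** Since three vertices carry at most three edges of a simple graph, four edges force four
    vertices. *)
Lemma edge_count h F : (forall e, e \in F -> (h e).1 != (h e).2) ->
  (forall e f a b, e \in F -> f \in F -> joins h e a b -> joins h f a b -> e = f) ->
  #|F| <= 'C(#|[set x | touches h F x]|, 2).
Proof.
move=> nl sm; rewrite -cards_draws.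
rewrite -(card_in_imset (f := fun e => [set (h e).1; (h e).2]) (D := F)).
  apply/subset_leq_card/subsetP => _ /imsetP[e eF ->]; rewrite inE cards2 nl // andbT.
  rewrite subUset !sub1set !inE; apply/andP.
  by split; apply/touchesP; exists e => //; [left | right].
move=> e f eF fF /(@set2_eq (hgraph h)) ef; apply: (sm e f _ _ eF fF (joins_h h e)).
by case: ef => -[-> ->]; [apply: joins_h | rewrite joinsC joins_h].
Qed.

(* A part with a single edge has no cycle through that edge. *)
Lemma disconnected_separation h F W (S := [set x | touches h F x]) :
  (forall e, e \in F -> (h e).1 != (h e).2) -> #|W| <= 2 -> ~~ conn (er h F) (S :\: W) ->
  exists F1 u v, [/\ F1 \subset F, F1 != set0, F1 != F, u != v &
    (forall x, touches h F1 x -> touches h (F :\: F1) x -> x \in [set u; v]) /\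
    (#|F1| <= 1 \/ #|F :\: F1| <= 1 ->
       forall Z, Z \in cyc h F -> even h (Z :&: F1))].
Proof.
set r := er h F; have r_sym : symmetric r := er_sym h F.
move=> nl W2 nconn.
have [a [b [aSW bSW nab]]] : exists a b,
    [/\ a \in S :\: W, b \in S :\: W & ~~ connect (restr r (S :\: W)) a b].
  move: nconn; rewrite /conn negb_forall_in => /exists_inP[a aSW].
  by rewrite negb_forall_in => /exists_inP[b bSW nab]; exists a, b.
pose S1 := component r (S :\: W) a.
have S1s : S1 \subset S :\: W := comp_sub aSW.
have bS1 : b \notin S1 by rewrite inE.
have aS1 : a \in S1 by apply: comp_refl.
(* All edges at the component [S1] of [a]; their ends are in [S1] or in [W]. *)
pose F1 := [set e in F | ((h e).1 \in S1) || ((h e).2 \in S1)].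
have at1 x e : x \in S1 -> e \in F -> inc h e x -> e \in F1.
  move=> xS eF; rewrite inE eF /inc; case: eqP => [->|_]; first by rewrite xS.
  by move=> /eqP ->; rewrite xS orbT.
have step e x y : e \in F -> joins h e x y -> x \in S1 -> y \in S :\: W -> y \in S1.
  move=> eF exy xS ySW; apply: (comp_closed aSW xS ySW).
  by apply/erP; split; [apply: (joins_neq nl eF exy) | exists e].
have inc_join e x : inc h e x -> exists y, joins h e x y.
  rewrite /inc; case: eqP => [<- _|_ /= /eqP <-].
    by exists (h e).2; apply: joins_h.
  by exists (h e).1; rewrite joinsC joins_h.
have mem1 e : e \in F1 -> exists2 x, x \in S1 & exists y, joins h e x y.
  rewrite inE => /andP[_ /orP[e1|e2]]; first by exists (h e).1 => //; exists (h e).2; apply: joins_h.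
  by exists (h e).2 => //; exists (h e).1; rewrite joinsC joins_h.
have atb e : e \in F -> inc h e b -> e \notin F1.
  move=> eF eb; apply/negP => /mem1[x xS [y exy]].
  have [z ebz] := inc_join e b eb.
  case: (joins_uniq exy ebz) => -[e1 e2]; first by rewrite -e1 xS in bS1.
  by have := step e x y eF exy xS; rewrite e2 bSW (negPf bS1) => /(_ isT).
have F1F : F1 \subset F by apply/subsetP => e; rewrite inE => /andP[].
have aF : touches h F a by case/setDP: aSW; rewrite inE.
have bF : touches h F b by case/setDP: bSW; rewrite inE.
have [ea eaF iea] := touches_inc nl aF; have [eb ebF ieb] := touches_inc nl bF.
have ea1 : ea \in F1 by apply: at1 iea.
have eb1 : eb \notin F1 by apply: atb.
have nbeq : a != b by apply: contraNneq bS1 => <-.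
(* A cut with fewer than two vertices is padded to a pair. *)
have [u [v [uv sW]]] : exists u v, u != v /\ W \subset [set u; v].
  have [->|[u uW]] := set_0Vmem W; first by exists a, b; rewrite sub0set.
  have [W0|[v /setD1P[vu vW]]] := set_0Vmem (W :\ u).
    exists u, a; split; last by rewrite -(setD1K uW) W0 setU0 sub1set set21.
    by case/setDP: aSW => _; apply: contraNneq => <-.
  exists u, v; split; first by rewrite eq_sym.
  have sub : [set u; v] \subset W by rewrite subUset !sub1set uW vW.
  have : [set u; v] == W by rewrite eqEcard sub cards2 eq_sym vu.
  by move/eqP->.
exists F1, u, v; split=> //.
- by apply/set0Pn; exists ea.
- by apply: contraNneq eb1 => ->.
split.
  move=> x /touchesP[e e1 ex] /touchesP[f /setDP[fF f1] fx]; apply: (subsetP sW).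
  have incx g : g \in F -> x = (h g).1 \/ x = (h g).2 -> inc h g x.
    move=> /nl; rewrite /inc => ne [] ->.
      by rewrite eqxx eq_sym (negPf ne).
    by rewrite eqxx (negPf ne).
  have xS1 : x \notin S1 by apply: contra f1 => xS; apply: at1 xS fF (incx f fF fx).
  have eF := subsetP F1F _ e1; have [y ySW [z eyz]] := mem1 e e1.
  have [t ext] := inc_join e x (incx e eF ex).
  apply: contraNT xS1 => xW; apply: (step e y x eF _ ySW); last first.
    by rewrite inE xW inE; apply/touchesP; exists e.
  have ne : x != y by apply: contraNneq (f1) => xy; apply: at1 _ fF (incx f fF fx); rewrite xy.
  by case: (joins_uniq ext eyz) => -[e1' e2']; [rewrite e1' eqxx in ne | rewrite e1'].
move=> one Z Zc; case: one => [F1le|F2le].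
  have -> : Z :&: F1 = set0; last exact: even0.
  have F1E f : f \in F1 -> f = ea.
    move=> f1; have /card_le1P H := F1le; have := H _ f1 ea.
    by rewrite ea1 inE => /esym/eqP.
  have neZ : ea \notin Z.
    apply: (cyc_pendant Zc iea) => f fF fa; apply: F1E.
    exact: at1 aS1 fF fa.
  apply/setP => f; rewrite !inE; apply/negP => /andP[fZ f1].
  by rewrite -(F1E f _) ?fZ ?inE // in neZ.
have eb2 : eb \in F :\: F1 by rewrite inE eb1.
have F2E f : f \in F :\: F1 -> f = eb.
  move=> f2; have /card_le1P H := F2le; have := H _ f2 eb.
  by rewrite eb2 inE => /esym/eqP.
have neZ : eb \notin Z.
  by apply: (cyc_pendant Zc ieb) => f fF fb; apply: F2E; rewrite inE atb.
have /cycP[/subsetP ZF Zev] := Zc.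
have -> : Z :&: F1 = Z; last by apply/evenP.
apply/setIidPl/subsetP => f fZ; apply: contraNT neZ => f1.
by rewrite -(F2E f) // inE f1 ZF.
Qed.

(** Without a direct sum or a usable 2-separation the graph must be simple and 3-connected: a loop
    is a direct summand, two parallel edges are one side of a 2-separation, and a cut of at most two
    vertices yields one or the other. *)
Theorem K33_free_system h F : ~ has_K33 (er h F) -> forall e, system_at h F e.
Proof.
move: {2}#|F|.+1 (ltnSn #|F|) => n; elim: n h F => // n IHn h F ltF noK e.
have IH h' F' : #|F'| < #|F| -> ~ has_K33 (er h' F') -> forall e, system_at h' F' e.
  by move=> lt; apply: IHn; apply: leq_trans lt _.
have [le4|gt4] := leqP #|cyc h F| 4; first exact: small_system.
case: (boolP [exists F1 : {set E}, [&& F1 \subset F, F1 != set0, F1 != F &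
    [forall Z in cyc h F, even h (Z :&: F1)]]]).
  case/existsP=> F1 /and4P[sF F10 F1F /forall_inP ev].
  exact: (split_step IH noK _ sF F10 F1F ev).
rewrite negb_exists => /forallP nsplit.
have odd_part F1 : F1 \subset F -> F1 != set0 -> F1 != F ->
    exists2 Z, Z \in cyc h F & ~~ even h (Z :&: F1).
  move=> sF F10 F1F; have := nsplit F1; rewrite sF F10 F1F /= negb_forall_in.
  by move/exists_inP.
case: (boolP [exists F1 : {set E}, exists u, exists v, [&& F1 \subset F, 1 < #|F1|,
    1 < #|F :\: F1|, u != v & [forall x, touches h F1 x ==> touches h (F :\: F1) x ==>
      (x \in [set u; v])]]]).
  case/existsP=> F1 /existsP[u /existsP[v /and5P[sF gt1 gt2 uv /forallP sep]]].
  have FE : F = F1 :|: (F :\: F1) by rewrite setDE setUIr setUCr setIT (setUidPr sF).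
  have dF : [disjoint F1 & F :\: F1] by apply: disjointI => f f1; rewrite inE f1.
  have sep1 x : touches h F1 x -> touches h (F :\: F1) x -> x \in [set u; v].
    by move=> t1 t2; have := sep x; rewrite t1 t2.
  have neq0 (A : {set E}) : 1 < #|A| -> A != set0 by move=> gt; rewrite -card_gt0; apply: ltnW.
  have F1F : F1 != F by apply: contraTneq gt2 => ->; rewrite setDv cards0.
  have F2F : F :\: F1 != F.
    apply: contraTneq gt1 => e2; have := setIDA F1 F F1.
    have := disjoint_setI0 dF; rewrite e2 (setIidPl sF) => -> _.
    by rewrite cards0.
  (* The system of the 2-sum is controlled on its first side only, so the sides are exchanged to
     have [e] outside the second. *)
  have [eF2|eF2] := boolP (e \in F :\: F1); last first.
    apply: (two_sum_step IH noK FE dF gt1 gt2 uv sep1 _ eF2).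
    exact: odd_part sF (neq0 _ gt1) F1F.
  apply: (two_sum_step IH noK _ _ gt2 gt1 uv).
  - by rewrite setUC.
  - by rewrite disjoint_sym.
  - by move=> x t2 t1; apply: sep1.
  - exact: odd_part (subsetDl _ _) (neq0 _ gt2) F2F.
  - by move: eF2; rewrite inE => /andP[].
rewrite negb_exists => /forallP nsep.
have no_sep F1 u v : F1 \subset F -> 1 < #|F1| -> 1 < #|F :\: F1| -> u != v ->
    (forall x, touches h F1 x -> touches h (F :\: F1) x -> x \in [set u; v]) -> False.
  move=> sF gt1 gt2 uv sep; have := nsep F1; rewrite negb_exists => /forallP/(_ u).
  rewrite negb_exists => /forallP/(_ v); rewrite sF gt1 gt2 uv /= => /forallP; apply=> x.
  by apply/implyP => t1; apply/implyP => t2; apply: sep.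
have nl f : f \in F -> (h f).1 != (h f).2.
  move=> fF; apply/eqP => loop.
  have incf x : inc h f x = false by rewrite /inc loop addbb.
  have Ff : [set f] != F.
    apply: contraTneq gt4 => <-; rewrite -leqNgt.
    apply: leq_trans (_ : #|powerset [set f]| <= _); last by rewrite card_powerset cards1.
    by apply/subset_leq_card/subsetP => Z; rewrite !inE => /andP[].
  have [||Z _] := odd_part [set f] _ _ Ff; first by rewrite sub1set.
    by apply/set0Pn; exists f; rewrite set11.
  case/negP; apply/evenP => x; apply: bd_out => g; rewrite !inE => /andP[_ /eqP->].
  exact: incf.
have F4 : 3 < #|F|.
  have [F0|[f fF]] := set_0Vmem F.
    move: gt4; rewrite F0; apply: contraLR => _; rewrite -leqNgt.
    apply: leq_trans (_ : #|powerset (set0 : {set E})| <= _); last by rewrite card_powerset cards0.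
    by apply/subset_leq_card/subsetP => Z; rewrite !inE => /andP[].
  have := leq_trans gt4 (card_cyc fF (nl f fF)); rewrite [#|F|](cardsD1 f F) fF.
  by case: #|F :\ f| => [|[|[|]]].
have sm f g a b : f \in F -> g \in F -> joins h f a b -> joins h g a b -> f = g.
  move=> fF gF fab gab; apply/eqP; apply: contraT => fg; exfalso.
  have ab := joins_neq nl fF fab.
  have sF : [set f; g] \subset F by rewrite subUset !sub1set fF.
  apply: (no_sep [set f; g] a b sF) => //; first by rewrite cards2 fg.
    by rewrite cardsD (setIidPr sF) cards2 fg; nlia.
  move=> x /touchesP[k]; rewrite !inE => kfg kx _.
  have kab : joins h k a b by case/orP: kfg => /eqP->.
  by case/orP: kab => /eqP kE; rewrite kE /= in kx; case: kx => ->; rewrite eqxx ?orbT.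
have c3 W : #|W| <= 2 -> conn (er h F) ([set x | touches h F x] :\: W).
  move=> W2; apply: contraT => nc.
  have [F1 [u [v [sF F10 F1F uv [sep small]]]]] := disconnected_separation nl W2 nc.
  have [Z Zc odd] := odd_part F1 sF F10 F1F.
  case: (no_sep F1 u v sF _ _ uv sep).
    by rewrite ltnNge; apply: contra odd => le1; apply: small => //; left.
  by rewrite ltnNge; apply: contra odd => le1; apply: small => //; right.
apply: three_connected_system => //.
have := leq_trans F4 (edge_count nl sm); case: #|_| => [|[|[|[|]]]] //.
Qed.

End Decomposition.

(** * The cycle matroid *)

Section CycleMatroid.
Variables (G : mgraph) (h : edge G -> G * G).
Hypothesis hE : forall e, ends e = [set (h e).1; (h e).2].
Implicit Types (Z Y B : {set edge G}) (e f : edge G).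
Local Notation M := (cycle_matroid G).

Lemma dependentE Z :
  dependent M Z <-> exists Y, [/\ Y \subset Z, Y != set0 & even h Y].
Proof.
split; first exact: dependent_even.
case=> Y [YZ Y0 Yev]; apply: contra (even_not_forest hE Y0 Yev).
exact: forestS YZ.
Qed.

(** For [e] in [Z], a smallest even subset [Y] of [Z] containing [e] is a circuit: a proper nonempty
    even subset of [Y] or its complement in [Y] would contain [e] and be smaller. *)
Lemma even_is_cycle Z : even h Z -> is_cycle M Z.
Proof.
move=> Zev; exists [set C | circuit M C & C \subset Z] => [C|].
  by rewrite inE => /andP[].
apply/eqP; rewrite eqEsubset; apply/andP; split; last first.
  by apply/bigcupsP => C; rewrite inE => /andP[].
apply/subsetP => e eZ; pose ok Y := [&& e \in Y, Y \subset Z & even h Y].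
have okZ : ok Z by rewrite /ok eZ subxx.
case: (@arg_minnP _ Z ok (fun Y => #|Y|) okZ) => Y /and3P[eY YZ Yev] Ymin.
apply/bigcupP; exists Y => //; rewrite inE YZ andbT; apply/minsetP; split.
  apply/dependentE; exists Y; split=> //.
  by apply/set0Pn; exists e.
move=> B /dependentE[Y' [Y'B Y'0 Y'ev]] BY; have Y'Y := subset_trans Y'B BY.
have [eY'|eY'] := boolP (e \in Y').
  have := Ymin Y'; rewrite /ok eY' Y'ev (subset_trans Y'Y YZ) => /(_ isT) le.
  have Y'E : Y' = Y by apply/eqP; rewrite eqEcard Y'Y.
  by apply/eqP; rewrite eqEsubset BY -Y'E.
have DE : symd Y Y' = Y :\: Y'.
  by rewrite /symd (eqP (_ : Y' :\: Y == set0)) ?setU0 ?setD_eq0.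
have := Ymin (Y :\: Y'); rewrite /ok inE eY eY' (subset_trans (subsetDl _ _) YZ).
rewrite -{1}DE even_symd // => /(_ isT); rewrite leqNgt => /negP[].
apply: proper_card; rewrite properEneq subsetDl andbT; apply/eqP => YE.
have /set0Pn[f fY'] := Y'0.
by have := subsetP Y'Y f fY'; rewrite -YE inE fY'.
Qed.

(** Removing the edges of a base [B] maps even sets bijectively to the subsets of its complement:
    [B] contains no nonempty even set, and the fundamental cycles [D e] sum to any prescribed
    trace. *)
Lemma card_cyc_corank : #|cyc h [set: edge G]| = 2 ^ corank M.
Proof.
have [B iB cB] : exists2 B, indep M B & #|B| = rank M.
  have [|B iB Bmax] := @eq_bigmax_cond _ (indep M) (fun B : {set edge G} => #|B|).
    by apply/card_gt0P; exists set0; apply: indep0.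
  by exists B => //; rewrite -Bmax.
have rk Y : indep M Y -> #|Y| <= #|B|.
  by move=> iY; rewrite cB; apply: (@leq_bigmax_cond _ (indep M) (fun A : {set edge G} => #|A|)).
have indB Y : Y \subset B -> even h Y -> Y = set0.
  move=> YB Yev; apply/eqP; apply: contraTT iB => Y0.
  by apply/dependentE; exists Y.
pose D e := odflt set0 [pick Y : {set edge G} | [&& e \in Y, Y \subset e |: B & even h Y]].
have DP e : e \in ~: B -> [/\ e \in D e, D e \subset e |: B & even h (D e)].
  rewrite inE => eB; rewrite /D; case: pickP => [Y /and3P[? ? ?]//|no].
  have : dependent M (e |: B).
    by apply/negP => /rk; rewrite cardsU1 eB ltnn.
  case/dependentE=> Y [YB Y0 Yev]; have := no Y; rewrite YB Yev !andbT => eY.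
  case/eqP: Y0; apply: indB Yev; apply/subsetP => f fY.
  have := subsetP YB f fY; rewrite in_setU1 => /orP[/eqP fe|//].
  by rewrite -fe fY in eY.
have co : corank M = #|~: B| by rewrite cardsCs setCK /corank cB.
rewrite co -card_powerset -(card_in_imset (f := fun Z => Z :\: B)).
  congr #|pred_of_set _|; apply/setP => T; apply/imsetP/idP => [[Z _ ->]|].
    by rewrite inE setDE subsetIr.
  rewrite inE => TB; exists (fsum D T).
    by apply: cyc_fsum => e /(subsetP TB)/DP[_ _ De]; rewrite inE subsetT.
  apply/setP => e; rewrite inE; have [eB|eB] /= := boolP (e \in B).
    by apply/negP => /(subsetP TB); rewrite inE eB.
  rewrite inE cntE; have eD f : f \in T -> (e \in D f) = (e == f).
    move=> /(subsetP TB)/DP[fD sD _]; apply/idP/eqP => [/(subsetP sD)|->//].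
    by rewrite in_setU1 (negPf eB) orbF => /eqP.
  have -> : [set f in T | e \in D f] = T :&: [set e].
    apply/setP => f; rewrite !inE; have [fT|//] := boolP (f \in T).
    by rewrite eD // eq_sym.
  have [eT|eT] := boolP (e \in T).
    by rewrite (setIidPr _) ?sub1set // cards1.
  rewrite (_ : T :&: [set e] = set0) ?cards0 //; apply/setP => f; rewrite !inE.
  by case: eqP => [->|]; rewrite ?(negPf eT) ?andbF.
move=> Z Z' /cycP[_ Zev] /cycP[_ Z'ev] eZ; have D0 : symd Z Z' = set0.
  apply: indB; last by apply: even_symd; apply/evenP.
  apply/subsetP => e; rewrite in_symd; apply: contraTT => eB.
  by have := congr1 (fun A : {set edge G} => e \in A) eZ; rewrite !inE eB /= => ->; rewrite addbb.
by rewrite -(symdK Z Z') D0 symdC symd0.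
Qed.

(** The kept edges are chosen between different branch sets, so none of them lies inside a branch
    set, and the connections there use contracted edges only. *)
Lemma no_K33_minor : K33_free G -> ~ has_K33 (er h [set: edge G]).
Proof.
move=> free [B [dB cB aB]]; apply: free.
pose ok (ij : 'I_3 * 'I_3) e := [exists a in B (inl ij.1), exists b in B (inr ij.2), joins h e a b].
have ex ij : exists e, ok ij e.
  case: ij => i j; have /adjP[a [b [aA bB /erP[_ [e _ eab]]]]] := aB i j.
  by exists e; apply/exists_inP; exists a => //; apply/exists_inP; exists b.
pose f (ij : edge K33) : edge G := xchoose (ex ij).
have fP ij : exists a b, [/\ a \in B (inl ij.1), b \in B (inr ij.2)
    & ends (f ij) = [set a; b]].
  have /exists_inP[a aA /exists_inP[b bB]] := xchooseP (ex ij).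
  by rewrite (joins_ends hE) => /eqP; exists a, b.
have same x s t : x \in B s -> x \in B t -> s = t.
  by move=> xs xt; apply/eqP; apply: contraT => st; have := disjointFr (dB s t st) xs; rewrite xt.
exists B, f; split=> //.
- move=> [i j] [i' j'] eqf; have [a [b [aA bB eab]]] := fP (i, j).
  have [a' [b' [aA' bB' eab']]] := fP (i', j'); rewrite -eqf eab in eab'.
  case: (set2_eq eab') => -[e1 e2]; rewrite -?e1 -?e2 in aA' bB'.
    by have [->] := same _ _ _ aA aA'; have [->] := same _ _ _ bB bB'.
  by have := same _ _ _ bB aA'.
- case=> [i|j].
    by have /adjP[a [b [? _ _]]] := aB i ord0; apply/set0Pn; exists a.
  by have /adjP[a [b [_ ? _]]] := aB ord0 j; apply/set0Pn; exists b.
- move=> s a b aA bB; apply: connect_sub (connP (cB s) a b aA bB) => x y.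
  case/and3P=> /erP[_ [e _ exy]] xs ys; apply: connect1; apply/exists_inP; exists e; last first.
    by rewrite -(joins_ends hE).
  have eE : ends e = [set x; y] by apply/eqP; rewrite -(joins_ends hE).
  rewrite inE eE subUset !sub1set xs ys !andbT; apply/negP => /codomP[ij eij].
  have [a' [b' [aA' bB' eab]]] := fP ij; rewrite -eij eE in eab.
  case: (set2_eq eab) => -[e1 e2]; rewrite -e1 -e2 in aA' bB'.
    by have := same _ _ _ xs aA'; rewrite (same _ _ _ ys bB').
  by have := same _ _ _ ys aA'; rewrite (same _ _ _ xs bB').
- move=> [i j]; have [a [b [aA bB eab]]] := fP (i, j); rewrite eab; split.
    rewrite subUset !sub1set; apply/andP; split; apply/bigcupP.
      by exists (inl i).
    by exists (inr j).
  apply/setP => s; rewrite !inE; apply/orP/pred0Pn => [[/eqP->|/eqP->]|[x /= /andP[xs]]].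
  + by exists a; rewrite /= aA set21.
  + by exists b; rewrite /= bB set22.
  + by rewrite !inE => /orP[]/eqP xE; rewrite xE in xs;
      [left; rewrite (same _ _ _ xs aA) | right; rewrite (same _ _ _ xs bB)].
Qed.

End CycleMatroid.

Theorem corollary3p17 (G : mgraph) (hG : K33_free G) :
  has_cycle_system (cycle_matroid G).
Proof.
have ex (e : edge G) : exists p : G * G, ends e == [set p.1; p.2].
  by have [u [v ->]] := endsE e; exists (u, v).
pose h e := xchoose (ex e); have hE e : ends e = [set (h e).1; (h e).2].
  exact: eqP (xchooseP (ex e)).
(* With corank 0 there may be no edge at which to ask for a system, but the empty family works. *)
have [c0|] := posnP (corank (cycle_matroid G)).
  have no (i : 'I_(corank (cycle_matroid G))) : False by have := ltn_ord i; rewrite [X in _ < X]c0.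
  exists (fun _ => set0); split=> [i|s /set0Pn[i _]]; by case: (no i).
move=> c_gt0; have /card_gt0P[e _] : 0 < #|edge G| by apply: leq_trans c_gt0 (leq_subr _ _).
have [I [J [C [Ccyc span uniq _]]]] := K33_free_system (no_K33_minor hE hG) e.
have ind (t : {set I}) : t \subset J -> t != set0 -> fsum C t != set0.
  move=> tJ t0; have [Y [_ /set0Pn[f fY] Yu]] := uniq t tJ t0.
  by apply/set0Pn; exists f; rewrite inE Yu.
(* The sums over subsets of [J] are distinct and exhaust the even sets, so both sides are the
   exponent of the same power of 2. *)
have cJ : corank (cycle_matroid G) = #|J|.
  apply/eqP; rewrite -(eqn_exp2l (m := 2)) // -(card_cyc_corank hE) -card_powerset.
  rewrite -(card_in_imset (fsum_inj ind)); apply/eqP; congr #|pred_of_set _|.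
  apply/setP => Z; apply/idP/imsetP => [/span[s sJ ->]|[s]].
    by exists s; rewrite // inE.
  by rewrite inE => /subsetP sJ ->; apply: cyc_fsum => i /sJ/Ccyc.
pose g (i : 'I_(corank (cycle_matroid G))) : I := enum_val (cast_ord cJ i).
have g_inj : injective g by move=> i j /enum_val_inj/cast_ord_inj.
have gJ i : g i \in J by apply: enum_valP.
exists (fun i => C (g i)); split=> [i|s s0].
  by apply: (even_is_cycle hE); have /cycP[_ /evenP] := Ccyc _ (gJ i).
have [||Y [/cycP[_ /evenP Yev] Y0 Yu]] := uniq (g @: s).
- by apply/subsetP => _ /imsetP[i _ ->].
- by have /set0Pn[i iS] := s0; apply/set0Pn; exists (g i); apply: imset_f.
apply/(dependentE hE); exists Y; split=> //; apply/subsetP => f /Yu.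
rewrite inE -cntE /cnt big_imset /=; last by move=> i j _ _; apply: g_inj.
by move=> ->.
Qed.
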